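(* Suppose that $-1<z_t(t)<1$ for all $t\ge 0$ and $z(0)=0$, and that $|\lambda(t)|^2(1-z_t(t))\le 1+z_t(t)$ for all $t\ge 0$. Let $(u_0,v_0)\in C^1([0,\infty))$ have compact support in $[0,\infty)$ and satisfy the compatibility conditions $$u_0(0)=\lambda(0)v_0(0)$$ and $$(1-z_t(0))u_{0x}(0)+\lambda(0)(1+z_t(0))v_{0x}(0)+i\lambda(0)\big(mu_0(0)-N_2(u_0(0),v_0(0))\big)-i\big(mv_0(0)-N_1(u_0(0),v_0(0))\big)+\lambda_t(0)v_0(0)=0.$$ Then the initial boundary value problem $$i(u_t+u_x)=-mv+N_1(u,v),\qquad i(v_t-v_x)=-mu+N_2(u,v)\quad\text{in }\Omega,$$ $$(u(x,0),v(x,0))=(u_0(x),v_0(x)),\ x\ge 0,\qquad u(z(t),t)=\lambda(t)v(z(t),t),\ t\ge 0,$$ has a unique global solution $(u,v)\in C^1(\overline{\Omega})$.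
   Context: Here $m\ge 0$ and $\alpha,\beta\in\mathbb{R}$ are constants, and $z(t)$ and $\lambda(t)$ are given functions of $t\ge 0$ ($z$ real valued), with the notation $z_t=dz/dt$, $\lambda_t=d\lambda/dt$. The domain is $\Omega=\{(x,t): t\ge 0,\ x\ge z(t)\}$. The unknowns $u,v$ and the data $u_0,v_0$ are complex valued; subscripts $x,t$ denote derivatives, and the bar on functions denotes complex conjugation. The nonlinear terms are $$N_1(u,v)=\alpha u|v|^2+2\beta v(\overline{u}v+u\overline{v}),\qquad N_2(u,v)=\alpha v|u|^2+2\beta u(\overline{u}v+u\overline{v}).$$ $\overline{\Omega}$ is the closure of $\Omega$.
   Formalization: The functions z and λ are assumed continuously differentiable on [0,∞) (one-sided at 0); with z_t or λ_t merely existing but discontinuous, the boundary condition u=λv can force a solution that is not C^1. *)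

(* Defs.v *)
From Stdlib Require Export Reals.
From Coquelicot Require Export Coquelicot.
Open Scope R_scope.

Definition interior_of {T : UniformSpace} (D : T -> Prop) (p : T) : Prop :=
  locally p D.

Definition closure_of {T : UniformSpace} (D : T -> Prop) (p : T) : Prop :=
  forall P : T -> Prop, locally p P -> exists q : T, P q /\ D q.

Definition half_line (t : R) : Prop := 0 <= t.

(** [df] is the derivative of [f] on [0, +oo), one-sided at 0, and both are
    continuous there.  Values at negative arguments are irrelevant. *)
Definition C1_half_line {V : NormedModule R_AbsRing} (f df : R -> V) : Prop :=
  (forall t : R, 0 <= t ->
     filterdiff f (within half_line (locally t)) (fun h : R => scal h (df t))) /\
  continuous_on half_line df.

Definition compactly_supported_half_line (f : R -> C) : Prop :=
  exists M : R, forall x : R, 0 <= x -> M < x -> f x = RtoC 0.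

(** Points of the plane are pairs [(x, t)].  [f] is of class C^1 on the closure
    of [D]: the partial derivatives of [f] in the interior of [D] are [fx] and
    [ft], and [f], [fx], [ft] are continuous up to the boundary.  Values outside
    the closure are irrelevant. *)
Definition C1_closure (D : R * R -> Prop) (f fx ft : R * R -> C) : Prop :=
  continuous_on (closure_of D) f /\
  continuous_on (closure_of D) fx /\
  continuous_on (closure_of D) ft /\
  (forall x t : R, interior_of D (x, t) ->
     is_derive (fun y : R => f (y, t)) x (fx (x, t)) /\
     is_derive (fun s : R => f (x, s)) t (ft (x, t))).

Definition Omega (z : R -> R) (p : R * R) : Prop :=
  0 <= snd p /\ z (snd p) <= fst p.

Definition N1 (alpha beta : R) (u v : C) : C :=
  (RtoC alpha * u * RtoC (Cmod v ^ 2)%R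
   + RtoC 2 * RtoC beta * v * (Cconj u * v + u * Cconj v))%C.

Definition N2 (alpha beta : R) (u v : C) : C :=
  (RtoC alpha * v * RtoC (Cmod u ^ 2)%R
   + RtoC 2 * RtoC beta * u * (Cconj u * v + u * Cconj v))%C.

(** At boundary points of [Omega z] the derivatives in the equations are the
    continuous extensions provided by [C1_closure]. *)
Definition global_C1_solution (m alpha beta : R) (z : R -> R)
    (lambda u0 v0 : R -> C) (u v : R * R -> C) : Prop :=
  exists ux ut vx vt : R * R -> C,
    C1_closure (Omega z) u ux ut /\
    C1_closure (Omega z) v vx vt /\
    (forall p : R * R, Omega z p ->
       (Ci * (ut p + ux p) = - (RtoC m * v p) + N1 alpha beta (u p) (v p))%C /\
       (Ci * (vt p - vx p) = - (RtoC m * u p) + N2 alpha beta (u p) (v p))%C) /\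
    (forall x : R, 0 <= x -> u (x, 0) = u0 x /\ v (x, 0) = v0 x) /\
    (forall t : R, 0 <= t -> u (z t, t) = (lambda t * v (z t, t))%C).

(* Main.v *)
Require Import Defs.
From Stdlib Require Import Reals Lra Lia Psatz ClassicalEpsilon.
From Coquelicot Require Import Coquelicot.
Open Scope R_scope.

(** In the coordinates [a = (x + t) / 2], [b = (t - x) / 2] the system becomes
    [U_a = F(U, V)], [V_b = F(V, U)] with one and the same cubic [F], because [N1]
    is [N2] with its arguments exchanged.  So [V] is obtained by integrating its
    source in [b] from the initial line, and [U] by integrating its source in [a]
    from the point where the characteristic enters the domain, on the initial line
    or on the boundary, where [U] is given by the entering value of [V].  Since the
    boundary is slower than the characteristics, this system of integral equations
    is causal: for globally Lipschitz sources Picard iteration converges on every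
    backward triangle [x + 2 t <= N] ([mild_existence]), and its solution is unique
    ([mild_uniqueness]).

    The cubic sources are made Lipschitz by scaling the pair [(U, V)] back into a
    large ball ([cut_src]).  This does not disturb the algebra behind the
    conservation of charge: [|U|^2] and [|V|^2] still have opposite growth rates
    along their characteristics, and the condition on [lambda] says exactly that the
    boundary does not emit charge.  Integrating over a backward triangle bounds the
    integral of [|V|^2] along every forward characteristic, and that of [|U|^2]
    along every backward one, by the initial charge ([charge_bound]).  As
    [Im (conj U * N1)] is at most a multiple of [|U|^2 |V|^2], the growth of
    [|U|^2] is linear with an integrable coefficient, and Gronwall's inequality
    bounds both fields independently of the ball ([back_wave_bound],
    [fwd_wave_bound]).  For a ball chosen beyond that bound the truncation is never
    active, so there is no blow-up to continue past.

    Along its own characteristics each field is differentiable by construction.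
    Across them, its derivative should solve the linearised integral equations;
    these have a solution [(P, Q)] by the same Picard theorem, whose continuity at
    the characteristic through the corner is the second compatibility condition.
    A Gronwall argument on difference quotients identifies [P] and [Q] with the
    missing derivatives ([is_derive_U], [is_derive_V]), which gives a classical
    solution on each triangle ([classical_upto_exists]).

    Conversely a classical solution satisfies the integral equations
    ([classical_is_mild]), so two of them agree ([classical_upto_unique]).  This
    proves uniqueness, and it lets the solutions on the triangles be patched into a
    global one ([global_of_classical]). *)

(** * Continuity of complex-valued maps *)

Lemma continuous_C_iff {X : UniformSpace} (f : X -> C) (x : X) :
  continuous f x <->
  continuous (fun y => Re (f y)) x /\ continuous (fun y => Im (f y)) x.
Proof.
  split.
  - intros H; split.
    + apply (continuous_comp f fst); [exact H|].
      destruct (f x); apply continuous_fst.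
    + apply (continuous_comp f snd); [exact H|].
      destruct (f x); apply continuous_snd.
  - intros [H1 H2].
    apply (continuous_ext (fun y => (Re (f y), Im (f y)))).
    { intros y; destruct (f y); reflexivity. }
    unfold continuous in *.
    apply (filterlim_pair (fun y => Re (f y)) (fun y => Im (f y)) H1) in H2.
    refine (filterlim_filter_le_2 _ _ H2).
    intros P [e He]. exists (ball (Re (f x)) e) (ball (Im (f x)) e).
    + now exists e.
    + now exists e.
    + intros u v Hu Hv. apply He. split; assumption.
Qed.

Lemma continuous_Rplus {X : UniformSpace} (f g : X -> R) x :
  continuous f x -> continuous g x -> continuous (fun y => f y + g y) x.
Proof. intros; now apply (continuous_plus (V := R_NormedModule)). Qed.

Lemma continuous_Ropp {X : UniformSpace} (f : X -> R) x :
  continuous f x -> continuous (fun y => - f y) x.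
Proof. intros; now apply (continuous_opp (V := R_NormedModule)). Qed.

Lemma continuous_Rminus {X : UniformSpace} (f g : X -> R) x :
  continuous f x -> continuous g x -> continuous (fun y => f y - g y) x.
Proof. intros; now apply (continuous_minus (V := R_NormedModule)). Qed.

Lemma continuous_Rmult {X : UniformSpace} (f g : X -> R) x :
  continuous f x -> continuous g x -> continuous (fun y => f y * g y) x.
Proof. intros; now apply (continuous_mult (K := R_AbsRing)). Qed.

Lemma continuous_Rfun {X : UniformSpace} (h : R -> R) (f : X -> R) x :
  continuous f x -> continuous h (f x) -> continuous (fun y => h (f y)) x.
Proof. intros; now apply (continuous_comp f h). Qed.

Lemma continuous_Rmax {X : UniformSpace} (f g : X -> R) x :
  continuous f x -> continuous g x -> continuous (fun y => Rmax (f y) (g y)) x.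
Proof.
  intros Hf Hg.
  apply (continuous_ext (fun y => (f y + g y + Rabs (f y - g y)) * / 2)).
  { intros y; unfold Rmax, Rabs; destruct (Rle_dec _ _), (Rcase_abs _); lra. }
  apply continuous_Rmult; [|apply continuous_const].
  apply continuous_Rplus; [now apply continuous_Rplus|].
  apply continuous_Rfun; [now apply continuous_Rminus|apply continuous_Rabs].
Qed.

Lemma continuous_Rmin {X : UniformSpace} (f g : X -> R) x :
  continuous f x -> continuous g x -> continuous (fun y => Rmin (f y) (g y)) x.
Proof.
  intros Hf Hg.
  apply (continuous_ext (fun y => - Rmax (- f y) (- g y))).
  { intros y; unfold Rmax, Rmin; repeat destruct (Rle_dec _ _); lra. }
  apply continuous_Ropp, continuous_Rmax; now apply continuous_Ropp.
Qed.

Lemma continuous_Rdiv {X : UniformSpace} (f g : X -> R) x :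
  continuous f x -> continuous g x -> g x <> 0 -> continuous (fun y => f y / g y) x.
Proof.
  intros Hf Hg H. apply continuous_Rmult; [exact Hf|].
  now apply continuous_Rfun with (h := Rinv); [|apply continuous_Rinv].
Qed.

Lemma continuous_Re {X : UniformSpace} (f : X -> C) x :
  continuous f x -> continuous (fun y => Re (f y)) x.
Proof. intros H; now apply continuous_C_iff in H. Qed.

Lemma continuous_Im {X : UniformSpace} (f : X -> C) x :
  continuous f x -> continuous (fun y => Im (f y)) x.
Proof. intros H; now apply continuous_C_iff in H. Qed.

Lemma continuous_RtoC {X : UniformSpace} (f : X -> R) x :
  continuous f x -> continuous (fun y => RtoC (f y)) x.
Proof.
  intros H; apply continuous_C_iff; split; [exact H|apply continuous_const].
Qed.

Lemma continuous_Cplus {X : UniformSpace} (f g : X -> C) x :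
  continuous f x -> continuous g x -> continuous (fun y => (f y + g y)%C) x.
Proof.
  rewrite !continuous_C_iff; intros [? ?] [? ?]; split; now apply continuous_Rplus.
Qed.

Lemma continuous_Copp {X : UniformSpace} (f : X -> C) x :
  continuous f x -> continuous (fun y => (- f y)%C) x.
Proof.
  rewrite !continuous_C_iff; intros [? ?]; split; now apply continuous_Ropp.
Qed.

Lemma continuous_Cminus {X : UniformSpace} (f g : X -> C) x :
  continuous f x -> continuous g x -> continuous (fun y => (f y - g y)%C) x.
Proof. intros; apply continuous_Cplus; [|apply continuous_Copp]; assumption. Qed.

Lemma continuous_Cmult {X : UniformSpace} (f g : X -> C) x :
  continuous f x -> continuous g x -> continuous (fun y => (f y * g y)%C) x.
Proof.
  rewrite !continuous_C_iff; intros [? ?] [? ?]; split; simpl.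
  - apply continuous_Rminus; now apply continuous_Rmult.
  - apply continuous_Rplus; now apply continuous_Rmult.
Qed.

Lemma continuous_Cconj {X : UniformSpace} (f : X -> C) x :
  continuous f x -> continuous (fun y => Cconj (f y)) x.
Proof.
  rewrite !continuous_C_iff; intros [? ?]; split; simpl; [|apply continuous_Ropp];
  assumption.
Qed.

Lemma continuous_Cmod {X : UniformSpace} (f : X -> C) x :
  continuous f x -> continuous (fun y => Cmod (f y)) x.
Proof.
  rewrite continuous_C_iff; intros [H1 H2]. unfold Cmod.
  apply (continuous_Rfun sqrt); [|apply continuous_sqrt].
  apply continuous_Rplus; simpl; apply continuous_Rmult; try assumption;
  apply continuous_Rmult; try assumption; apply continuous_const.
Qed.

Definition cont2 {E : UniformSpace} (f : R -> R -> E) : Prop :=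
  forall p : R * R, continuous (fun q : R * R => f (fst q) (snd q)) p.

Lemma cont2_comp {X E : UniformSpace} (f : R -> R -> E) (g h : X -> R) x :
  cont2 f -> continuous g x -> continuous h x -> continuous (fun y => f (g y) (h y)) x.
Proof. intros Hf Hg Hh. now apply (continuous_comp_2 g h f). Qed.

Lemma continuous_pfst (p : R * R) : continuous (fun q : R * R => fst q) p.
Proof. destruct p; apply continuous_fst. Qed.

Lemma continuous_psnd (p : R * R) : continuous (fun q : R * R => snd q) p.
Proof. destruct p; apply continuous_snd. Qed.

Lemma continuous_1 {X E : UniformSpace} (f : R -> E) (g : X -> R) x :
  (forall y, continuous f y) -> continuous g x -> continuous (fun y => f (g y)) x.
Proof. intros Hf Hg; now apply (continuous_comp g f). Qed.

(** The clauses for partially applied operations are there because unification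
    leaves eta-reduced functions behind. *)
Ltac cont :=
  cbv beta;
  match goal with
  | |- cont2 _ => intros ?; cont
  | H : cont2 ?f |- continuous (fun q => ?f (fst q) (snd q)) _ => exact (H _)
  | H : cont2 ?f |- continuous (fun y => ?f _ _) _ => apply (cont2_comp f _ _ _ H); cont
  | H : cont2 ?f |- continuous (?f ?a) ?x =>
      apply (cont2_comp f (fun _ => a) (fun y => y) x H); cont
  | H : forall y, continuous ?f y |- continuous ?f _ => exact (H _)
  | H : forall y, continuous ?f y |- continuous (fun y => ?f _) _ =>
      apply (continuous_1 f _ _ H); cont
  | |- continuous (fun y => ?c) _ => apply continuous_const
  | |- continuous (fun y => y) _ => apply continuous_id
  | |- continuous fst _ => apply continuous_pfst
  | |- continuous snd _ => apply continuous_psnd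
  | |- continuous (Rmult ?a) ?x => apply (continuous_Rmult (fun _ => a) (fun y => y) x); cont
  | |- continuous (Rplus ?a) ?x => apply (continuous_Rplus (fun _ => a) (fun y => y) x); cont
  | |- continuous (Rminus ?a) ?x => apply (continuous_Rminus (fun _ => a) (fun y => y) x); cont
  | |- continuous Ropp ?x => apply (continuous_Ropp (fun y => y) x), continuous_id
  | |- continuous (fun q => fst q) _ => apply continuous_pfst
  | |- continuous (fun q => snd q) _ => apply continuous_psnd
  | |- continuous (fun y => (_ + _)%R) _ => apply continuous_Rplus; cont
  | |- continuous (fun y => (_ - _)%R) _ => apply continuous_Rminus; cont
  | |- continuous (fun y => (- _)%R) _ => apply continuous_Ropp; cont
  | |- continuous (fun y => (_ * _)%R) _ => apply continuous_Rmult; cont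
  | |- continuous (fun y => Rmax _ _) _ => apply continuous_Rmax; cont
  | |- continuous (fun y => Rmin _ _) _ => apply continuous_Rmin; cont
  | |- continuous (fun y => (_ + _)%C) _ => apply continuous_Cplus; cont
  | |- continuous (fun y => (_ - _)%C) _ => apply continuous_Cminus; cont
  | |- continuous (fun y => (- _)%C) _ => apply continuous_Copp; cont
  | |- continuous (fun y => (_ * _)%C) _ => apply continuous_Cmult; cont
  | |- continuous (fun y => Cconj _) _ => apply continuous_Cconj; cont
  | |- continuous (fun y => RtoC _) _ => apply continuous_RtoC; cont
  | |- continuous (fun y => Cmod _) _ => apply continuous_Cmod; cont
  | |- continuous (fun y => Re _) _ => apply continuous_Re; cont
  | |- continuous (fun y => Im _) _ => apply continuous_Im; cont
  | _ => try assumption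
  end.

Lemma Cmod_sub_sym (x y : C) : Cmod (x - y)%C = Cmod (y - x)%C.
Proof. rewrite <- Cmod_opp; f_equal; ring. Qed.


Lemma Cmod_sq (x : C) : Cmod x * Cmod x = Re x * Re x + Im x * Im x.
Proof. generalize (Cmod2_alt x); simpl; rewrite !Rmult_1_r; auto. Qed.

Lemma Cmod_le_Re_Im (x : C) : Cmod x <= Rabs (Re x) + Rabs (Im x).
Proof.
  generalize (Rabs_pos (Re x)) (Rabs_pos (Im x)) (Cmod_ge_0 x) (Cmod_sq x); intros.
  assert (Rabs (Re x) * Rabs (Re x) = Re x * Re x)
    by (rewrite <- Rabs_mult; apply Rabs_pos_eq; nra).
  assert (Rabs (Im x) * Rabs (Im x) = Im x * Im x)
    by (rewrite <- Rabs_mult; apply Rabs_pos_eq; nra).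
  nra.
Qed.

Lemma Im_le_Cmod (x : C) : Rabs (Im x) <= Cmod x.
Proof.
  eapply Rle_trans; [|apply Rmax_Cmod]. apply Rmax_r.
Qed.

Lemma continuous_C_eps {X : UniformSpace} (f : X -> C) (x : X) :
  continuous f x <->
  forall e, 0 < e -> locally x (fun y => Cmod (f y - f x)%C < e).
Proof.
  split.
  - intros H e He.
    assert (Hc : continuous (fun y => Cmod (f y - f x)%C) x) by cont.
    specialize (Hc (fun r => r < e)).
    apply Hc. exists (mkposreal e He). intros y Hy.
    replace (Cmod (f x - f x)%C) with 0 in Hy
      by (replace (f x - f x)%C with (RtoC 0) by ring; now rewrite Cmod_0).
    apply Rabs_lt_between in Hy. simpl in Hy.
    unfold minus, plus, opp in Hy; simpl in Hy. lra.
  - intros H. apply continuous_C_iff; split; intros P [e He];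
    (refine (filter_imp _ _ _ (H e (cond_pos e))); intros y Hy; apply He).
    + eapply Rle_lt_trans; [|exact Hy]. exact (re_le_Cmod (f y - f x)%C).
    + eapply Rle_lt_trans; [|exact Hy]. exact (Im_le_Cmod (f y - f x)%C).
Qed.

Lemma cont2_eps (f : R -> R -> C) :
  cont2 f <->
  forall a b e, 0 < e -> exists d, 0 < d /\ forall a' b',
    Rabs (a' - a) < d -> Rabs (b' - b) < d -> Cmod (f a' b' - f a b)%C < e.
Proof.
  split.
  - intros H a b e He.
    destruct (proj1 (continuous_C_eps _ (a, b)) (H (a, b)) e He) as [d Hd].
    exists d; split; [apply cond_pos|]. intros a' b' Ha Hb.
    apply (Hd (a', b')). split; assumption.
  - intros H [a b]. apply continuous_C_eps; intros e He.
    destruct (H a b e He) as [d [Hd H']].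
    exists (mkposreal d Hd). intros [a' b'] [Ha Hb]. now apply H'.
Qed.

Lemma cont2_continuity_2d (f : R -> R -> R) x y :
  cont2 f -> continuity_2d_pt f x y.
Proof.
  intros H. apply continuity_2d_pt_filterlim. exact (H (x, y)).
Qed.

Lemma box_uniform_continuity (f : R -> R -> C) (M e : R) :
  cont2 f -> 0 < e ->
  exists d, 0 < d /\ forall a b a' b',
    Rabs a <= M -> Rabs b <= M -> Rabs a' <= M -> Rabs b' <= M ->
    Rabs (a' - a) < d -> Rabs (b' - b) < d -> Cmod (f a' b' - f a b)%C < e.
Proof.
  intros Hf He.
  assert (He2 : 0 < e / 2) by lra.
  assert (H1 : cont2 (fun a b => Re (f a b))) by (intros p; cont).
  assert (H2 : cont2 (fun a b => Im (f a b))) by (intros p; cont).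
  destruct (uniform_continuity_2d _ (- M) M (- M) M
     (fun x y _ _ => cont2_continuity_2d _ x y H1) (mkposreal _ He2)) as [d1 Hd1].
  destruct (uniform_continuity_2d _ (- M) M (- M) M
     (fun x y _ _ => cont2_continuity_2d _ x y H2) (mkposreal _ He2)) as [d2 Hd2].
  exists (Rmin d1 d2); split.
  { apply Rmin_pos; apply cond_pos. }
  intros a b a' b' Ha Hb Ha' Hb' H3 H4.
  apply Rabs_le_between in Ha, Hb, Ha', Hb'.
  eapply Rle_lt_trans; [apply Cmod_le_Re_Im|].
  generalize (Rmin_l d1 d2) (Rmin_r d1 d2); intros.
  specialize (Hd1 a b a' b'). specialize (Hd2 a b a' b'). simpl in Hd1, Hd2.
  change (Re (f a' b' - f a b)%C) with (Re (f a' b') - Re (f a b)).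
  change (Im (f a' b' - f a b)%C) with (Im (f a' b') - Im (f a b)).
  assert (Rabs (Re (f a' b') - Re (f a b)) < e / 2) by (apply Hd1; lra).
  assert (Rabs (Im (f a' b') - Im (f a b)) < e / 2) by (apply Hd2; lra).
  lra.
Qed.

(** Uniform continuity carries the value at the origin to any point of the box in
    a number of steps fixed by the modulus. *)
Lemma box_bounded (f : R -> R -> C) (M : R) :
  cont2 f -> exists B, 0 <= B /\
    forall a b, Rabs a <= M -> Rabs b <= M -> Cmod (f a b) <= B.
Proof.
  intros Hf.
  destruct (box_uniform_continuity f M 1 Hf Rlt_0_1) as [d [Hd H]].
  assert (Hn : forall n : nat, forall a b, Rabs a <= M -> Rabs b <= M ->
     Rabs a <= INR n * (d / 2) -> Rabs b <= INR n * (d / 2) ->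
     Cmod (f a b) <= Cmod (f 0 0) + INR n).
  { induction n as [|n IH]; intros a b Ha Hb Ha' Hb'.
    - simpl in Ha', Hb'.
      assert (Rabs a = 0) by (generalize (Rabs_pos a); lra).
      assert (Rabs b = 0) by (generalize (Rabs_pos b); lra).
      assert (a = 0) by (destruct (Req_dec a 0) as [|Hx]; [auto|apply Rabs_no_R0 in Hx; lra]).
      assert (b = 0) by (destruct (Req_dec b 0) as [|Hx]; [auto|apply Rabs_no_R0 in Hx; lra]).
      subst; simpl; lra.
    - rewrite S_INR in *.
      assert (Hp : 0 <= INR n) by apply pos_INR.
      set (k := INR n / (INR n + 1)).
      assert (Hk : 0 <= k <= 1).
      { unfold k; split; [apply Rdiv_le_0_compat; lra|].
        apply Rle_div_l; lra. }
      assert (Hk1 : k * (INR n + 1) = INR n) by (unfold k; field; lra).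
      assert (Hsc : forall c, Rabs c <= M -> Rabs c <= (INR n + 1) * (d / 2) ->
                 Rabs (k * c) <= M /\ Rabs (k * c) <= INR n * (d / 2) /\
                 Rabs (c - k * c) < d).
      { intros c Hc Hc'. rewrite Rabs_mult, (Rabs_pos_eq k) by lra.
        replace (c - k * c) with ((1 - k) * c) by ring.
        rewrite Rabs_mult, (Rabs_pos_eq (1 - k)) by lra.
        generalize (Rabs_pos c); intros.
        split; [nra|]. split.
        - apply Rle_trans with (k * ((INR n + 1) * (d / 2))).
          apply Rmult_le_compat_l; lra. rewrite <- Rmult_assoc, Hk1. lra.
        - assert ((1 - k) * Rabs c <= (1 - k) * ((INR n + 1) * (d / 2))).
          apply Rmult_le_compat_l; lra.
          assert ((1 - k) * ((INR n + 1) * (d / 2)) = d / 2).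
          { replace ((1 - k) * ((INR n + 1) * (d / 2))) with
              ((INR n + 1) * (d/2) - (k * (INR n + 1)) * (d/2)) by ring.
            rewrite Hk1; ring. }
          lra. }
      destruct (Hsc a Ha Ha') as [A1 [A2 A3]].
      destruct (Hsc b Hb Hb') as [B1 [B2 B3]].
      specialize (IH _ _ A1 B1 A2 B2).
      specialize (H _ _ _ _ A1 B1 Ha Hb A3 B3).
      replace (f a b) with ((f a b - f (k * a)%R (k * b)%R) + f (k * a)%R (k * b)%R)%C by ring.
      eapply Rle_trans; [apply Cmod_triangle|]. lra. }
  destruct (nfloor_ex (Rabs M / (d / 2))) as [n [_ Hn2]].
  { apply Rdiv_le_0_compat; [apply Rabs_pos|lra]. }
  exists (Cmod (f 0 0) + INR (S n)); split.
  { generalize (Cmod_ge_0 (f 0 0)) (pos_INR (S n)); lra. }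
  assert (Rabs M <= INR (S n) * (d / 2)).
  { apply Rlt_div_l in Hn2; [|lra]. rewrite S_INR; lra. }
  assert (HM := Rle_abs M).
  intros a b Ha Hb. apply Hn; lra.
Qed.

Lemma interval_bounded (f : R -> C) (M : R) :
  (forall x, continuous f x) -> exists B, 0 <= B /\
    forall a, Rabs a <= M -> Cmod (f a) <= B.
Proof.
  intros Hf. destruct (box_bounded (fun a _ => f a) M) as [B [HB H]].
  { intros p; cont. }
  exists B; split; [exact HB|]. intros a Ha. now apply (H a a).
Qed.

Lemma continuous_continuity_pt (f : R -> R) x : continuous f x -> continuity_pt f x.
Proof. intros H; now apply continuity_pt_filterlim. Qed.

(** * Integrals of complex-valued functions *)

Definition CInt (f : R -> C) (a b : R) : C := @RInt C_R_CompleteNormedModule f a b.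

Lemma is_CInt (f : R -> C) (a b : R) :
  (forall x, continuous f x) -> @is_RInt C_R_NormedModule f a b (CInt f a b).
Proof.
  intros Hf. apply (RInt_correct (V := C_R_CompleteNormedModule)).
  apply (ex_RInt_continuous (V := C_R_CompleteNormedModule)). intros z _. apply Hf.
Qed.

Lemma CInt_Chasles (f : R -> C) (a b c : R) :
  (forall x, continuous f x) -> (CInt f a b + CInt f b c = CInt f a c)%C.
Proof.
  intros Hf. apply (RInt_Chasles (V := C_R_CompleteNormedModule));
  apply (ex_RInt_continuous (V := C_R_CompleteNormedModule)); intros z _; apply Hf.
Qed.

Lemma CInt_point (f : R -> C) (a : R) : CInt f a a = 0.
Proof. exact (RInt_point (V := C_R_CompleteNormedModule) a f). Qed.

Lemma CInt_minus (f g : R -> C) (a b : R) :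
  (forall x, continuous f x) -> (forall x, continuous g x) ->
  (CInt (fun x => f x - g x) a b = CInt f a b - CInt g a b)%C.
Proof.
  intros Hf Hg. apply (RInt_minus (V := C_R_CompleteNormedModule));
  apply (ex_RInt_continuous (V := C_R_CompleteNormedModule)); intros z _;
  [apply Hf|apply Hg].
Qed.

Lemma CInt_const (c : C) (a b : R) : CInt (fun _ => c) a b = (RtoC (b - a) * c)%C.
Proof.
  unfold CInt. rewrite (RInt_const (V := C_R_CompleteNormedModule)).
  destruct c as [x y]. unfold scal; simpl; unfold prod_scal, scal; simpl.
  unfold mult; simpl. unfold Cmult; simpl. f_equal; ring.
Qed.

Lemma norm_Cmod (x : C) : @norm R_AbsRing C_R_NormedModule x = Cmod x.
Proof.
  unfold norm; simpl. unfold prod_norm, Cmod. f_equal.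
  unfold norm; simpl. unfold abs; simpl. rewrite !Rmult_1_r, <- !Rabs_mult.
  rewrite !Rabs_pos_eq by apply Rle_0_sqr. reflexivity.
Qed.

Lemma Cmod_CInt_le (f : R -> C) (g : R -> R) (a b : R) :
  a <= b -> (forall x, continuous f x) -> (forall x, continuous g x) ->
  (forall x, a <= x <= b -> Cmod (f x) <= g x) -> Cmod (CInt f a b) <= RInt g a b.
Proof.
  intros Hab Hf Hg H.
  rewrite <- norm_Cmod.
  apply (norm_RInt_le (V := C_R_NormedModule) f g a b _ _ Hab);
    [intros x Hx; rewrite norm_Cmod; now apply H|now apply is_CInt|].
  apply (RInt_correct (V := R_CompleteNormedModule)).
  apply (ex_RInt_continuous (V := R_CompleteNormedModule)). intros z _; apply Hg.
Qed.

Lemma Cmod_CInt_le_const (f : R -> C) (M a b : R) :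
  (forall x, continuous f x) ->
  (forall x, Rmin a b <= x <= Rmax a b -> Cmod (f x) <= M) ->
  Cmod (CInt f a b) <= Rabs (b - a) * M.
Proof.
  intros Hf H. rewrite <- norm_Cmod.
  apply (norm_RInt_le_const_abs (V := C_R_NormedModule) f a b);
    [intros x Hx; rewrite norm_Cmod; now apply H|now apply is_CInt].
Qed.

Lemma is_derive_CInt (f : R -> C) (a x : R) :
  (forall x, continuous f x) ->
  is_derive (fun b => CInt f a b) x (f x).
Proof.
  intros Hf.
  apply (is_derive_RInt (V := C_R_NormedModule) f (fun b => CInt f a b) a x).
  - exists (mkposreal 1 Rlt_0_1). intros y _. now apply is_CInt.
  - apply Hf.
Qed.


Lemma is_linear_scal_C (l : C) :
  is_linear (U := R_NormedModule) (V := C_R_NormedModule) (fun y : R => scal y l).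
Proof. apply (is_linear_scal_l (V := C_R_NormedModule)). Qed.

Lemma is_derive_C_iff (f : R -> C) (x : R) (l : C) :
  is_derive f x l <->
  is_derive (fun y => Re (f y)) x (Re l) /\ is_derive (fun y => Im (f y)) x (Im l).
Proof.
  split.
  - intros [Hl H]. split; (split; [apply (is_linear_scal_l (V := R_NormedModule))|]);
    intros y Hy e; specialize (H y Hy e);
    (refine (filter_imp _ _ _ H); intros t Ht; eapply Rle_trans; [|exact Ht]).
    + rewrite norm_Cmod. eapply Rle_trans; [|apply re_le_Cmod].
      apply Req_le. unfold norm; simpl. unfold abs; simpl. f_equal.
    + rewrite norm_Cmod. eapply Rle_trans; [|apply Im_le_Cmod].
      apply Req_le. unfold norm; simpl. unfold abs; simpl. f_equal.
  - intros [[_ H1] [_ H2]]. split; [apply is_linear_scal_C|].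
    intros y Hy e.
    assert (He : 0 < e / 2) by (generalize (cond_pos e); lra).
    specialize (H1 y Hy (mkposreal _ He)). specialize (H2 y Hy (mkposreal _ He)).
    refine (filter_imp _ _ _ (filter_and _ _ H1 H2)). intros t [Ht1 Ht2].
    rewrite norm_Cmod. eapply Rle_trans; [apply Cmod_le_Re_Im|].
    simpl in Ht1, Ht2.
    match type of Ht1 with (?u <= _ ) => match goal with |- ?v + _ <= _ => change v with u end end.
    match type of Ht2 with (?u <= _ ) => match goal with |- _ + ?v <= _ => change v with u end end.
    lra.
Qed.

Lemma is_derive_add_const (c : C) (f : R -> C) (x : R) (l : C) :
  is_derive f x l -> is_derive (fun y => (c + f y)%C) x l.
Proof.
  intros H. apply is_derive_C_iff in H. destruct H as [H1 H2]. apply is_derive_C_iff. split.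
  - evar_last; [apply (is_derive_plus (K := R_AbsRing) (V := R_NormedModule) (fun _ => Re c)
      (fun y => Re (f y))); [apply is_derive_const|exact H1]|]. apply Rplus_0_l.
  - evar_last; [apply (is_derive_plus (K := R_AbsRing) (V := R_NormedModule) (fun _ => Im c)
      (fun y => Im (f y))); [apply is_derive_const|exact H2]|]. apply Rplus_0_l.
Qed.

(** The hypotheses on the two partial derivatives differ on purpose: along its own
    characteristics a field is differentiable everywhere, across them it is only
    differentiated at the point itself. *)
Lemma is_derive_along_curve (f fx : R -> R -> C) (fy : C) (X Y : R -> R) (s dX dY : R) :
  locally (X s, Y s) (fun p : R * R =>
     is_derive (fun w => f w (snd p)) (fst p) (fx (fst p) (snd p))) ->
  is_derive (fun w => f (X s) w) (Y s) fy ->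
  continuous (fun p : R * R => fx (fst p) (snd p)) (X s, Y s) ->
  is_derive X s dX -> is_derive Y s dY ->
  is_derive (fun r => f (X r) (Y r)) s (RtoC dX * fx (X s) (Y s) + RtoC dY * fy)%C.
Proof.
  intros Hx Hy Hc HX HY.
  assert (real_case : forall (g gx : R -> R -> R) (gy : R),
    locally (X s, Y s) (fun p : R * R =>
       is_derive (fun w => g w (snd p)) (fst p) (gx (fst p) (snd p))) ->
    is_derive (fun w => g (X s) w) (Y s) gy ->
    continuous (fun p : R * R => gx (fst p) (snd p)) (X s, Y s) ->
    is_derive (fun r => g (X r) (Y r)) s (dX * gx (X s) (Y s) + dY * gy)).
  { intros g gx gy H1 H2 H3.
    generalize (is_derive_filterdiff g (X s) (Y s) gx gy H1 H2 H3); intros H4.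
    generalize (filterdiff_comp'_2 X Y g s (fun h => scal h dX) (fun h => scal h dY)
      (fun u v => plus (scal u (gx (X s) (Y s))) (scal v gy)) HX HY H4); intros H5.
    refine (filterdiff_ext_lin _ _ _ H5 _).
    intros y. unfold scal, plus; simpl. unfold mult; simpl. ring. }
  apply is_derive_C_iff. apply is_derive_C_iff in Hy.
  apply continuous_C_iff in Hc. destruct Hy as [Hy1 Hy2], Hc as [Hc1 Hc2].
  replace (Re (RtoC dX * fx (X s) (Y s) + RtoC dY * fy)%C)
    with (dX * Re (fx (X s) (Y s)) + dY * Re fy) by (simpl; unfold Re; ring).
  replace (Im (RtoC dX * fx (X s) (Y s) + RtoC dY * fy)%C)
    with (dX * Im (fx (X s) (Y s)) + dY * Im fy) by (simpl; unfold Im; ring).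
  split.
  - apply (real_case (fun a b => Re (f a b)) (fun a b => Re (fx a b)) (Re fy)); try easy.
    refine (filter_imp _ _ _ Hx). intros p Hp. now apply is_derive_C_iff in Hp.
  - apply (real_case (fun a b => Im (f a b)) (fun a b => Im (fx a b)) (Im fy)); try easy.
    refine (filter_imp _ _ _ Hx). intros p Hp. now apply is_derive_C_iff in Hp.
Qed.

Lemma continuous_R_eps {X : UniformSpace} (f : X -> R) (x : X) :
  continuous f x -> forall e, 0 < e -> locally x (fun y => Rabs (f y - f x) < e).
Proof.
  intros H e He. apply (H (fun r => Rabs (r - f x) < e)).
  exists (mkposreal e He). intros y Hy. exact Hy.
Qed.

(** An integral depends continuously on its bounds and on the integrand: split off
    the end pieces, which are short, and use uniform continuity on the rest. *)
Lemma continuous_CInt_bounds {X : UniformSpace} (f : R -> R -> C) (al be ga : X -> R) (x : X) :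
  cont2 f -> continuous al x -> continuous be x -> continuous ga x ->
  continuous (fun y => CInt (fun s => f s (ga y)) (al y) (be y)) x.
Proof.
  intros Hf Ha Hb Hg.
  assert (Hs : forall w s, continuous (fun s => f s w) s) by (intros; cont).
  apply continuous_C_eps; intros e He.
  set (a0 := al x); set (b0 := be x); set (y0 := ga x).
  set (M := Rabs a0 + Rabs b0 + Rabs y0 + 1).
  generalize (Rabs_pos a0) (Rabs_pos b0) (Rabs_pos y0); intros P1 P2 P3.
  destruct (box_bounded f M Hf) as [B [HB HBd]].
  set (e1 := e / (4 * (Rabs (b0 - a0) + 1))).
  assert (Hpos : 0 < 4 * (Rabs (b0 - a0) + 1)) by (generalize (Rabs_pos (b0 - a0)); lra).
  assert (He1 : 0 < e1) by (apply Rdiv_lt_0_compat; lra).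
  destruct (box_uniform_continuity f M e1 Hf He1) as [d [Hd Huc]].
  set (eta := Rmin (Rmin 1 d) (e / (4 * (B + 1)))).
  assert (Heta : 0 < eta).
  { apply Rmin_pos; [apply Rmin_pos; lra|apply Rdiv_lt_0_compat; lra]. }
  assert (E1 : eta <= 1) by (unfold eta; eapply Rle_trans; [apply Rmin_l|apply Rmin_l]).
  assert (E2 : eta <= d) by (unfold eta; eapply Rle_trans; [apply Rmin_l|apply Rmin_r]).
  assert (E3 : eta * B <= e / 4).
  { apply Rle_trans with (e / (4 * (B + 1)) * B).
    - apply Rmult_le_compat_r; [lra|apply Rmin_r].
    - apply Rmult_le_reg_r with (4 * (B + 1)); [lra|]. field_simplify; [|lra]. nra. }
  generalize (continuous_R_eps _ _ Ha eta Heta) (continuous_R_eps _ _ Hb eta Heta)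
    (continuous_R_eps _ _ Hg eta Heta); intros L1 L2 L3.
  refine (filter_imp _ _ _ (filter_and _ _ L1 (filter_and _ _ L2 L3))).
  intros y [D1 [D2 D3]]. fold a0 in D1. fold b0 in D2. fold y0 in D3.
  set (a := al y) in *; set (b := be y) in *; set (w := ga y) in *.
  assert (box : forall u u0, Rabs (u - u0) < eta -> Rabs u <= Rabs u0 + 1).
  { intros u u0 Hu. replace u with ((u - u0) + u0) by ring.
    eapply Rle_trans; [apply Rabs_triang|]. lra. }
  generalize (box _ _ D1) (box _ _ D2) (box _ _ D3); intros Ba Bb Bw.
  assert (between : forall u v s, Rmin u v <= s <= Rmax u v -> Rabs u <= M -> Rabs v <= M ->
     Rabs s <= M).
  { intros u v s Hs1 Hu Hv. apply Rabs_le_between in Hu, Hv. apply Rabs_le_between.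
    unfold Rmin, Rmax in Hs1; destruct (Rle_dec u v); lra. }
  replace (CInt (fun s => f s w) a b - CInt (fun s => f s y0) a0 b0)%C with
    (CInt (fun s => f s w) a a0 + CInt (fun s => f s w - f s y0) a0 b0
      + CInt (fun s => f s w) b0 b)%C.
  2:{ rewrite CInt_minus by (intros; apply Hs).
      rewrite <- (CInt_Chasles (fun s => f s w) a a0 b) by apply Hs.
      rewrite <- (CInt_Chasles (fun s => f s w) a0 b0 b) by apply Hs. ring. }
  eapply Rle_lt_trans; [apply Cmod_triangle|].
  assert (T1 : Cmod (CInt (fun s => f s w) a a0) <= e / 4).
  { eapply Rle_trans; [apply Cmod_CInt_le_const with (M := B)|].
    - apply Hs.
    - intros s Hs1. apply HBd; [apply (between a a0); unfold M; auto; lra|unfold M; lra].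
    - rewrite Rabs_minus_sym. apply Rle_trans with (eta * B); [|exact E3].
      apply Rmult_le_compat_r; lra. }
  assert (T3 : Cmod (CInt (fun s => f s w) b0 b) <= e / 4).
  { eapply Rle_trans; [apply Cmod_CInt_le_const with (M := B)|].
    - apply Hs.
    - intros s Hs1. apply HBd; [apply (between b0 b); unfold M; auto; lra|unfold M; lra].
    - apply Rle_trans with (eta * B); [|exact E3].
      apply Rmult_le_compat_r; lra. }
  assert (T2 : Cmod (CInt (fun s => f s w - f s y0)%C a0 b0) <= e / 4).
  { eapply Rle_trans; [apply Cmod_CInt_le_const with (M := e1)|].
    - intros; cont.
    - intros s Hs1. apply Rlt_le, Huc; try (unfold M; lra);
      try (apply (between a0 b0); unfold M; auto; lra).
      unfold Rminus; rewrite Rplus_opp_r, Rabs_R0; lra.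
    - unfold e1. apply Rmult_le_reg_r with (4 * (Rabs (b0 - a0) + 1)); [lra|].
      field_simplify; [|lra]. generalize (Rabs_pos (b0 - a0)); nra. }
  assert (T12 := Cmod_triangle (CInt (fun s => f s w) a a0) (CInt (fun s => f s w - f s y0)%C a0 b0)).
  lra.
Qed.

(** * Geometric convergence and integral inequalities *)

Lemma geometric_Lim_seq (u : nat -> R) (B : R) :
  (forall n, Rabs (u (S n) - u n) <= B / 2 ^ n) ->
  forall n, Rabs (u n - real (Lim_seq u)) <= 2 * B / 2 ^ n.
Proof.
  intros H.
  assert (P2 : forall n, 0 < 2 ^ n) by (intros; apply pow_lt; lra).
  assert (HB : 0 <= B).
  { specialize (H 0%nat). simpl in H. generalize (Rabs_pos (u 1%nat - u 0%nat)); lra. }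
  assert (Hk : forall n k, Rabs (u (n + k)%nat - u n) <= 2 * B / 2 ^ n - 2 * B / 2 ^ (n + k)).
  { intros n; induction k as [|k IH].
    - rewrite Nat.add_0_r. unfold Rminus; rewrite !Rplus_opp_r, Rabs_R0; lra.
    - rewrite Nat.add_succ_r.
      replace (u (S (n + k)) - u n) with ((u (S (n + k)) - u (n + k)%nat) + (u (n + k)%nat - u n)) by ring.
      eapply Rle_trans; [apply Rabs_triang|].
      specialize (H (n + k)%nat).
      assert (2 * B / 2 ^ S (n + k) = B / 2 ^ (n + k)).
      { simpl; field. apply Rgt_not_eq, P2. }
      assert (2 * B / 2 ^ (n + k) = 2 * (B / 2 ^ (n + k))) by (field; apply Rgt_not_eq, P2).
      lra. }
  assert (Hk' : forall n k, Rabs (u (n + k)%nat - u n) <= 2 * B / 2 ^ n).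
  { intros n k. eapply Rle_trans; [apply Hk|].
    assert (0 <= 2 * B / 2 ^ (n + k)) by (apply Rdiv_le_0_compat; [lra|apply P2]). lra. }
  assert (Hex : ex_finite_lim_seq u).
  { apply ex_lim_seq_cauchy_corr. intros e.
    assert (Hlim : is_lim_seq (fun n => 4 * B * (/ 2) ^ n) 0).
    { replace (Finite 0) with (Rbar_mult (4 * B) 0) by (simpl; f_equal; ring).
      apply is_lim_seq_scal_l, is_lim_seq_geom. rewrite Rabs_pos_eq; lra. }
    destruct (proj2 (is_lim_seq_spec _ _) Hlim e) as [N HN].
    exists N. intros n m Hn Hm.
    specialize (HN N (Nat.le_refl N)).
    replace n with (N + (n - N))%nat by lia. replace m with (N + (m - N))%nat by lia.
    replace (u (N + (n - N))%nat - u (N + (m - N))%nat) with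
      ((u (N + (n - N))%nat - u N) + - (u (N + (m - N))%nat - u N)) by ring.
    eapply Rle_lt_trans; [apply Rabs_triang|]. rewrite Rabs_Ropp.
    generalize (Hk' N (n - N)%nat) (Hk' N (m - N)%nat); intros.
    apply Rabs_lt_between in HN.
    assert (4 * B * (/2) ^ N = 2 * (2 * B / 2 ^ N)).
    { rewrite pow_inv. field. apply Rgt_not_eq, P2. }
    lra. }
  intros n. apply Lim_seq_correct' in Hex.
  apply is_lim_seq_incr_n with (N := n) in Hex.
  assert (Hl : is_lim_seq (fun k => Rabs (u n - u (k + n)%nat)) (Rabs (u n - real (Lim_seq u)))).
  { apply (is_lim_seq_abs _ (Finite (u n - real (Lim_seq u)))).
    apply is_lim_seq_minus'; [apply is_lim_seq_const|exact Hex]. }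
  refine (is_lim_seq_le _ _ _ (Finite (2 * B / 2 ^ n)) _ Hl (is_lim_seq_const _)).
  intros k. rewrite Rabs_minus_sym, Nat.add_comm. apply Hk'.
Qed.

Lemma geometric_limit (x : nat -> R -> R -> C) :
  (forall n, cont2 (x n)) ->
  (forall M, exists B, forall n a b, Rabs a <= M -> Rabs b <= M ->
     Cmod (x (S n) a b - x n a b)%C <= B / 2 ^ n) ->
  exists l, cont2 l /\ forall M, exists B, 0 <= B /\ forall n a b,
     Rabs a <= M -> Rabs b <= M -> Cmod (x n a b - l a b)%C <= B / 2 ^ n.
Proof.
  intros Hx Hb.
  assert (P2 : forall n, 0 < 2 ^ n) by (intros; apply pow_lt; lra).
  set (l := fun a b => (real (Lim_seq (fun n => Re (x n a b))),
                        real (Lim_seq (fun n => Im (x n a b)))) : C).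
  assert (Hl : forall M, exists B, 0 <= B /\ forall n a b,
     Rabs a <= M -> Rabs b <= M -> Cmod (x n a b - l a b)%C <= B / 2 ^ n).
  { intros M. destruct (Hb M) as [B HB]. exists (4 * Rmax B 0); split.
    { generalize (Rmax_r B 0); lra. }
    intros n a b Ha Hb'.
    eapply Rle_trans; [apply Cmod_le_Re_Im|].
    assert (HB' : forall k, B / 2 ^ k <= Rmax B 0 / 2 ^ k).
    { intros k. apply Rmult_le_compat_r; [left; apply Rinv_0_lt_compat, P2|apply Rmax_l]. }
    assert (R1 := geometric_Lim_seq (fun n => Re (x n a b)) (Rmax B 0)
       (fun k => Rle_trans _ _ _ (Rle_trans _ _ _ (re_le_Cmod (x (S k) a b - x k a b)%C)
          (HB k a b Ha Hb')) (HB' k)) n).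
    assert (R2 := geometric_Lim_seq (fun n => Im (x n a b)) (Rmax B 0)
       (fun k => Rle_trans _ _ _ (Rle_trans _ _ _ (Im_le_Cmod (x (S k) a b - x k a b)%C)
          (HB k a b Ha Hb')) (HB' k)) n).
    change (Re (x n a b - l a b)%C) with (Re (x n a b) - real (Lim_seq (fun n => Re (x n a b)))).
    change (Im (x n a b - l a b)%C) with (Im (x n a b) - real (Lim_seq (fun n => Im (x n a b)))).
    replace (4 * Rmax B 0 / 2 ^ n) with (2 * Rmax B 0 / 2 ^ n + 2 * Rmax B 0 / 2 ^ n)
      by (field; apply Rgt_not_eq, P2).
    apply Rplus_le_compat; assumption. }
  exists l; split; [|exact Hl].
  apply cont2_eps. intros a b e He.
  set (M := Rabs a + Rabs b + 1).
  generalize (Rabs_pos a) (Rabs_pos b); intros Pa Pb.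
  destruct (Hl M) as [B [HB HBn]].
  assert (exists n, B / 2 ^ n < e / 4) as [n Hn].
  { assert (Hlim : is_lim_seq (fun n => B * (/ 2) ^ n) 0).
    { replace (Finite 0) with (Rbar_mult B 0) by (simpl; f_equal; ring).
      apply is_lim_seq_scal_l, is_lim_seq_geom. rewrite Rabs_pos_eq; lra. }
    assert (He4 : 0 < e / 4) by lra.
    destruct (proj2 (is_lim_seq_spec _ _) Hlim (mkposreal _ He4)) as [N HN].
    exists N. specialize (HN N (Nat.le_refl N)). simpl in HN.
    rewrite Rminus_0_r in HN. apply Rabs_lt_between in HN.
    unfold Rdiv at 1. rewrite <- pow_inv. lra. }
  assert (He2 : 0 < e / 2) by lra.
  destruct (proj1 (cont2_eps _) (Hx n) a b (e / 2) He2) as [d [Hd Hd']].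
  exists (Rmin d 1); split; [apply Rmin_pos; lra|].
  intros a' b' Ha' Hb'. generalize (Rmin_l d 1) (Rmin_r d 1); intros.
  assert (Rabs a' <= M).
  { unfold M. replace a' with ((a' - a) + a) by ring. eapply Rle_trans; [apply Rabs_triang|]. lra. }
  assert (Rabs b' <= M).
  { unfold M. replace b' with ((b' - b) + b) by ring. eapply Rle_trans; [apply Rabs_triang|]. lra. }
  replace (l a' b' - l a b)%C with
    (- (x n a' b' - l a' b') + (x n a' b' - x n a b) + (x n a b - l a b))%C by ring.
  eapply Rle_lt_trans; [apply Cmod_triangle|].
  assert (T := Cmod_triangle (- (x n a' b' - l a' b'))%C (x n a' b' - x n a b)%C).
  rewrite Cmod_opp in T.
  assert (Cmod (x n a' b' - l a' b')%C <= B / 2 ^ n) by (apply HBn; assumption).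
  assert (Cmod (x n a b - l a b)%C <= B / 2 ^ n) by (apply HBn; unfold M; lra).
  assert (Cmod (x n a' b' - x n a b)%C < e / 2) by (apply Hd'; lra).
  lra.
Qed.

Lemma increase_le_of_derive_le (f df : R -> R) (k c d : R) :
  c <= d -> (forall x, c < x < d -> is_derive f x (df x)) ->
  (forall x, c <= x <= d -> continuous f x) ->
  (forall x, c <= x <= d -> df x <= k) -> f d - f c <= k * (d - c).
Proof.
  intros Hcd Hd Hc Hk.
  destruct (MVT_gen f c d df) as [x [Hx ->]].
  - intros x; rewrite Rmin_left, Rmax_right by lra; apply Hd.
  - intros x; rewrite Rmin_left, Rmax_right by lra; intros.
    now apply continuous_continuity_pt, Hc.
  - rewrite Rmin_left, Rmax_right in Hx by lra.
    apply Rmult_le_compat_r; [lra|now apply Hk].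
Qed.

Lemma is_derive_RInt_cont (f : R -> R) (a x : R) :
  (forall y, continuous f y) -> is_derive (fun b => RInt f a b) x (f x).
Proof.
  intros Hf. apply (is_derive_RInt (V := R_NormedModule) f (fun b => RInt f a b) a x).
  - exists (mkposreal 1 Rlt_0_1). intros y _.
    apply (RInt_correct (V := R_CompleteNormedModule)).
    apply (ex_RInt_continuous (V := R_CompleteNormedModule)). intros z _; apply Hf.
  - apply Hf.
Qed.

Lemma ex_RInt_cont (f : R -> R) (a b : R) : (forall y, continuous f y) -> ex_RInt f a b.
Proof.
  intros Hf. apply (ex_RInt_continuous (V := R_CompleteNormedModule)). intros z _; apply Hf.
Qed.

Lemma is_derive_continuous_R (f : R -> R) x l : is_derive f x l -> continuous f x.
Proof.
  intros H. apply (ex_derive_continuous (K := R_AbsRing) (V := R_NormedModule)). now exists l.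
Qed.

(** [(eps + L * RInt phi c x) * exp (- L * (x - c))] is nonincreasing. *)
Lemma gronwall (phi : R -> R) (eps L c d : R) :
  0 <= L -> (forall x, continuous phi x) ->
  (forall x, c <= x <= d -> phi x <= eps + L * RInt phi c x) ->
  forall x, c <= x <= d -> phi x <= eps * exp (L * (x - c)).
Proof.
  intros HL Hphi H x Hx.
  set (J := fun y => (eps + L * RInt phi c y) * exp (- L * (y - c))).
  set (dJ := fun y => L * phi y * exp (- L * (y - c)) + (eps + L * RInt phi c y) * (- L * exp (- L * (y - c)))).
  assert (HJ : forall y, is_derive J y (dJ y)).
  { intros y. unfold J, dJ.
    evar_last.
    - apply (is_derive_mult (fun y => eps + L * RInt phi c y) (fun y => exp (- L * (y - c))) y
               (L * phi y) (- L * exp (- L * (y - c)))).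
      + evar_last.
        * apply (is_derive_plus (fun _ => eps) (fun y => L * RInt phi c y)).
          apply is_derive_const. apply is_derive_scal, is_derive_RInt_cont, Hphi.
        * apply Rplus_0_l.
      + auto_derive; [exact I|unfold Rminus; ring].
      + intros; apply Rmult_comm.
    - unfold plus, mult; simpl. ring. }
  assert (HJx : J x - J c <= 0 * (x - c)).
  { apply increase_le_of_derive_le with (df := dJ); [lra|intros; apply HJ| |].
    - intros y _. apply (is_derive_continuous_R _ _ _ (HJ y)).
    - intros y Hy. unfold dJ.
      assert (phi y <= eps + L * RInt phi c y) by (apply H; lra).
      generalize (exp_pos (- L * (y - c))); intros.
      assert (L * phi y * exp (- L * (y - c)) <= L * (eps + L * RInt phi c y) * exp (- L * (y - c))).
      { apply Rmult_le_compat_r; [lra|]. apply Rmult_le_compat_l; lra. }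
      lra. }
  assert (Jc : J c = eps).
  { unfold J. rewrite RInt_point. unfold zero; simpl.
    replace (- L * (c - c)) with 0 by ring. rewrite exp_0; ring. }
  assert (HE : exp (- L * (x - c)) * exp (L * (x - c)) = 1).
  { rewrite <- exp_plus. replace (- L * (x - c) + L * (x - c)) with 0 by ring. apply exp_0. }
  eapply Rle_trans; [apply H, Hx|].
  replace (eps + L * RInt phi c x) with (J x * exp (L * (x - c))).
  - apply Rmult_le_compat_r; [left; apply exp_pos|]. lra.
  - unfold J. rewrite Rmult_assoc, HE; ring.
Qed.

Lemma exp_le x y : x <= y -> exp x <= exp y.
Proof. intros [H| -> ]; [left; now apply exp_increasing|lra]. Qed.

Lemma one_le_exp x : 0 <= x -> 1 <= exp x.
Proof. intros H. rewrite <- exp_0. now apply exp_le. Qed.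

(** Integration gains the factor [1 / K] on functions of growth [exp (K s)]; this is
    what makes integral operators contract in exponentially weighted norms. *)
Lemma Cmod_CInt_exp_le (phi : R -> C) (B K a c b : R) :
  0 < K -> 0 <= B -> c <= b -> (forall x, continuous phi x) ->
  (forall s, c <= s <= b -> Cmod (phi s) <= B * exp (K * (s + a))) ->
  Cmod (CInt phi c b) <= B / K * exp (K * (b + a)).
Proof.
  intros HK HB Hcb Hphi H.
  set (g := fun s => B * exp (K * (s + a))).
  assert (Hd : forall s, is_derive (fun s => B / K * exp (K * (s + a))) s (g s)).
  { intros s. unfold g. auto_derive; [exact I|]. field; lra. }
  assert (Hg : forall s, continuous g s).
  { intros s. apply (ex_derive_continuous (V := R_NormedModule)). unfold g.
    auto_derive. exact I. }
  eapply Rle_trans; [apply (Cmod_CInt_le phi g c b Hcb Hphi Hg H)|].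
  assert (Hi : is_RInt g c b (minus (B / K * exp (K * (b + a))) (B / K * exp (K * (c + a))))).
  { apply (is_RInt_derive (V := R_CompleteNormedModule) (fun s => B / K * exp (K * (s + a))) g);
    intros; [apply Hd|apply Hg]. }
  rewrite (is_RInt_unique _ _ _ _ Hi). unfold minus, plus, opp; simpl.
  assert (0 <= B / K * exp (K * (c + a))).
  { apply Rmult_le_pos; [apply Rdiv_le_0_compat; lra|left; apply exp_pos]. }
  lra.
Qed.

(** * Mild solutions in characteristic coordinates *)

(** [s b] is the coordinate [a] at which the forward characteristic with label
    [b] enters the domain [s b <= a]: through the initial line [a = - b] when
    [b <= 0], through the moving boundary when [b >= 0]. *)
Record entry_curve (s : R -> R) : Prop := {
  entry_continuous : forall b, continuous s b;
  entry_0 : s 0 = 0;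
  entry_initial : forall b, b <= 0 -> s b = - b;
  entry_nonneg : forall b, 0 <= s b;
  entry_increasing : forall b b', 0 <= b -> b < b' -> s b < s b' }.

Lemma entry_back (s : R -> R) (a b b' : R) :
  entry_curve s -> s b <= a -> - a <= b' <= b -> s b' <= a.
Proof.
  intros Hs Hab Hb'.
  destruct (Rle_dec b' 0) as [H|H]; [rewrite (entry_initial s Hs) by lra; lra|].
  destruct (Req_dec b b') as [->|Hne]; [lra|].
  assert (s b' < s b) by (apply (entry_increasing s Hs); lra). lra.
Qed.

(** The backward triangle [x + 2 t <= N]: a compact piece of the domain, closed
    under following characteristics backwards. *)
Definition reg (s : R -> R) (N a b : R) : Prop := s b <= a /\ 3 * a + b <= N.

(** The characteristics [b <= 0] issue from the initial line; for them [bpos]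
    selects the corner, where the boundary data are frozen. *)
Definition bpos (b : R) : R := Rmax b 0.

Lemma entry_ge (s : R -> R) b : entry_curve s -> - b <= s b.
Proof.
  intros Hs. destruct (Rle_dec b 0).
  - rewrite (entry_initial s Hs); lra.
  - generalize (entry_nonneg s Hs b); lra.
Qed.

Lemma reg_time (s : R -> R) N a b : entry_curve s -> reg s N a b -> 0 <= a + b.
Proof. intros Hs [H _]. generalize (entry_ge s b Hs); lra. Qed.

Lemma reg_box (s : R -> R) N a b :
  entry_curve s -> reg s N a b -> Rabs a <= N /\ Rabs b <= N /\ 0 <= a.
Proof.
  intros Hs [H1 H2]. generalize (entry_ge s b Hs) (entry_nonneg s Hs b); intros.
  split; [|split; [|lra]]; apply Rabs_le_between; lra.
Qed.

Lemma reg_back_a (s : R -> R) N a a' b : reg s N a b -> s b <= a' <= a -> reg s N a' b.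
Proof. unfold reg; lra. Qed.

Lemma reg_back_b (s : R -> R) N a b b' :
  entry_curve s -> reg s N a b -> - a <= b' <= b -> reg s N a b'.
Proof.
  intros Hs [H1 H2] Hb. split; [now apply (entry_back s a b b')|lra].
Qed.

Lemma entry_bpos (s : R -> R) b :
  entry_curve s -> s (bpos b) <= s b /\ s (bpos b) + bpos b = s b + b.
Proof.
  intros Hs. unfold bpos, Rmax; destruct (Rle_dec b 0); [|lra].
  rewrite (entry_0 s Hs), (entry_initial s Hs b) by lra. lra.
Qed.

Lemma reg_entry (s : R -> R) N a b :
  entry_curve s -> reg s N a b -> reg s N (s (bpos b)) (bpos b).
Proof.
  intros Hs [H1 H2]. generalize (entry_bpos s b Hs); intros [H3 H4].
  split; [lra|]. generalize (entry_nonneg s Hs (bpos b)); lra.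
Qed.

Definition back_wave (vi : R -> C) (g : R -> R -> C) (a b : R) : C :=
  (vi a + CInt (fun b' => g a b') (- a) b)%C.

(** The forward wave enters with the value [mu b] plus [nu b] times the backward
    wave at the boundary.  On the initial line, [b <= 0], that backward value is
    taken at the corner, which keeps the formula continuous in [b]. *)
Definition fwd_wave (s : R -> R) (mu nu vi : R -> C) (f g : R -> R -> C) (a b : R) : C :=
  (mu b + nu b * back_wave vi g (s (bpos b)) (bpos b) + CInt (fun a' => f a' b) (s b) a)%C.

Lemma continuous_bpos {X : UniformSpace} (f : X -> R) x :
  continuous f x -> continuous (fun y => bpos (f y)) x.
Proof. intros; unfold bpos; cont. Qed.

Lemma cont2_back_wave vi g :
  (forall a, continuous vi a) -> cont2 g -> cont2 (back_wave vi g).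
Proof.
  intros Hv Hg p. unfold back_wave.
  apply continuous_Cplus; [cont|].
  apply (continuous_CInt_bounds (fun b' a => g a b')); cont.
Qed.

Lemma cont2_fwd_wave s mu nu vi f g :
  entry_curve s -> (forall a, continuous mu a) -> (forall a, continuous nu a) ->
  (forall a, continuous vi a) -> cont2 f -> cont2 g -> cont2 (fwd_wave s mu nu vi f g).
Proof.
  intros Hs Hmu Hnu Hv Hf Hg p. unfold fwd_wave.
  assert (Hsc := entry_continuous s Hs).
  assert (Hbw := cont2_back_wave vi g Hv Hg).
  apply continuous_Cplus; [apply continuous_Cplus; [cont|apply continuous_Cmult; [cont|]]|].
  - apply (cont2_comp (back_wave vi g)); [exact Hbw| |].
    + apply (continuous_1 s); [exact Hsc|]. apply continuous_bpos; cont.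
    + apply continuous_bpos; cont.
  - apply (continuous_CInt_bounds f); cont.
Qed.

(** Integrating the sources along characteristics gains a factor [1 / K] in the
    norm weighted by [exp (K t)], with [t = a + b]. *)
Lemma wave_contraction s mu nu vi f g f' g' N K B La :
  entry_curve s -> cont2 f -> cont2 g -> cont2 f' -> cont2 g' ->
  0 < K -> 0 <= B -> (forall b, Rabs b <= N -> Cmod (nu b) <= La) ->
  (forall a b, reg s N a b ->
     Cmod (f a b - f' a b)%C <= B * exp (K * (a + b)) /\
     Cmod (g a b - g' a b)%C <= B * exp (K * (a + b))) ->
  forall a b, reg s N a b ->
    Cmod (back_wave vi g a b - back_wave vi g' a b)%C <= B / K * exp (K * (a + b)) /\
    Cmod (fwd_wave s mu nu vi f g a b - fwd_wave s mu nu vi f' g' a b)%C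
      <= (1 + La) * (B / K) * exp (K * (a + b)).
Proof.
  intros Hs Hf Hg Hf' Hg' HK HB Hnu H.
  assert (HV : forall a b, reg s N a b ->
    Cmod (back_wave vi g a b - back_wave vi g' a b)%C <= B / K * exp (K * (a + b))).
  { intros a b Hab. unfold back_wave.
    replace (vi a + CInt (fun b' => g a b') (- a) b - (vi a + CInt (fun b' => g' a b') (- a) b))%C
      with (CInt (fun b' => g a b' - g' a b')%C (- a) b).
    2:{ rewrite (CInt_minus (fun b' => g a b') (fun b' => g' a b')) by (intros; cont). ring. }
    rewrite (Rplus_comm a b). apply Cmod_CInt_exp_le; auto.
    - generalize (reg_time s N a b Hs Hab); lra.
    - intros; cont.
    - intros b' Hb'. rewrite (Rplus_comm b' a). apply H.
      now apply (reg_back_b s N a b). }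
  intros a b Hab. split; [now apply HV|].
  unfold fwd_wave.
  set (W := back_wave vi g (s (bpos b)) (bpos b)).
  set (W' := back_wave vi g' (s (bpos b)) (bpos b)).
  replace (mu b + nu b * W + CInt (fun a' => f a' b) (s b) a -
           (mu b + nu b * W' + CInt (fun a' => f' a' b) (s b) a))%C
    with (nu b * (W - W') + CInt (fun a' => f a' b - f' a' b)%C (s b) a)%C.
  2:{ rewrite CInt_minus by (intros; cont). ring. }
  eapply Rle_trans; [apply Cmod_triangle|]. rewrite Cmod_mult.
  assert (Hb := reg_box s N a b Hs Hab). destruct Hb as [_ [Hb _]].
  assert (HI : Cmod (CInt (fun a' => f a' b - f' a' b)%C (s b) a) <= B / K * exp (K * (a + b))).
  { apply Cmod_CInt_exp_le; auto.
    - apply Hab.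
    - intros; cont.
    - intros a' Ha'. apply H. now apply (reg_back_a s N a). }
  assert (HW : Cmod (W - W')%C <= B / K * exp (K * (a + b))).
  { eapply Rle_trans; [apply HV, (reg_entry s N a b Hs Hab)|].
    apply Rmult_le_compat_l; [apply Rdiv_le_0_compat; lra|].
    assert (H3 := entry_bpos s b Hs). destruct Hab as [Hab _].
    apply exp_le, Rmult_le_compat_l; lra. }
  specialize (Hnu b Hb).
  assert (Cmod (nu b) * Cmod (W - W')%C <= La * (B / K * exp (K * (a + b)))).
  { apply Rmult_le_compat; auto using Cmod_ge_0. }
  lra.
Qed.

(** Hence sources that depend on the waves with Lipschitz constant [L] are
    improved by a factor 2 once the weight is steep enough. *)
Lemma wave_halving s mu nu vi f g f' g' N L B La :
  let K := 2 * L * (2 + La) + 1 in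
  entry_curve s -> cont2 f -> cont2 g -> cont2 f' -> cont2 g' ->
  0 <= L -> 0 <= B -> (forall b, Rabs b <= N -> Cmod (nu b) <= La) -> 0 <= La ->
  (forall a b, reg s N a b ->
     Cmod (f a b - f' a b)%C <= B * exp (K * (a + b)) /\
     Cmod (g a b - g' a b)%C <= B * exp (K * (a + b))) ->
  forall a b, reg s N a b ->
    L * (Cmod (fwd_wave s mu nu vi f g a b - fwd_wave s mu nu vi f' g' a b)%C
         + Cmod (back_wave vi g a b - back_wave vi g' a b)%C) <= B / 2 * exp (K * (a + b)).
Proof.
  intros K Hs Cf Cg Cf' Cg' HL HB Hnu HLa H a b Hab.
  assert (HK : 0 < K) by (unfold K; nra).
  destruct (wave_contraction s mu nu vi f g f' g' N K B La Hs Cf Cg Cf' Cg' HK HB Hnu H a b Hab)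
    as [HV HU].
  eapply Rle_trans; [apply Rmult_le_compat_l; [exact HL|apply Rplus_le_compat; eassumption]|].
  replace (L * ((1 + La) * (B / K) * exp (K * (a + b)) + B / K * exp (K * (a + b))))
    with (L * (2 + La) / K * B * exp (K * (a + b))) by (field; lra).
  apply Rmult_le_compat_r; [left; apply exp_pos|].
  replace (B / 2) with (/ 2 * B) by field. apply Rmult_le_compat_r; [exact HB|].
  apply Rle_div_l; [exact HK|]. unfold K. lra.
Qed.

Lemma source_bound s (f g : R -> R -> C) N : entry_curve s -> cont2 f -> cont2 g ->
  exists B, 0 <= B /\ forall K, 0 < K -> forall a b, reg s N a b ->
    Cmod (f a b) <= B * exp (K * (a + b)) /\ Cmod (g a b) <= B * exp (K * (a + b)).
Proof.
  intros Hs Cf Cg.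
  destruct (box_bounded f N Cf) as [B1 [HB1 H1]]. destruct (box_bounded g N Cg) as [B2 [HB2 H2]].
  exists (B1 + B2). split; [lra|]. intros K HK a b Hab.
  destruct (reg_box s N a b Hs Hab) as [Ha [Hb _]].
  assert (He : 1 <= exp (K * (a + b))).
  { apply one_le_exp, Rmult_le_pos; [lra|exact (reg_time s N a b Hs Hab)]. }
  specialize (H1 a b Ha Hb). specialize (H2 a b Ha Hb).
  split; (eapply Rle_trans; [eassumption|]); nra.
Qed.

Lemma le_0_of_geometric (x B : R) : (forall n : nat, x <= B / 2 ^ n) -> x <= 0.
Proof.
  intros H.
  assert (Hlim : is_lim_seq (fun n => B * (/ 2) ^ n) 0).
  { replace (Finite 0) with (Rbar_mult B 0) by (simpl; f_equal; ring).
    apply is_lim_seq_scal_l, is_lim_seq_geom. rewrite Rabs_pos_eq; lra. }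
  refine (is_lim_seq_le _ _ (Finite x) (Finite 0) _ (is_lim_seq_const x) Hlim).
  intros n. rewrite pow_inv. apply H.
Qed.

Lemma Cmod_sub_eq_0 (x y : C) : Cmod (x - y)%C <= 0 -> x = y.
Proof.
  intros H. assert (Hz : (x - y)%C = 0).
  { apply Cmod_eq_0. generalize (Cmod_ge_0 (x - y)%C); lra. }
  replace x with ((x - y) + y)%C by ring. rewrite Hz; ring.
Qed.

Definition lipschitz_source (s : R -> R) (F : R -> R -> C -> C -> C) : Prop :=
  forall N, exists L, 0 <= L /\ forall a b, reg s N a b -> forall u v u' v',
    Cmod (F a b u v - F a b u' v')%C <= L * (Cmod (u - u')%C + Cmod (v - v')%C).

Definition continuous_source (F : R -> R -> C -> C -> C) : Prop :=
  forall u v, cont2 u -> cont2 v -> cont2 (fun a b => F a b (u a b) (v a b)).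

(** The values of [f], [g] outside the domain are only there to make the
    waves continuous functions on the whole plane. *)
Record mild_solution (s : R -> R) (mu nu vi : R -> C) (F G : R -> R -> C -> C -> C) (N : R)
    (f g : R -> R -> C) : Prop := {
  mild_f_cont : cont2 f;
  mild_g_cont : cont2 g;
  mild_f : forall a b, reg s N a b ->
    f a b = F a b (fwd_wave s mu nu vi f g a b) (back_wave vi g a b);
  mild_g : forall a b, reg s N a b ->
    g a b = G a b (fwd_wave s mu nu vi f g a b) (back_wave vi g a b) }.

(** Picard iteration on the pair of sources.  The triangles [reg s N] are closed
    under following characteristics backwards, so the iterates converge on each
    of them, at a geometric rate in a suitable exponentially weighted norm. *)
Theorem mild_existence s mu nu vi F G :
  entry_curve s -> (forall a, continuous mu a) -> (forall a, continuous nu a) ->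
  (forall a, continuous vi a) ->
  continuous_source F -> continuous_source G ->
  lipschitz_source s F -> lipschitz_source s G ->
  exists f g, forall N, mild_solution s mu nu vi F G N f g.
Proof.
  intros Hs Hmu Hnu Hvi HF HG LF LG.
  assert (Hsc := entry_continuous s Hs).
  (* sources are evaluated at the retraction (max a (s b), b) of the plane onto
     the domain, which makes them continuous functions of all (a, b) *)
  set (T := fun (H : R -> R -> C -> C -> C) (w : (R -> R -> C) * (R -> R -> C)) (a b : R) =>
     let a' := Rmax a (s b) in
     H a' b (fwd_wave s mu nu vi (fst w) (snd w) a' b) (back_wave vi (snd w) a' b)).
  set (w := fix w (n : nat) : (R -> R -> C) * (R -> R -> C) :=
     match n with
     | O => (fun _ _ => RtoC 0, fun _ _ => RtoC 0)
     | S k => (T F (w k), T G (w k))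
     end).
  assert (HT : forall H q, continuous_source H -> cont2 (fst q) -> cont2 (snd q) -> cont2 (T H q)).
  { intros H q HH H1 H2 p.
    set (E := fun a b => H a b (fwd_wave s mu nu vi (fst q) (snd q) a b) (back_wave vi (snd q) a b)).
    assert (HE : cont2 E).
    { apply HH; [apply cont2_fwd_wave|apply cont2_back_wave]; assumption. }
    change (continuous (fun p : R * R => E (Rmax (fst p) (s (snd p))) (snd p)) p). cont. }
  assert (Hw : forall n, cont2 (fst (w n)) /\ cont2 (snd (w n))).
  { induction n as [|n [IH1 IH2]]; simpl; [split; intros p; cont|].
    split; apply HT; assumption. }
  assert (Tdom : forall H q a b, s b <= a ->
     T H q a b = H a b (fwd_wave s mu nu vi (fst q) (snd q) a b) (back_wave vi (snd q) a b)).
  { intros H q a b Hab. unfold T. rewrite Rmax_left by lra. reflexivity. }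
  assert (retr : forall n a b, fst (w n) (Rmax a (s b)) b = fst (w n) a b /\
     snd (w n) (Rmax a (s b)) b = snd (w n) a b).
  { intros [|n] a b; [split; reflexivity|]. simpl; unfold T.
    rewrite (Rmax_left (Rmax a (s b)) (s b)) by apply Rmax_r. split; reflexivity. }
  assert (bound : forall M, exists N, forall a b, Rabs a <= M -> Rabs b <= M ->
     reg s N (Rmax a (s b)) b).
  { intros M. destruct (interval_bounded (fun b => RtoC (s b)) M) as [S0 [HS0 HS]].
    { intros; cont. }
    exists (3 * (M + S0) + M). intros a b Ha Hb.
    specialize (HS b Hb). rewrite Cmod_R in HS.
    apply Rabs_le_between in HS, Ha, Hb. generalize (Rmax_r a (s b)).
    split; [apply Rmax_r|]. unfold Rmax; destruct (Rle_dec a (s b)); lra. }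
  assert (La : forall N, exists La, 0 <= La /\ forall b, Rabs b <= N -> Cmod (nu b) <= La).
  { intros N. apply interval_bounded; assumption. }
  assert (rate : forall N, exists B K, 0 <= B /\ 0 < K /\ forall n a b, reg s N a b ->
     Cmod (fst (w (S n)) a b - fst (w n) a b)%C <= B / 2 ^ n * exp (K * (a + b)) /\
     Cmod (snd (w (S n)) a b - snd (w n) a b)%C <= B / 2 ^ n * exp (K * (a + b))).
  { intros N.
    destruct (LF N) as [L1 [HL1 HF']]. destruct (LG N) as [L2 [HL2 HG']].
    destruct (La N) as [l [Hl Hnl]].
    destruct (Hw 0%nat) as [c01 c02]. destruct (Hw 1%nat) as [c11 c12].
    destruct (source_bound s (fun a b => fst (w 1%nat) a b - fst (w 0%nat) a b)%C
      (fun a b => snd (w 1%nat) a b - snd (w 0%nat) a b)%C N Hs) as [B [HB H01]];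
      [intros p; cont|intros p; cont|].
    set (L := L1 + L2). set (K := 2 * L * (2 + l) + 1).
    assert (HL : 0 <= L) by (unfold L; lra).
    assert (HK : 0 < K) by (unfold K; nra).
    exists B, K. split; [exact HB|]. split; [exact HK|].
    induction n as [|n IH].
    - intros a b Hab. simpl pow. unfold Rdiv; rewrite Rinv_1, Rmult_1_r. exact (H01 K HK a b Hab).
    - intros a b Hab.
      assert (P2 : 0 < 2 ^ n) by (apply pow_lt; lra).
      assert (HBn : 0 <= B / 2 ^ n) by (apply Rdiv_le_0_compat; lra).
      destruct (Hw (S n)) as [c1 c2]. destruct (Hw n) as [c3 c4].
      assert (key := wave_halving s mu nu vi _ _ _ _ N L _ l
                  Hs c1 c2 c3 c4 HL HBn Hnl Hl IH a b Hab).
      replace (B / 2 ^ n / 2) with (B / 2 ^ S n) in key by (simpl; field; lra).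
      assert (reduce : forall H q q' Lh, 0 <= Lh <= L ->
        (forall u v u' v', Cmod (H a b u v - H a b u' v')%C <= Lh * (Cmod (u - u')%C + Cmod (v - v')%C)) ->
        q = w (S n) -> q' = w n ->
        Cmod (T H q a b - T H q' a b)%C <= B / 2 ^ S n * exp (K * (a + b))).
      { intros H q q' Lh HLh Hlip -> ->. rewrite !Tdom by apply Hab.
        eapply Rle_trans; [apply Hlip|]. eapply Rle_trans; [|exact key].
        apply Rmult_le_compat_r; [|lra]. apply Rplus_le_le_0_compat; apply Cmod_ge_0. }
      split.
      + apply (reduce F _ _ L1); [unfold L; lra|intros; now apply HF'|reflexivity|reflexivity].
      + apply (reduce G _ _ L2); [unfold L; lra|intros; now apply HG'|reflexivity|reflexivity]. }
  assert (rate' : forall M, exists B, forall n a b, Rabs a <= M -> Rabs b <= M ->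
     Cmod (fst (w (S n)) a b - fst (w n) a b)%C <= B / 2 ^ n /\
     Cmod (snd (w (S n)) a b - snd (w n) a b)%C <= B / 2 ^ n).
  { intros M. destruct (bound M) as [N HN]. destruct (rate N) as [B [K [HB [HK H]]]].
    exists (B * exp (K * (2 * N))). intros n a b Ha Hb.
    assert (Hr := HN a b Ha Hb).
    assert (He : B / 2 ^ n * exp (K * (Rmax a (s b) + b)) <= B * exp (K * (2 * N)) / 2 ^ n).
    { replace (B * exp (K * (2 * N)) / 2 ^ n) with (B / 2 ^ n * exp (K * (2 * N)))
        by (field; apply pow_nonzero; lra).
      apply Rmult_le_compat_l; [apply Rdiv_le_0_compat; [lra|apply pow_lt; lra]|].
      destruct (reg_box s N _ _ Hs Hr) as [H1 [H2 _]].
      apply Rabs_le_between in H1, H2.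
      apply exp_le, Rmult_le_compat_l; lra. }
    destruct (H n _ _ Hr) as [H1 H2].
    rewrite !(proj1 (retr _ a b)) in H1. rewrite !(proj2 (retr _ a b)) in H2. lra. }
  destruct (geometric_limit (fun n => fst (w n)) (fun n => proj1 (Hw n))) as [f [Hf Hfl]].
  { intros M. destruct (rate' M) as [B HB]. exists B. intros; now apply HB. }
  destruct (geometric_limit (fun n => snd (w n)) (fun n => proj2 (Hw n))) as [g [Hg Hgl]].
  { intros M. destruct (rate' M) as [B HB]. exists B. intros; now apply HB. }
  assert (conclude : forall H h, continuous_source H -> lipschitz_source s H ->
    (forall M, exists B, 0 <= B /\ forall n a b, Rabs a <= M -> Rabs b <= M ->
        Cmod (T H (w n) a b - h a b)%C <= B / 2 ^ n) ->
    forall N a b, reg s N a b ->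
      h a b = H a b (fwd_wave s mu nu vi f g a b) (back_wave vi g a b)).
  { intros H h HH LH Hh N a b Hab.
    destruct (reg_box s N a b Hs Hab) as [Ha [Hb _]].
    destruct (Hh N) as [B0 [HB0 H0]]. destruct (Hfl N) as [B1 [HB1 H1]].
    destruct (Hgl N) as [B2 [HB2 H2]]. destruct (LH N) as [L [HL HLip]].
    destruct (La N) as [l [Hl Hnl]].
    apply Cmod_sub_eq_0.
    apply (le_0_of_geometric _ (B0 + L * ((2 + l) * (B1 + B2) * exp (a + b)))).
    intros n.
    assert (P2 : 0 < 2 ^ n) by (apply pow_lt; lra).
    assert (HBn : 0 <= (B1 + B2) / 2 ^ n) by (apply Rdiv_le_0_compat; lra).
    assert (Hd : forall B', 0 <= B' <= B1 + B2 -> forall x y, reg s N x y ->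
       B' / 2 ^ n <= (B1 + B2) / 2 ^ n * exp (1 * (x + y))).
    { intros B' HB' x y Hxy.
      assert (1 <= exp (1 * (x + y))).
      { rewrite <- exp_0 at 1. assert (Ht := reg_time s N x y Hs Hxy).
        destruct Ht as [Ht|Ht]; [left; apply exp_increasing; lra|].
        rewrite <- Ht, Rmult_0_r; lra. }
      apply Rle_trans with ((B1 + B2) / 2 ^ n).
      - apply Rmult_le_compat_r; [left; now apply Rinv_0_lt_compat|lra].
      - rewrite <- (Rmult_1_r ((B1 + B2) / 2 ^ n)) at 1. apply Rmult_le_compat_l; lra. }
    destruct (Hw n) as [c1 c2].
    destruct (wave_contraction s mu nu vi _ _ _ _ N 1 ((B1 + B2) / 2 ^ n) l
                  Hs c1 c2 Hf Hg Rlt_0_1 HBn Hnl) with (a := a) (b := b) as [HV HU].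
    { intros x y Hxy. destruct (reg_box s N x y Hs Hxy) as [Hx [Hy _]]. split.
      - eapply Rle_trans; [now apply H1|]. apply Hd; [lra|exact Hxy].
      - eapply Rle_trans; [now apply H2|]. apply Hd; [lra|exact Hxy]. }
    { exact Hab. }
    specialize (H0 n a b Ha Hb). rewrite Tdom in H0 by apply Hab.
    match type of H0 with Cmod (?p - _)%C <= _ => set (hn := p) in * end.
    match goal with |- Cmod (_ - ?p)%C <= _ => set (hl := p) in * end.
    replace (h a b - hl)%C with (- (hn - h a b) + (hn - hl))%C by ring.
    eapply Rle_trans; [apply Cmod_triangle|]. rewrite Cmod_opp.
    assert (Cmod (hn - hl)%C <= L * ((2 + l) * (B1 + B2) * exp (a + b)) / 2 ^ n).
    { unfold hn, hl. eapply Rle_trans; [now apply HLip|].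
      eapply Rle_trans; [apply Rmult_le_compat_l; [exact HL|apply Rplus_le_compat; eassumption]|].
      rewrite !Rmult_1_l. apply Req_le. field. lra. }
    replace ((B0 + L * ((2 + l) * (B1 + B2) * exp (a + b))) / 2 ^ n)
      with (B0 / 2 ^ n + L * ((2 + l) * (B1 + B2) * exp (a + b)) / 2 ^ n) by (field; lra).
    lra. }
  assert (shift : forall h (x : nat -> R -> R -> C),
    (forall M, exists B, 0 <= B /\ forall n a b, Rabs a <= M -> Rabs b <= M ->
        Cmod (x n a b - h a b)%C <= B / 2 ^ n) ->
    (forall M, exists B, 0 <= B /\ forall n a b, Rabs a <= M -> Rabs b <= M ->
        Cmod (x (S n) a b - h a b)%C <= B / 2 ^ n)).
  { intros h x Hx M. destruct (Hx M) as [B [HB H]]. exists B; split; [exact HB|].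
    intros n a b Ha Hb. eapply Rle_trans; [now apply H|].
    assert (P2 : 0 < 2 ^ n) by (apply pow_lt; lra).
    apply Rmult_le_compat_l; [exact HB|].
    apply Rinv_le_contravar; [exact P2|]. simpl; lra. }
  exists f, g. intros N. split; try assumption.
  - apply (conclude F f HF LF (shift f _ Hfl) N).
  - apply (conclude G g HG LG (shift g _ Hgl) N).
Qed.

(** The same contraction, iterated on a difference of two solutions.  The Lipschitz
    bound is only asked along these two, so cubic sources qualify. *)
Theorem mild_uniqueness s mu nu vi f g f' g' N L :
  entry_curve s -> (forall a, continuous nu a) ->
  cont2 f -> cont2 g -> cont2 f' -> cont2 g' -> 0 <= L ->
  (forall a b, reg s N a b ->
     let d := Cmod (fwd_wave s mu nu vi f g a b - fwd_wave s mu nu vi f' g' a b)%C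
              + Cmod (back_wave vi g a b - back_wave vi g' a b)%C in
     Cmod (f a b - f' a b)%C <= L * d /\ Cmod (g a b - g' a b)%C <= L * d) ->
  forall a b, reg s N a b ->
    fwd_wave s mu nu vi f g a b = fwd_wave s mu nu vi f' g' a b /\
    back_wave vi g a b = back_wave vi g' a b.
Proof.
  intros Hs Hnu Hf Hg Hf' Hg' HL H.
  destruct (interval_bounded nu N Hnu) as [l [Hl Hnl]].
  destruct (source_bound s (fun a b => f a b - f' a b)%C (fun a b => g a b - g' a b)%C N Hs)
    as [B [HB H0]]; [intros p; cont|intros p; cont|].
  set (K := 2 * L * (2 + l) + 1).
  assert (HK : 0 < K) by (unfold K; nra).
  assert (rate : forall n : nat, forall a b, reg s N a b ->
     Cmod (f a b - f' a b)%C <= B / 2 ^ n * exp (K * (a + b)) /\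
     Cmod (g a b - g' a b)%C <= B / 2 ^ n * exp (K * (a + b))).
  { induction n as [|n IH]; intros a b Hab.
    - simpl pow. unfold Rdiv; rewrite Rinv_1, Rmult_1_r. exact (H0 K HK a b Hab).
    - assert (P2 : 0 < 2 ^ n) by (apply pow_lt; lra).
      assert (HBn : 0 <= B / 2 ^ n) by (apply Rdiv_le_0_compat; lra).
      assert (key := wave_halving s mu nu vi _ _ _ _ N L _ l
                  Hs Hf Hg Hf' Hg' HL HBn Hnl Hl IH a b Hab).
      replace (B / 2 ^ n / 2) with (B / 2 ^ S n) in key by (simpl; field; lra).
      destruct (H a b Hab) as [Hx Hy]. split; eapply Rle_trans; eassumption. }
  intros a b Hab.
  assert (final : forall n : nat,
    Cmod (back_wave vi g a b - back_wave vi g' a b)%C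
       <= (1 + l) * (B / K) * exp (K * (a + b)) / 2 ^ n /\
    Cmod (fwd_wave s mu nu vi f g a b - fwd_wave s mu nu vi f' g' a b)%C
       <= (1 + l) * (B / K) * exp (K * (a + b)) / 2 ^ n).
  { intros n. assert (P2 : 0 < 2 ^ n) by (apply pow_lt; lra).
    assert (HBn : 0 <= B / 2 ^ n) by (apply Rdiv_le_0_compat; lra).
    destruct (wave_contraction s mu nu vi _ _ _ _ N K _ l
                  Hs Hf Hg Hf' Hg' HK HBn Hnl (rate n) a b Hab) as [HV HU].
    replace ((1 + l) * (B / K) * exp (K * (a + b)) / 2 ^ n)
      with ((1 + l) * (B / 2 ^ n / K) * exp (K * (a + b))) by (field; lra).
    split; [|exact HU]. eapply Rle_trans; [exact HV|].
    apply Rmult_le_compat_r; [left; apply exp_pos|].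
    assert (0 <= B / 2 ^ n / K) by (apply Rdiv_le_0_compat; lra). nra. }
  split; apply Cmod_sub_eq_0.
  - exact (le_0_of_geometric _ _ (fun n => proj2 (final n))).
  - exact (le_0_of_geometric _ _ (fun n => proj1 (final n))).
Qed.

(** * The cubic nonlinearity *)

(** The real-trilinear form whose diagonal is [N2]. *)
Definition tri (al be : R) (w1 w2 w3 : C * C) : C :=
  (RtoC al * snd w1 * fst w2 * Cconj (fst w3)
   + RtoC 2 * RtoC be * fst w1 * (Cconj (fst w2) * snd w3 + fst w2 * Cconj (snd w3)))%C.

Definition wabs (w : C * C) : R := Cmod (fst w) + Cmod (snd w).

(** Differential of [N2] at [(x, y)] in the direction [(p, q)]; real-linear only,
    because of the conjugations. *)
Definition dN2 (al be : R) (x y p q : C) : C :=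
  (tri al be (p, q) (x, y) (x, y) + tri al be (x, y) (p, q) (x, y)
   + tri al be (x, y) (x, y) (p, q))%C.

Definition tri_bound (al be : R) : R := Rabs al + 4 * Rabs be.

Lemma tri_bound_nonneg al be : 0 <= tri_bound al be.
Proof. unfold tri_bound. generalize (Rabs_pos al) (Rabs_pos be); lra. Qed.

Lemma wabs_nonneg w : 0 <= wabs w.
Proof. unfold wabs. generalize (Cmod_ge_0 (fst w)) (Cmod_ge_0 (snd w)); lra. Qed.

Lemma tri_le al be w1 w2 w3 :
  Cmod (tri al be w1 w2 w3) <= tri_bound al be * (wabs w1 * wabs w2 * wabs w3).
Proof.
  destruct w1 as [x1 y1], w2 as [x2 y2], w3 as [x3 y3].
  unfold tri, wabs, tri_bound; simpl.
  eapply Rle_trans; [apply Cmod_triangle|].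
  rewrite !Cmod_mult, !Cmod_R, Cmod_conj, (Rabs_pos_eq 2) by lra.
  assert (H := Cmod_triangle (Cconj x2 * y3)%C (x2 * Cconj y3)%C).
  rewrite !Cmod_mult, !Cmod_conj in H.
  generalize (Cmod_ge_0 x1) (Cmod_ge_0 x2) (Cmod_ge_0 x3) (Cmod_ge_0 y1) (Cmod_ge_0 y2) (Cmod_ge_0 y3).
  set (X1 := Cmod x1) in *; set (X2 := Cmod x2) in *; set (X3 := Cmod x3) in *.
  set (Y1 := Cmod y1) in *; set (Y2 := Cmod y2) in *; set (Y3 := Cmod y3) in *.
  intros.
  set (A := Rabs al); set (B := Rabs be).
  assert (0 <= A) by apply Rabs_pos. assert (0 <= B) by apply Rabs_pos.
  assert (P : X2 * X3 <= (X2 + Y2) * (X3 + Y3)) by nra.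
  assert (P' : X2 * Y3 <= (X2 + Y2) * (X3 + Y3)) by nra.
  assert (0 <= X2 * X3) by nra. assert (0 <= X2 * Y3) by nra.
  set (Q := (X2 + Y2) * (X3 + Y3)) in *.
  assert (A * Y1 * X2 * X3 <= A * ((X1 + Y1) * Q)).
  { replace (A * Y1 * X2 * X3) with (A * (Y1 * (X2 * X3))) by ring.
    apply Rmult_le_compat_l; [lra|]. apply Rmult_le_compat; lra. }
  assert (2 * B * X1 * Cmod (Cconj x2 * y3 + x2 * Cconj y3)%C <= 4 * B * ((X1 + Y1) * Q)).
  { apply Rle_trans with (2 * B * X1 * (2 * Q)).
    - apply Rmult_le_compat_l; [|lra]. apply Rmult_le_pos; lra.
    - replace (2 * B * X1 * (2 * Q)) with (4 * B * (X1 * Q)) by ring.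
      apply Rmult_le_compat_l; [lra|]. apply Rmult_le_compat_r; lra. }
  replace ((A + 4 * B) * ((X1 + Y1) * (X2 + Y2) * (X3 + Y3)))
    with (A * ((X1 + Y1) * Q) + 4 * B * ((X1 + Y1) * Q)) by (unfold Q; ring).
  lra.
Qed.

Lemma N2_tri al be x y : N2 al be x y = tri al be (x, y) (x, y) (x, y).
Proof. unfold N2, tri; simpl fst; simpl snd. rewrite Cmod2_conj. ring. Qed.

Lemma N1_N2 al be u v : N1 al be u v = N2 al be v u.
Proof. unfold N1, N2. ring. Qed.

Lemma Cconj_add x y : Cconj (x + y)%C = (Cconj x + Cconj y)%C.
Proof. unfold Cconj; destruct x, y; simpl; unfold Cplus; simpl; f_equal; ring. Qed.

Lemma Cconj_sub x y : Cconj (x - y)%C = (Cconj x - Cconj y)%C.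
Proof. unfold Cconj; destruct x, y; simpl; unfold Cminus, Cplus, Copp; simpl; f_equal; ring. Qed.

(** Telescoping in the three slots of [tri]. *)
Lemma N2_lipschitz al be M x y x' y' :
  Cmod x + Cmod y <= M -> Cmod x' + Cmod y' <= M ->
  Cmod (N2 al be x y - N2 al be x' y')%C
   <= 3 * tri_bound al be * (M * M) * (Cmod (x - x')%C + Cmod (y - y')%C).
Proof.
  intros H H'.
  rewrite !N2_tri.
  set (w := (x, y)); set (w' := (x', y')); set (d := (x - x', y - y')%C).
  replace (tri al be w w w - tri al be w' w' w')%C with
    (tri al be d w w + tri al be w' d w + tri al be w' w' d)%C.
  2:{ unfold tri, w, w', d; simpl. rewrite !Cconj_sub. ring. }
  eapply Rle_trans; [apply Cmod_triangle|].
  assert (T := Cmod_triangle (tri al be d w w) (tri al be w' d w)).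
  assert (T1 := tri_le al be d w w). assert (T2 := tri_le al be w' d w).
  assert (T3 := tri_le al be w' w' d).
  change (Cmod (x - x')%C + Cmod (y - y')%C) with (wabs d).
  change (Cmod x + Cmod y) with (wabs w) in H. change (Cmod x' + Cmod y') with (wabs w') in H'.
  generalize (wabs_nonneg w) (wabs_nonneg w') (wabs_nonneg d) (tri_bound_nonneg al be).
  intros p1 p2 p3 p4.
  assert (q1 : wabs w * wabs w <= M * M) by nra.
  assert (q2 : wabs w' * wabs w <= M * M) by nra.
  assert (q3 : wabs w' * wabs w' <= M * M) by nra.
  set (c := tri_bound al be) in *. set (D := wabs d) in *.
  assert (r : forall z, z <= M * M -> c * (z * D) <= c * (M * M) * D).
  { intros z Hz. rewrite Rmult_assoc. apply Rmult_le_compat_l; [lra|].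
    apply Rmult_le_compat_r; lra. }
  apply r in q1, q2, q3.
  replace (c * (D * wabs w * wabs w)) with (c * (wabs w * wabs w * D)) in T1 by ring.
  replace (c * (wabs w' * D * wabs w)) with (c * (wabs w' * wabs w * D)) in T2 by ring.
  lra.
Qed.

Lemma N2_taylor al be M x y p q :
  Cmod x + Cmod y <= M -> Cmod p + Cmod q <= M ->
  Cmod (N2 al be (x + p) (y + q) - N2 al be x y - dN2 al be x y p q)%C
   <= 4 * tri_bound al be * M * ((Cmod p + Cmod q) * (Cmod p + Cmod q)).
Proof.
  intros H H'. unfold dN2. rewrite !N2_tri.
  set (w := (x, y)); set (d := (p, q)).
  replace (tri al be (x + p, y + q)%C (x + p, y + q)%C (x + p, y + q)%C - tri al be w w w
     - (tri al be d w w + tri al be w d w + tri al be w w d))%C with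
    (tri al be d d w + tri al be d w d + (tri al be w d d + tri al be d d d))%C.
  2:{ unfold tri, w, d; simpl. rewrite !Cconj_add. ring. }
  assert (T1 := tri_le al be d d w). assert (T2 := tri_le al be d w d).
  assert (T3 := tri_le al be w d d). assert (T4 := tri_le al be d d d).
  change (Cmod p + Cmod q) with (wabs d) in *. change (Cmod x + Cmod y) with (wabs w) in H.
  generalize (wabs_nonneg w) (wabs_nonneg d) (tri_bound_nonneg al be).
  set (W := wabs w) in *. set (D := wabs d) in *. set (c := tri_bound al be) in *.
  intros.
  eapply Rle_trans; [apply Cmod_triangle|].
  assert (U1 := Cmod_triangle (tri al be d d w) (tri al be d w d)).
  assert (U2 := Cmod_triangle (tri al be w d d) (tri al be d d d)).
  assert (HD : 0 <= D * D) by nra.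
  assert (r : forall z, z <= M -> c * (D * D * z) <= c * M * (D * D)).
  { intros z Hz. replace (c * M * (D * D)) with (c * (D * D * M)) by ring.
    apply Rmult_le_compat_l; [lra|]. apply Rmult_le_compat_l; lra. }
  assert (r1 := r W H). assert (r2 := r D H').
  replace (c * (D * W * D)) with (c * (D * D * W)) in T2 by ring.
  replace (c * (W * D * D)) with (c * (D * D * W)) in T3 by ring.
  lra.
Qed.

Lemma dN2_sub al be x y p q p' q' :
  (dN2 al be x y p q - dN2 al be x y p' q' = dN2 al be x y (p - p') (q - q'))%C.
Proof. unfold dN2, tri; simpl. rewrite !Cconj_sub. ring. Qed.

Lemma dN2_le al be M x y p q :
  Cmod x + Cmod y <= M ->
  Cmod (dN2 al be x y p q) <= 3 * tri_bound al be * (M * M) * (Cmod p + Cmod q).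
Proof.
  intros H. unfold dN2.
  set (w := (x, y)); set (d := (p, q)).
  eapply Rle_trans; [apply Cmod_triangle|].
  assert (T := Cmod_triangle (tri al be d w w) (tri al be w d w)).
  assert (T1 := tri_le al be d w w). assert (T2 := tri_le al be w d w).
  assert (T3 := tri_le al be w w d).
  change (Cmod p + Cmod q) with (wabs d). change (Cmod x + Cmod y) with (wabs w) in H.
  generalize (wabs_nonneg w) (wabs_nonneg d) (tri_bound_nonneg al be).
  intros p1 p2 p3.
  set (c := tri_bound al be) in *. set (D := wabs d) in *.
  assert (q1 : c * (wabs w * wabs w * D) <= c * (M * M) * D).
  { rewrite (Rmult_assoc c (M * M)). apply Rmult_le_compat_l; [lra|].
    apply Rmult_le_compat_r; [lra|]. nra. }
  replace (c * (D * wabs w * wabs w)) with (c * (wabs w * wabs w * D)) in T1 by ring.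
  replace (c * (wabs w * D * wabs w)) with (c * (wabs w * wabs w * D)) in T2 by ring.
  lra.
Qed.

(** The equations read [u_t + u_x = src u v] and [v_t - v_x = src v u]. *)
Definition src (m al be : R) (p q : C) : C := (Ci * (RtoC m * q - N2 al be q p))%C.

Definition dsrc (m al be : R) (p q dp dq : C) : C :=
  (Ci * (RtoC m * dq - dN2 al be q p dq dp))%C.

Lemma Ci_sq : (Ci * Ci = - (1))%C.
Proof. unfold Ci, Cmult, Copp, RtoC; simpl. f_equal; ring. Qed.

Lemma equation_src (m : R) (D q n : C) :
  (Ci * D = - (RtoC m * q) + n)%C <-> D = (Ci * (RtoC m * q - n))%C.
Proof.
  split; intros H.
  - transitivity (- (Ci * (Ci * D)))%C.
    + replace (Ci * (Ci * D))%C with (Ci * Ci * D)%C by ring. rewrite Ci_sq. ring.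
    + rewrite H. ring.
  - rewrite H. replace (Ci * (Ci * (RtoC m * q - n)))%C with (Ci * Ci * (RtoC m * q - n))%C by ring.
    rewrite Ci_sq. ring.
Qed.

Lemma cont2_src m al be (p q : R -> R -> C) :
  cont2 p -> cont2 q -> cont2 (fun a b => src m al be (p a b) (q a b)).
Proof.
  intros Cp Cq x. unfold src.
  apply continuous_ext with (f := fun y : R * R => let w := (q (fst y) (snd y), p (fst y) (snd y)) in
    (Ci * (RtoC m * q (fst y) (snd y) - tri al be w w w))%C).
  - intros y. now rewrite N2_tri.
  - unfold tri; simpl. cont.
Qed.

(** ** Truncation *)

(** The factor that brings [(p, q)] back into the ball [|p|, |q| <= r]. *)
Definition cut (r : R) (p q : C) : R := r / Rmax r (Rmax (Cmod p) (Cmod q)).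

Lemma cut_sym r p q : cut r p q = cut r q p.
Proof. unfold cut. now rewrite (Rmax_comm (Cmod p)). Qed.

Lemma cut_range r p q : 0 < r -> 0 <= cut r p q <= 1.
Proof.
  intros Hr. unfold cut. generalize (Rmax_l r (Rmax (Cmod p) (Cmod q))). intros.
  split; [apply Rdiv_le_0_compat; lra|]. apply Rle_div_l; lra.
Qed.

Lemma cut_one r p q : 0 < r -> Cmod p <= r -> Cmod q <= r -> cut r p q = 1.
Proof.
  intros Hr Hp Hq. unfold cut. rewrite Rmax_left; [field; lra|].
  now apply Rmax_lub.
Qed.

Lemma cut_bound r p q : 0 < r -> cut r p q * Cmod p <= r.
Proof.
  intros Hr. unfold cut.
  generalize (Rmax_l r (Rmax (Cmod p) (Cmod q))) (Rmax_r r (Rmax (Cmod p) (Cmod q)))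
    (Rmax_l (Cmod p) (Cmod q)); intros.
  set (X := Rmax r (Rmax (Cmod p) (Cmod q))) in *.
  replace (r / X * Cmod p) with (r * Cmod p / X) by (field; lra).
  apply Rle_div_l; [lra|]. apply Rmult_le_compat_l; lra.
Qed.

Lemma Cmod_diff_le (p q : C) : Rabs (Cmod p - Cmod q) <= Cmod (p - q)%C.
Proof.
  apply Rabs_le_between.
  assert (H1 := Cmod_triangle (p - q)%C q). replace (p - q + q)%C with p in H1 by ring.
  assert (H2 := Cmod_triangle (q - p)%C p). replace (q - p + p)%C with q in H2 by ring.
  rewrite (Cmod_sub_sym q p) in H2. lra.
Qed.

Lemma cut_lipschitz r p q p' q' : 0 < r ->
  Cmod (RtoC (cut r p q) * p - RtoC (cut r p' q') * p')%C
   <= 2 * (Cmod (p - p')%C + Cmod (q - q')%C).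
Proof.
  intros Hr. unfold cut.
  assert (Hp := Cmod_diff_le p p'). assert (Hq := Cmod_diff_le q q').
  apply Rabs_le_between in Hp, Hq.
  generalize (Cmod_ge_0 (p - p')%C) (Cmod_ge_0 (q - q')%C) (Cmod_ge_0 p') (Cmod_ge_0 q'); intros P1 P2 P3 P4.
  set (X := Rmax r (Rmax (Cmod p) (Cmod q))). set (X' := Rmax r (Rmax (Cmod p') (Cmod q'))).
  assert (HX : r <= X) by apply Rmax_l.
  assert (HX' : r <= X') by apply Rmax_l.
  assert (HXp : Cmod p' <= X').
  { eapply Rle_trans; [|apply Rmax_r]. apply Rmax_l. }
  set (D := Cmod (p - p')%C + Cmod (q - q')%C).
  assert (HXX : Rabs (X' - X) <= D).
  { apply Rabs_le_between. unfold X, X', D.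
    unfold Rmax; repeat destruct (Rle_dec _ _); lra. }
  replace (RtoC (r / X) * p - RtoC (r / X') * p')%C with
    (RtoC (r / X) * (p - p') + RtoC (r / X - r / X') * p')%C by (rewrite RtoC_minus; ring).
  eapply Rle_trans; [apply Cmod_triangle|]. rewrite !Cmod_mult, !Cmod_R.
  assert (0 <= r / X <= 1).
  { split; [apply Rdiv_le_0_compat; lra|]. apply Rle_div_l; lra. }
  rewrite (Rabs_pos_eq (r / X)) by lra.
  assert (E1 : r / X * Cmod (p - p')%C <= D) by (unfold D; nra).
  assert (E2 : Rabs (r / X - r / X') * Cmod p' <= D).
  { replace (r / X - r / X') with (r / X * ((X' - X) / X')) by (field; lra).
    rewrite Rabs_mult, (Rabs_pos_eq (r / X)) by lra.
    unfold Rdiv at 2. rewrite Rabs_mult, (Rabs_pos_eq (/ X')) by (left; apply Rinv_0_lt_compat; lra).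
    assert (F : Rabs (X' - X) * / X' * Cmod p' <= D).
    { replace (Rabs (X' - X) * / X' * Cmod p') with (Rabs (X' - X) * (Cmod p' / X')) by (field; lra).
      assert (0 <= Cmod p' / X' <= 1).
      { split; [apply Rdiv_le_0_compat; lra|]. apply Rle_div_l; lra. }
      generalize (Rabs_pos (X' - X)); nra. }
    assert (0 <= Rabs (X' - X) * / X' * Cmod p').
    { apply Rmult_le_pos; [apply Rmult_le_pos; [apply Rabs_pos|left; apply Rinv_0_lt_compat; lra]|lra]. }
    nra. }
  lra.
Qed.

(** Scaling both fields by the same real factor makes the nonlinearity globally
    Lipschitz without spoiling the algebra behind charge conservation. *)
Definition cut_src (m al be r : R) (p q : C) : C :=
  (Ci * (RtoC m * q - N2 al be (RtoC (cut r p q) * q) (RtoC (cut r p q) * p)))%C.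

Lemma cut_src_lipschitz m al be r : 0 < r -> exists L, 0 <= L /\ forall p q p' q',
  Cmod (cut_src m al be r p q - cut_src m al be r p' q')%C
   <= L * (Cmod (p - p')%C + Cmod (q - q')%C).
Proof.
  intros Hr. exists (Rabs m + 3 * tri_bound al be * ((2 * r) * (2 * r)) * 4).
  assert (Hc := tri_bound_nonneg al be).
  split.
  { generalize (Rabs_pos m). assert (0 <= r * r) by nra.
    assert (0 <= tri_bound al be * (r * r)) by now apply Rmult_le_pos. nra. }
  intros p q p' q'. unfold cut_src.
  set (k := cut r p q). set (k' := cut r p' q').
  replace (Ci * (RtoC m * q - N2 al be (RtoC k * q) (RtoC k * p)) -
     Ci * (RtoC m * q' - N2 al be (RtoC k' * q') (RtoC k' * p')))%C with
    (Ci * (RtoC m * (q - q') + - (N2 al be (RtoC k * q) (RtoC k * p) - N2 al be (RtoC k' * q') (RtoC k' * p'))))%C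
    by ring.
  rewrite Cmod_mult, Cmod_Ci, Rmult_1_l.
  eapply Rle_trans; [apply Cmod_triangle|]. rewrite Cmod_opp, Cmod_mult, Cmod_R.
  assert (B : forall a b, Cmod (RtoC (cut r a b) * b)%C + Cmod (RtoC (cut r a b) * a)%C <= 2 * r).
  { intros a b. rewrite !Cmod_mult, !Cmod_R, !Rabs_pos_eq by now apply cut_range.
    generalize (cut_bound r a b Hr) (cut_bound r b a Hr). rewrite (cut_sym r b a). lra. }
  assert (HN := N2_lipschitz al be (2 * r) _ _ _ _ (B p q) (B p' q')).
  fold k k' in HN.
  assert (H1 := cut_lipschitz r p q p' q' Hr). fold k k' in H1.
  assert (H2 := cut_lipschitz r q p q' p' Hr).
  rewrite (cut_sym r q p), (cut_sym r q' p') in H2. fold k k' in H2.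
  generalize (Cmod_ge_0 (p - p')%C) (Cmod_ge_0 (q - q')%C); intros P1 P2.
  set (D := Cmod (p - p')%C + Cmod (q - q')%C) in *.
  assert (HH : Cmod (RtoC k * q - RtoC k' * q')%C + Cmod (RtoC k * p - RtoC k' * p')%C <= 4 * D)
    by (unfold D in *; lra).
  set (e := 3 * tri_bound al be * (2 * r * (2 * r))) in *.
  assert (He : 0 <= e) by (unfold e; apply Rmult_le_pos; nra).
  assert (e * (Cmod (RtoC k * q - RtoC k' * q')%C + Cmod (RtoC k * p - RtoC k' * p')%C) <= e * (4 * D))
    by (apply Rmult_le_compat_l; lra).
  assert (Rabs m * Cmod (q - q')%C <= Rabs m * D).
  { apply Rmult_le_compat_l; [apply Rabs_pos|unfold D; lra]. }
  lra.
Qed.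

Lemma cont2_cut_src m al be r (p q : R -> R -> C) : 0 < r ->
  cont2 p -> cont2 q -> cont2 (fun a b => cut_src m al be r (p a b) (q a b)).
Proof.
  intros Hr Cp Cq x. destruct (cut_src_lipschitz m al be r Hr) as [L [HL H]].
  apply continuous_C_eps. intros e He.
  assert (He' : 0 < e / (2 * (L + 1))) by (apply Rdiv_lt_0_compat; lra).
  refine (filter_imp _ _ _ (filter_and _ _ (proj1 (continuous_C_eps _ x) (Cp x) _ He')
    (proj1 (continuous_C_eps _ x) (Cq x) _ He'))).
  intros y [H1 H2]. eapply Rle_lt_trans; [apply H|].
  assert (Hx : (L + 1) * (e / (2 * (L + 1))) = e / 2) by (field; lra).
  generalize (Cmod_ge_0 (p (fst y) (snd y) - p (fst x) (snd x))%C)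
    (Cmod_ge_0 (q (fst y) (snd y) - q (fst x) (snd x))%C). nra.
Qed.

Lemma N2_homogeneous al be k x y :
  N2 al be (RtoC k * x) (RtoC k * y) = (RtoC (k * k * k) * N2 al be x y)%C.
Proof.
  rewrite !N2_tri. unfold tri; simpl.
  replace (Cconj (RtoC k * x)) with (RtoC k * Cconj x)%C.
  2:{ destruct x; unfold Cconj, RtoC, Cmult; simpl; f_equal; ring. }
  replace (Cconj (RtoC k * y)) with (RtoC k * Cconj y)%C.
  2:{ destruct y; unfold Cconj, RtoC, Cmult; simpl; f_equal; ring. }
  rewrite !RtoC_mult. ring.
Qed.

Lemma cut_src_scaled m al be r p q : 0 < r -> exists k, 0 <= k <= 1 /\
  cut_src m al be r p q = (Ci * (RtoC m * q - RtoC k * N2 al be q p))%C /\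
  cut_src m al be r q p = (Ci * (RtoC m * p - RtoC k * N2 al be p q))%C.
Proof.
  intros Hr. set (c := cut r p q). exists (c * c * c).
  assert (Hc : 0 <= c <= 1) by now apply cut_range.
  split.
  { assert (0 <= c * c <= 1) by nra. nra. }
  unfold cut_src. rewrite (cut_sym r q p). fold c. rewrite !N2_homogeneous. split; reflexivity.
Qed.

Lemma cut_src_src m al be r p q :
  0 < r -> Cmod p <= r -> Cmod q <= r -> cut_src m al be r p q = src m al be p q.
Proof.
  intros Hr Hp Hq. unfold cut_src, src. rewrite cut_one by assumption.
  now rewrite !Cmult_1_l.
Qed.

Definition normsq (x : C) : R := Re x * Re x + Im x * Im x.

Lemma normsq_nonneg x : 0 <= normsq x.
Proof. unfold normsq; nra. Qed.

Lemma Re_N2 al be x y : Re (N2 al be x y) =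
  al * Re y * normsq x + 4 * be * Re x * (Re x * Re y + Im x * Im y).
Proof.
  rewrite N2_tri. destruct x as [a b], y as [c d].
  unfold tri, normsq, Re, Im; simpl. ring.
Qed.

Lemma Im_N2 al be x y : Im (N2 al be x y) =
  al * Im y * normsq x + 4 * be * Im x * (Re x * Re y + Im x * Im y).
Proof.
  rewrite N2_tri. destruct x as [a b], y as [c d].
  unfold tri, normsq, Re, Im; simpl. ring.
Qed.

(** [charge_rate p f] is the derivative of [|p|^2] when that of [p] is [f]. *)
Definition charge_rate (p f : C) : R := 2 * (Re p * Re f + Im p * Im f).

Lemma Re_rate m k n q : Re (Ci * (RtoC m * q - RtoC k * n))%C = - (m * Im q - k * Im n).
Proof. destruct q, n; unfold Re, Im; simpl. ring. Qed.

Lemma Im_rate m k n q : Im (Ci * (RtoC m * q - RtoC k * n))%C = m * Re q - k * Re n.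
Proof. destruct q, n; unfold Re, Im; simpl. ring. Qed.

(** The nonlinear contributions to the two rates are [Im (conj p * N1)] and
    [Im (conj q * N2)], both multiples of [Re (conj p * q) * Im (conj p * q)], with
    opposite signs. *)
Lemma charge_rate_cancel m al be k p q :
  charge_rate p (Ci * (RtoC m * q - RtoC k * N2 al be q p))%C
  + charge_rate q (Ci * (RtoC m * p - RtoC k * N2 al be p q))%C = 0.
Proof.
  unfold charge_rate. rewrite !Re_rate, !Im_rate, !Re_N2, !Im_N2. unfold normsq. ring.
Qed.

(** No fourth powers: the rate of [|p|^2] is linear in [|p|^2] with a coefficient
    controlled by [|q|^2]. *)
Lemma charge_rate_le m al be k p q : 0 <= m -> 0 <= k <= 1 ->
  charge_rate p (Ci * (RtoC m * q - RtoC k * N2 al be q p))%C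
  <= m * (normsq p + normsq q) + 4 * Rabs be * normsq q * normsq p.
Proof.
  intros Hm Hk. unfold charge_rate. rewrite !Re_rate, !Im_rate, !Re_N2, !Im_N2.
  unfold normsq. destruct p as [a b], q as [c d]. unfold Re, Im; simpl.
  set (S1 := c * a + d * b). set (S2 := a * d - b * c).
  match goal with |- ?l <= _ => replace l with (- 2 * m * S2 + k * (8 * be * (S1 * S2)))
    by (unfold S1, S2; ring) end.
  assert (HS : S1 * S1 + S2 * S2 = (c * c + d * d) * (a * a + b * b)) by (unfold S1, S2; ring).
  assert (Hbe : be * (S1 * S2) <= Rabs be * ((S1 * S1 + S2 * S2) / 2)).
  { assert (Hab : Rabs (S1 * S2) <= (S1 * S1 + S2 * S2) / 2).
    { apply Rabs_le_between. generalize (Rle_0_sqr (S1 + S2)) (Rle_0_sqr (S1 - S2)).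
      unfold Rsqr; lra. }
    eapply Rle_trans; [apply Rle_abs|]. rewrite Rabs_mult.
    apply Rmult_le_compat_l; [apply Rabs_pos|exact Hab]. }
  assert (H0 : 0 <= Rabs be * ((S1 * S1 + S2 * S2) / 2)).
  { apply Rmult_le_pos; [apply Rabs_pos|]. nra. }
  assert (H1 : k * (8 * be * (S1 * S2)) <= 8 * (Rabs be * ((S1 * S1 + S2 * S2) / 2))).
  { replace (k * (8 * be * (S1 * S2))) with (8 * (k * (be * (S1 * S2)))) by ring.
    apply Rmult_le_compat_l; [lra|]. nra. }
  assert (H2 : - 2 * S2 <= a * a + b * b + (c * c + d * d)).
  { unfold S2. generalize (Rle_0_sqr (a + d)) (Rle_0_sqr (b - c)). unfold Rsqr. lra. }
  assert (H3 : m * (- 2 * S2) <= m * (a * a + b * b + (c * c + d * d)))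
    by (apply Rmult_le_compat_l; lra).
  rewrite HS in H1.
  replace (4 * Rabs be * (c * c + d * d) * (a * a + b * b)) with
    (8 * (Rabs be * ((c * c + d * d) * (a * a + b * b) / 2))) by field.
  lra.
Qed.

(** * A priori bounds *)

Lemma is_derive_RInt_lower (q h : R -> R -> R) (sg : R -> R) (ds a0 b : R) :
  cont2 q -> cont2 h -> (forall a b, is_derive (fun b => q a b) b (h a b)) ->
  is_derive sg b ds ->
  is_derive (fun b => RInt (fun a => q a b) (sg b) a0) b
    (RInt (fun a => h a b) (sg b) a0 + - q (sg b) b * ds).
Proof.
  intros Hq Hh Hd Hs.
  assert (HD : forall t x, Derive (fun u => q t u) x = h t x).
  { intros t x. apply is_derive_unique, Hd. }
  assert (Hex : forall y c d, ex_RInt (fun t => q t y) c d).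
  { intros; apply ex_RInt_cont; intros; cont. }
  assert (Hc2 : forall x t, continuity_2d_pt (fun u v => Derive (fun z => q v z) u) x t).
  { intros x t. apply continuity_2d_pt_ext with (f := fun u v => h v u).
    { intros; now rewrite HD. }
    apply (cont2_continuity_2d (fun u v => h v u)). intros p; cont. }
  rewrite (RInt_ext _ (fun a => Derive (fun u => q a u) b)) by (intros; now rewrite HD).
  apply (is_derive_RInt_param_bound_comp_aux2 (fun x t => q t x) sg a0 b ds).
  - apply filter_forall; intros; apply Hex.
  - exists (mkposreal 1 Rlt_0_1). apply filter_forall; intros; apply Hex.
  - exact Hs.
  - exists (mkposreal 1 Rlt_0_1). apply filter_forall; intros x t _.
    eexists; apply Hd.
  - intros; apply Hc2.
  - apply locally_2d_forall; intros; apply Hc2.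
  - apply continuous_continuity_pt. cont.
Qed.

(** Conservation of charge on the region [sg b <= a <= a0], [b1 <= b <= b2]: what
    leaves through [b = b2] and [a = a0] entered through [b = b1] and [a = sg b]. *)
Lemma flux_bound (e q h1 h2 : R -> R -> R) (sg dsg : R -> R) (a0 b1 b2 k : R) :
  cont2 e -> cont2 q -> cont2 h1 -> cont2 h2 ->
  (forall a b, is_derive (fun a => e a b) a (h1 a b)) ->
  (forall a b, is_derive (fun b => q a b) b (h2 a b)) ->
  (forall b, is_derive sg b (dsg b)) -> b1 <= b2 ->
  (forall b, b1 <= b <= b2 -> sg b <= a0 /\
     (forall a, sg b <= a <= a0 -> h1 a b + h2 a b = 0) /\
     e (sg b) b - dsg b * q (sg b) b <= k) ->
  RInt (fun a => q a b2) (sg b2) a0 + RInt (fun b => e a0 b) b1 b2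
    <= RInt (fun a => q a b1) (sg b1) a0 + k * (b2 - b1).
Proof.
  intros He Hq Hh1 Hh2 De Dq Dsg Hb H.
  set (Psi := fun b => RInt (fun a => q a b) (sg b) a0 + RInt (fun b => e a0 b) b1 b).
  set (dPsi := fun b => (RInt (fun a => h2 a b) (sg b) a0 + - q (sg b) b * dsg b) + e a0 b).
  assert (HP : forall b, is_derive Psi b (dPsi b)).
  { intros b. apply (is_derive_plus (K := R_AbsRing) (V := R_NormedModule)).
    - now apply is_derive_RInt_lower.
    - apply (is_derive_RInt_cont (fun b => e a0 b)). intros; cont. }
  assert (HPsi : Psi b2 - Psi b1 <= k * (b2 - b1)).
  { apply increase_le_of_derive_le with (df := dPsi); auto.
    - intros x _. apply (is_derive_continuous_R _ _ _ (HP x)).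
    - intros b Hb'. destruct (H b Hb') as [H1 [H2 H3]]. unfold dPsi.
      assert (Hi : RInt (fun a => h1 a b) (sg b) a0 = e a0 b - e (sg b) b).
      { apply is_RInt_unique.
        apply (is_RInt_derive (V := R_CompleteNormedModule) (fun a => e a b) (fun a => h1 a b));
        intros; [apply De|cont]. }
      assert (Hs : RInt (fun a => h2 a b) (sg b) a0 = - RInt (fun a => h1 a b) (sg b) a0).
      { rewrite <- (RInt_opp (V := R_CompleteNormedModule)) by (apply ex_RInt_cont; intros; cont).
        apply RInt_ext. intros a Ha. rewrite Rmin_left, Rmax_right in Ha by lra.
        assert (h1 a b + h2 a b = 0) by (apply H2; lra).
        unfold opp; simpl; lra. }
      rewrite Hs, Hi. lra. }
  unfold Psi in HPsi.
  rewrite (RInt_point b1 (fun b => e a0 b)) in HPsi. unfold zero in HPsi; simpl in HPsi. lra.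
Qed.

(** A quadratic growth rate is harmless when the other field is square
    integrable along the characteristic. *)
Lemma growth_bound (y h w : R -> R) (m k C0 c d : R) :
  0 <= m -> 0 <= k -> c <= d -> (forall x, continuous w x) ->
  (forall x, is_derive y x (h x)) ->
  (forall x, c <= x <= d -> 0 <= y x /\ 0 <= w x /\
     h x <= m * (y x + w x) + k * w x * y x) ->
  RInt w c d <= C0 ->
  y d <= exp (m * (d - c) + k * C0) * (y c + m * C0).
Proof.
  intros Hm Hk Hcd Hw Dy H HC.
  set (I := fun x => RInt w c x).
  assert (DI : forall x, is_derive I x (w x)) by (intros; now apply is_derive_RInt_cont).
  set (Phi := fun x => m * (x - c) + k * I x).
  assert (DPhi : forall x, is_derive Phi x (m + k * w x)).
  { intros x. unfold Phi.
    apply (is_derive_plus (K := R_AbsRing) (V := R_NormedModule)).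
    - auto_derive; [exact Logic.I|ring].
    - apply is_derive_scal, DI. }
  set (psi := fun x => y x * exp (- Phi x) - m * I x).
  set (dpsi := fun x => (h x * exp (- Phi x) + y x * (- (m + k * w x) * exp (- Phi x))) - m * w x).
  assert (Dpsi : forall x, is_derive psi x (dpsi x)).
  { intros x. unfold psi, dpsi.
    apply (is_derive_minus (K := R_AbsRing) (V := R_NormedModule)).
    - apply (is_derive_mult y (fun x => exp (- Phi x)) x (h x)); [apply Dy| |intros; apply Rmult_comm].
      apply (is_derive_comp exp (fun x => - Phi x) x); [apply is_derive_exp|].
      apply (is_derive_opp (K := R_AbsRing) (V := R_NormedModule)), DPhi.
    - apply is_derive_scal, DI. }
  assert (HI : forall x, c <= x <= d -> 0 <= I x).
  { intros x Hx. unfold I. apply RInt_ge_0; [lra|now apply ex_RInt_cont|].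
    intros z Hz. apply H; lra. }
  assert (HPhi : forall x, c <= x <= d -> 0 <= Phi x).
  { intros x Hx. unfold Phi. generalize (HI x Hx). intros.
    assert (0 <= k * I x) by now apply Rmult_le_pos.
    assert (0 <= m * (x - c)) by (apply Rmult_le_pos; lra). lra. }
  assert (Hpsi : psi d - psi c <= 0 * (d - c)).
  { apply increase_le_of_derive_le with (df := dpsi); auto.
    - intros x _. apply (is_derive_continuous_R _ _ _ (Dpsi x)).
    - intros x Hx. destruct (H x Hx) as [H1 [H2 H3]]. unfold dpsi.
      assert (P := exp_pos (- Phi x)).
      assert (E1 : exp (- Phi x) <= 1).
      { rewrite <- exp_0. apply exp_le. generalize (HPhi x Hx); lra. }
      assert (h x * exp (- Phi x) <= (m * (y x + w x) + k * w x * y x) * exp (- Phi x))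
        by (apply Rmult_le_compat_r; lra).
      assert (m * w x * exp (- Phi x) <= m * w x * 1).
      { apply Rmult_le_compat_l; [now apply Rmult_le_pos|exact E1]. }
      lra. }
  assert (Hc : psi c = y c).
  { unfold psi, Phi, I. rewrite RInt_point. unfold zero; simpl.
    replace (- (m * (c - c) + k * 0)) with 0 by ring. rewrite exp_0; ring. }
  assert (HE : exp (- Phi d) * exp (Phi d) = 1).
  { rewrite <- exp_plus. replace (- Phi d + Phi d) with 0 by ring. apply exp_0. }
  assert (H1 : y d = (psi d + m * I d) * exp (Phi d)).
  { unfold psi. replace (y d * exp (- Phi d) - m * I d + m * I d) with (y d * exp (- Phi d)) by ring.
    rewrite Rmult_assoc, HE; ring. }
  rewrite H1, Rmult_comm.
  destruct (H c ltac:(lra)) as [yc _].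
  assert (HId := HI d ltac:(lra)). fold (I d) in HC.
  assert (HmI : 0 <= m * I d) by now apply Rmult_le_pos.
  assert (HmC : m * I d <= m * C0) by now apply Rmult_le_compat_l.
  assert (HP2 : exp (Phi d) <= exp (m * (d - c) + k * C0)).
  { assert (Phi d <= m * (d - c) + k * C0).
    { unfold Phi. assert (k * I d <= k * C0) by now apply Rmult_le_compat_l. lra. }
    now apply exp_le. }
  apply Rle_trans with (exp (Phi d) * (y c + m * C0)).
  - apply Rmult_le_compat_l; [left; apply exp_pos|lra].
  - apply Rmult_le_compat_r; lra.
Qed.

Lemma is_derive_back_wave vi g a b : cont2 g ->
  is_derive (fun b => back_wave vi g a b) b (g a b).
Proof.
  intros Hg. apply is_derive_add_const.
  apply (is_derive_CInt (fun b' => g a b')). intros; cont.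
Qed.

Lemma is_derive_fwd_wave s mu nu vi f g a b : cont2 f ->
  is_derive (fun a => fwd_wave s mu nu vi f g a b) a (f a b).
Proof.
  intros Hf. apply is_derive_add_const.
  apply (is_derive_CInt (fun a' => f a' b)). intros; cont.
Qed.

Lemma is_derive_normsq (p : R -> C) (f : C) x :
  is_derive p x f -> is_derive (fun y => normsq (p y)) x (charge_rate (p x) f).
Proof.
  intros H. apply is_derive_C_iff in H. destruct H as [H1 H2].
  unfold normsq, charge_rate.
  evar_last.
  - apply (is_derive_plus (K := R_AbsRing) (V := R_NormedModule)).
    + apply (is_derive_mult (fun y => Re (p y)) (fun y => Re (p y)));
        [exact H1|exact H1|intros; apply Rmult_comm].
    + apply (is_derive_mult (fun y => Im (p y)) (fun y => Im (p y)));
        [exact H2|exact H2|intros; apply Rmult_comm].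
  - unfold plus, mult; simpl. ring.
Qed.

Lemma normsq_mult x y : normsq (x * y)%C = normsq x * normsq y.
Proof. destruct x, y. unfold normsq, Re, Im; simpl. ring. Qed.

Lemma fwd_wave_entry s mu nu vi f g b :
  fwd_wave s mu nu vi f g (s b) b = (mu b + nu b * back_wave vi g (s (bpos b)) (bpos b))%C.
Proof. unfold fwd_wave. rewrite CInt_point. ring. Qed.

Lemma back_wave_entry vi g a : back_wave vi g a (- a) = vi a.
Proof. unfold back_wave. rewrite CInt_point. ring. Qed.

Lemma bpos_of_nonneg b : 0 <= b -> bpos b = b.
Proof. intros; unfold bpos; now rewrite Rmax_left. Qed.

Section Bounds.

Context (s sg dsg : R -> R) (mu nu vi : R -> C) (m al be r N S La : R) (f g : R -> R -> C).
Hypothesis Hs : entry_curve s.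
Hypothesis Hsg : forall b, 0 <= b -> sg b = s b.
Hypothesis Dsg : forall b, is_derive sg b (dsg b).
Hypothesis Hm : 0 <= m.
Hypothesis Hr : 0 < r.
Hypothesis Cmu : forall b, continuous mu b.
Hypothesis Cnu : forall b, continuous nu b.
Hypothesis Cvi : forall b, continuous vi b.
Hypothesis Hmu : forall b, 0 <= b -> mu b = 0.
Hypothesis Hinit : forall b, - N <= b <= 0 ->
  normsq (mu b + nu b * vi 0)%C <= S /\ normsq (vi (- b)) <= S.
Hypothesis HLa : forall b, 0 <= b <= N -> normsq (nu b) <= La.
(** The boundary does not produce charge. *)
Hypothesis Hdiss : forall a b, reg s N a b -> 0 <= b -> normsq (nu b) <= dsg b.
Hypothesis Hmild : mild_solution s mu nu vi
  (fun _ _ u v => cut_src m al be r u v) (fun _ _ u v => cut_src m al be r v u) N f g.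

Let U := fwd_wave s mu nu vi f g.
Let V := back_wave vi g.

Lemma truncated_U_cont : cont2 U.
Proof. destruct Hmild. now apply cont2_fwd_wave. Qed.

Lemma truncated_V_cont : cont2 V.
Proof. destruct Hmild. now apply cont2_back_wave. Qed.

Lemma U_boundary b : 0 <= b -> U (s b) b = (nu b * V (s b) b)%C.
Proof.
  intros Hb. unfold U. rewrite fwd_wave_entry, Hmu, bpos_of_nonneg by exact Hb. unfold V. ring.
Qed.

Lemma U_initial b : b <= 0 -> U (- b) b = (mu b + nu b * vi 0)%C.
Proof.
  intros Hb. rewrite <- (entry_initial s Hs b Hb) at 1. unfold U. rewrite fwd_wave_entry.
  unfold bpos. rewrite Rmax_right by lra. rewrite (entry_0 s Hs).
  rewrite <- Ropp_0 at 2. now rewrite back_wave_entry.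
Qed.

Lemma truncated_sources a b : reg s N a b -> exists k, 0 <= k <= 1 /\
  f a b = (Ci * (RtoC m * V a b - RtoC k * N2 al be (V a b) (U a b)))%C /\
  g a b = (Ci * (RtoC m * U a b - RtoC k * N2 al be (U a b) (V a b)))%C.
Proof.
  intros Hab. destruct Hmild as [_ _ Hf Hg].
  destruct (cut_src_scaled m al be r (U a b) (V a b) Hr) as [k [Hk [H1 H2]]].
  exists k. split; [exact Hk|]. rewrite <- H1, <- H2. split; [now apply Hf|now apply Hg].
Qed.

Lemma init_bound_nonneg : 0 <= N -> 0 <= S.
Proof.
  intros HN. destruct (Hinit 0 ltac:(lra)) as [_ H].
  eapply Rle_trans; [apply normsq_nonneg|exact H].
Qed.

(** Charge balance on the backward triangle with apex [(a0, b0)], first below the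
    corner characteristic [b = 0], where charge enters from the initial line, then
    above it, where the boundary emits none. *)
Lemma charge_bound a0 b0 : reg s N a0 b0 ->
  RInt (fun a => normsq (V a b0)) (s b0) a0 <= 2 * S * N /\
  RInt (fun b => normsq (U a0 b)) (- a0) b0 <= 2 * S * N.
Proof.
  intros Hab.
  assert (CU := truncated_U_cont). assert (CV := truncated_V_cont).
  assert (Cf := mild_f_cont _ _ _ _ _ _ _ _ _ Hmild).
  assert (Cg := mild_g_cont _ _ _ _ _ _ _ _ _ Hmild).
  destruct (reg_box s N a0 b0 Hs Hab) as [Ha0 [Hb0 Ha0']].
  apply Rabs_le_between in Ha0, Hb0.
  assert (HS : 0 <= S) by (apply init_bound_nonneg; lra).
  assert (Ht := reg_time s N a0 b0 Hs Hab).
  set (e := fun a b => normsq (U a b)). set (q := fun a b => normsq (V a b)).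
  set (h1 := fun a b => charge_rate (U a b) (f a b)).
  set (h2 := fun a b => charge_rate (V a b) (g a b)).
  assert (Ce : cont2 e) by (intros p; unfold e, normsq; cont).
  assert (Cq : cont2 q) by (intros p; unfold q, normsq; cont).
  assert (Ch1 : cont2 h1) by (intros p; unfold h1, charge_rate; cont).
  assert (Ch2 : cont2 h2) by (intros p; unfold h2, charge_rate; cont).
  assert (De : forall a b, is_derive (fun a => e a b) a (h1 a b)).
  { intros a b. apply (is_derive_normsq (fun a => U a b)). now apply is_derive_fwd_wave. }
  assert (Dq : forall a b, is_derive (fun b => q a b) b (h2 a b)).
  { intros a b. apply (is_derive_normsq (fun b => V a b)). now apply is_derive_back_wave. }
  assert (Hcancel : forall a b, reg s N a b -> h1 a b + h2 a b = 0).
  { intros a b Hr'. destruct (truncated_sources a b Hr') as [k [_ [Hf Hg]]].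
    unfold h1, h2. rewrite Hf, Hg. apply charge_rate_cancel. }
  assert (pos : forall (p : R -> R) c d, (forall x, continuous p x) -> (forall x, 0 <= p x) ->
     c <= d -> 0 <= RInt p c d).
  { intros p c d Hp Hp' Hcd. apply RInt_ge_0; auto. now apply ex_RInt_cont. }
  (* the initial stage, up to the corner *)
  assert (stage1 : forall b, - a0 <= b <= 0 -> b <= b0 ->
     RInt (fun a => q a b) (s b) a0 + RInt (fun b => e a0 b) (- a0) b <= 2 * S * N).
  { intros b Hb Hb'.
    assert (Hflux := flux_bound e q h1 h2 (fun b => - b) (fun _ => - (1)) a0 (- a0) b (2 * S)
      Ce Cq Ch1 Ch2 De Dq).
    rewrite (entry_initial s Hs) by lra.
    rewrite Ropp_involutive, (RInt_point a0) in Hflux.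
    apply Rle_trans with (0 + 2 * S * (b - - a0)).
    - apply Hflux; [|lra|].
      + intros x. auto_derive; [exact I|ring].
      + intros b' Hb''. split; [lra|]. split.
        * intros a Ha. apply Hcancel. apply (reg_back_a s N a0).
          -- apply (reg_back_b s N a0 b0); auto; lra.
          -- rewrite (entry_initial s Hs); lra.
        * unfold e, q. rewrite U_initial by lra.
          assert (HV : V (- b') b' = vi (- b')).
          { rewrite <- (Ropp_involutive b') at 2. apply back_wave_entry. }
          rewrite HV. destruct (Hinit b'); [lra|]. lra.
    - rewrite Rplus_0_l. apply Rmult_le_compat_l; lra. }
  assert (stage2 : RInt (fun a => q a b0) (s b0) a0 + RInt (fun b => e a0 b) (- a0) b0 <= 2 * S * N).
  { destruct (Rle_dec b0 0) as [Hn|Hn]; [apply stage1; lra|].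
    assert (H1 := stage1 0 ltac:(lra) ltac:(lra)).
    assert (Hflux := flux_bound e q h1 h2 sg dsg a0 0 b0 0 Ce Cq Ch1 Ch2 De Dq Dsg ltac:(lra)).
    rewrite !Hsg in Hflux by lra.
    assert (Hflux' : RInt (fun a => q a b0) (s b0) a0 + RInt (fun b => e a0 b) 0 b0
      <= RInt (fun a => q a 0) (s 0) a0 + 0 * (b0 - 0)).
    { apply Hflux. intros b Hb. rewrite Hsg by lra.
      assert (Hreg : reg s N a0 b) by (apply (reg_back_b s N a0 b0); auto; lra).
      split; [apply Hreg|]. split.
      - intros a Ha. apply Hcancel. now apply (reg_back_a s N a0).
      - unfold e, q. rewrite U_boundary, normsq_mult by lra.
        assert (Hd := Hdiss a0 b Hreg ltac:(lra)).
        assert (normsq (nu b) * normsq (V (s b) b) <= dsg b * normsq (V (s b) b))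
          by (apply Rmult_le_compat_r; [apply normsq_nonneg|exact Hd]).
        lra. }
    assert (Hch : RInt (fun b => e a0 b) (- a0) 0 + RInt (fun b => e a0 b) 0 b0
       = RInt (fun b => e a0 b) (- a0) b0).
    { apply (RInt_Chasles (V := R_CompleteNormedModule));
      apply ex_RInt_cont; intros; cont. }
    lra. }
  assert (0 <= RInt (fun a => q a b0) (s b0) a0).
  { apply pos; [intros; cont|intros; apply normsq_nonneg|apply Hab]. }
  assert (0 <= RInt (fun b => e a0 b) (- a0) b0).
  { apply pos; [intros; cont|intros; apply normsq_nonneg|lra]. }
  fold e q. unfold e, q in *. lra.
Qed.

(** The bounds involve the data only, not the truncation radius [r].  Here
    [2 * S * N] bounds the charge and [2 * N] the length of a characteristic. *)
Definition back_bound : R := exp (m * (2 * N) + 4 * Rabs be * (2 * S * N)) * (S + m * (2 * S * N)).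
Definition fwd_bound : R :=
  exp (m * (2 * N) + 4 * Rabs be * (2 * S * N)) * (S + La * back_bound + m * (2 * S * N)).

Lemma back_wave_bound a b : reg s N a b -> normsq (V a b) <= back_bound.
Proof.
  intros Hab.
  assert (CU := truncated_U_cont). assert (CV := truncated_V_cont).
  assert (Cg := mild_g_cont _ _ _ _ _ _ _ _ _ Hmild).
  destruct (reg_box s N a b Hs Hab) as [Ha [Hb Ha']].
  apply Rabs_le_between in Ha, Hb.
  assert (HS : 0 <= S) by (apply init_bound_nonneg; lra).
  assert (Ht := reg_time s N a b Hs Hab).
  assert (HC : 0 <= 2 * S * N) by (apply Rmult_le_pos; lra).
  assert (HmC : 0 <= m * (2 * S * N)) by now apply Rmult_le_pos.
  eapply Rle_trans.
  - apply (growth_bound (fun b => normsq (V a b)) (fun b => charge_rate (V a b) (g a b))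
      (fun b => normsq (U a b)) m (4 * Rabs be) (2 * S * N) (- a) b); auto.
    + generalize (Rabs_pos be); lra.
    + lra.
    + intros x; unfold normsq; cont.
    + intros x. apply (is_derive_normsq (fun b => V a b)). now apply is_derive_back_wave.
    + intros x Hx. split; [apply normsq_nonneg|]. split; [apply normsq_nonneg|].
      destruct (truncated_sources a x) as [k [Hk [_ ->]]].
      { apply (reg_back_b s N a b); auto. }
      now apply charge_rate_le.
    + now apply charge_bound.
  - unfold back_bound. apply Rmult_le_compat.
    + left; apply exp_pos.
    + assert (H := normsq_nonneg (V a (- a))). lra.
    + apply exp_le. apply Rplus_le_compat_r. apply Rmult_le_compat_l; lra.
    + unfold V. rewrite back_wave_entry.
      destruct (Hinit (- a)) as [_ H]; [lra|]. rewrite Ropp_involutive in H. lra.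
Qed.

Lemma fwd_wave_bound a b : reg s N a b -> normsq (U a b) <= fwd_bound.
Proof.
  intros Hab.
  assert (CU := truncated_U_cont). assert (CV := truncated_V_cont).
  assert (Cf := mild_f_cont _ _ _ _ _ _ _ _ _ Hmild).
  destruct (reg_box s N a b Hs Hab) as [Ha [Hb Ha']].
  apply Rabs_le_between in Ha, Hb.
  assert (HS : 0 <= S) by (apply init_bound_nonneg; lra).
  assert (Ht := reg_time s N a b Hs Hab).
  assert (HC : 0 <= 2 * S * N) by (apply Rmult_le_pos; lra).
  assert (HmC : 0 <= m * (2 * S * N)) by now apply Rmult_le_pos.
  assert (HBB : 0 <= back_bound).
  { unfold back_bound. apply Rmult_le_pos; [left; apply exp_pos|lra]. }
  assert (HLa0 : 0 <= La).
  { eapply Rle_trans; [apply (normsq_nonneg (nu 0))|]. apply HLa; lra. }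
  assert (HLB : 0 <= La * back_bound) by now apply Rmult_le_pos.
  assert (Hge := entry_ge s b Hs).
  eapply Rle_trans.
  - apply (growth_bound (fun a => normsq (U a b)) (fun a => charge_rate (U a b) (f a b))
      (fun a => normsq (V a b)) m (4 * Rabs be) (2 * S * N) (s b) a); auto.
    + generalize (Rabs_pos be); lra.
    + apply Hab.
    + intros x; unfold normsq; cont.
    + intros x. apply (is_derive_normsq (fun a => U a b)). now apply is_derive_fwd_wave.
    + intros x Hx. split; [apply normsq_nonneg|]. split; [apply normsq_nonneg|].
      destruct (truncated_sources x b) as [k [Hk [ -> _ ]]].
      { now apply (reg_back_a s N a). }
      now apply charge_rate_le.
    + now apply charge_bound.
  - unfold fwd_bound. apply Rmult_le_compat.
    + left; apply exp_pos.
    + assert (H := normsq_nonneg (U (s b) b)). lra.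
    + apply exp_le. apply Rplus_le_compat_r. apply Rmult_le_compat_l; lra.
    + apply Rplus_le_compat_r. destruct (Rle_dec b 0) as [Hn|Hn].
      * rewrite (entry_initial s Hs b Hn), U_initial by exact Hn.
        destruct (Hinit b) as [H _]; [lra|]. lra.
      * rewrite U_boundary, normsq_mult by lra.
        assert (H := back_wave_bound (s b) b). 
        assert (H' : normsq (V (s b) b) <= back_bound).
        { apply H. apply (reg_back_a s N a); auto. destruct Hab; lra. }
        assert (normsq (nu b) * normsq (V (s b) b) <= La * back_bound).
        { apply Rmult_le_compat; auto using normsq_nonneg. apply HLa; lra. }
        lra.
Qed.

End Bounds.

(** * Differentiability across characteristics *)

Lemma CInt_near (psi : R -> C) (w : C) (e c d : R) :
  c <= d -> (forall x, continuous psi x) ->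
  (forall x, c <= x <= d -> Cmod (psi x - w)%C <= e) ->
  Cmod (CInt psi c d - RtoC (d - c) * w)%C <= e * (d - c).
Proof.
  intros Hcd Hp H. rewrite <- CInt_const, <- CInt_minus by (try assumption; intros; cont).
  eapply Rle_trans; [apply Cmod_CInt_le_const with (M := e)|].
  - intros; cont.
  - intros x Hx. rewrite Rmin_left, Rmax_right in Hx by lra. now apply H.
  - rewrite Rabs_pos_eq by lra. lra.
Qed.

Lemma CInt_of_derive (phi dphi : R -> C) (c d : R) :
  (forall x, is_derive phi x (dphi x)) -> (forall x, continuous dphi x) ->
  CInt dphi c d = (phi d - phi c)%C.
Proof.
  intros Hd Hc.
  apply (is_RInt_unique (V := C_R_CompleteNormedModule)).
  apply (is_RInt_derive (V := C_R_CompleteNormedModule)); intros; [apply Hd|apply Hc].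
Qed.

Lemma C1_uniform (phi dphi : R -> C) (M e : R) :
  (forall x, is_derive phi x (dphi x)) -> (forall x, continuous dphi x) -> 0 < e ->
  exists d, 0 < d /\ forall x y, Rabs x <= M -> Rabs y <= M -> x <= y -> y - x < d ->
    Cmod (phi y - phi x - RtoC (y - x) * dphi x)%C <= e * (y - x).
Proof.
  intros Hd Hc He.
  destruct (box_uniform_continuity (fun a _ => dphi a) M e) as [d [Hd0 H]]; auto.
  { intros p; cont. }
  exists d; split; [exact Hd0|]. intros x y Hx Hy Hxy Hyd.
  rewrite <- (CInt_of_derive phi dphi x y Hd Hc).
  apply CInt_near; auto. intros z Hz. left.
  assert (HM : 0 <= M) by (generalize (Rabs_pos x); lra).
  apply (H x 0 z 0); auto; try (rewrite Rabs_R0; lra).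
  - apply Rabs_le_between in Hx, Hy. apply Rabs_le_between. lra.
  - rewrite Rabs_pos_eq; lra.
  - unfold Rminus; rewrite Rplus_opp_r, Rabs_R0; lra.
Qed.

(** First-order expansion of [src] when the increment [q' - q] is already close to
    [h * dq], and that of [p] is only known to be small: the error is controlled by
    the remainder of [p], as a Gronwall argument needs. *)
Definition taylor_bound (m al be M K : R) : Prop :=
  forall e h p q p' q' dp dq,
  0 < e <= 1 -> 0 <= h ->
  Cmod p <= M -> Cmod q <= M -> Cmod p' <= M -> Cmod q' <= M -> Cmod dp <= M -> Cmod dq <= M ->
  Cmod (p' - p)%C <= e -> Cmod (q' - q)%C <= e -> Cmod (q' - q - RtoC h * dq)%C <= e * h ->
  Cmod (src m al be p' q' - src m al be p q - RtoC h * dsrc m al be p q dp dq)%C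
   <= K * (Cmod (p' - p - RtoC h * dp)%C + e * h).

Lemma src_taylor m al be M : exists K, 0 <= K /\ taylor_bound m al be M K.
Proof.
  set (c := tri_bound al be). assert (Hc : 0 <= c) by apply tri_bound_nonneg.
  set (M0 := Rabs M). assert (HM0 : 0 <= M0) by apply Rabs_pos.
  set (M' := 2 * M0 + 2).
  set (k1 := 3 * c * (M' * M')). set (k2 := 4 * c * M').
  assert (Hk1 : 0 <= k1) by (unfold k1; apply Rmult_le_pos; [lra|nra]).
  assert (Hk2 : 0 <= k2) by (unfold k2; apply Rmult_le_pos; [lra|unfold M'; lra]).
  exists (Rabs m + k1 + 2 * k2 * (2 + 2 * M0)).
  split.
  { generalize (Rabs_pos m). assert (0 <= k2 * (2 + 2 * M0)) by (apply Rmult_le_pos; lra). lra. }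
  intros e h p q p' q' dp dq He Hh Bp Bq Bp' Bq' Bdp Bdq Sp Sq Rq.
  assert (HMM : M <= M0) by apply Rle_abs.
  set (dx := (q' - q)%C) in *. set (dy := (p' - p)%C) in *.
  set (rp := (dy - RtoC h * dp)%C) in *. set (rq := (dx - RtoC h * dq)%C) in *.
  assert (T := N2_taylor al be M' q p dx dy).
  replace (q + dx)%C with q' in T by (unfold dx; ring).
  replace (p + dy)%C with p' in T by (unfold dy; ring).
  specialize (T ltac:(unfold M'; lra) ltac:(unfold M'; lra)).
  assert (D := dN2_le al be M' q p rq rp ltac:(unfold M'; lra)).
  assert (Es : (dN2 al be q p dx dy - RtoC h * dN2 al be q p dq dp = dN2 al be q p rq rp)%C).
  { unfold rq, rp. rewrite <- dN2_sub. f_equal. f_equal.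
    unfold dN2, tri; simpl.
    assert (Hcj : forall z, Cconj (RtoC h * z)%C = (RtoC h * Cconj z)%C).
    { intros [z1 z2]; unfold Cconj, RtoC, Cmult; simpl; f_equal; ring. }
    rewrite !Hcj. ring. }
  unfold src, dsrc.
  replace (Ci * (RtoC m * q' - N2 al be q' p') - Ci * (RtoC m * q - N2 al be q p)
      - RtoC h * (Ci * (RtoC m * dq - dN2 al be q p dq dp)))%C with
    (Ci * (RtoC m * rq + - (N2 al be q' p' - N2 al be q p - dN2 al be q p dx dy)
       + - dN2 al be q p rq rp))%C.
  2:{ rewrite <- Es. unfold rq, dx. ring. }
  rewrite Cmod_mult, Cmod_Ci, Rmult_1_l.
  eapply Rle_trans; [apply Cmod_triangle|]. rewrite Cmod_opp.
  assert (Tr := Cmod_triangle (RtoC m * rq)%C (- (N2 al be q' p' - N2 al be q p - dN2 al be q p dx dy))%C).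
  rewrite Cmod_opp, Cmod_mult, Cmod_R in Tr.
  fold c in T, D. fold k1 in D. fold k2 in T.
  assert (Gp : Cmod dy <= Cmod rp + h * M0).
  { replace dy with (rp + RtoC h * dp)%C by (unfold rp; ring).
    eapply Rle_trans; [apply Cmod_triangle|]. rewrite Cmod_mult, Cmod_R, Rabs_pos_eq by lra.
    apply Rplus_le_compat_l, Rmult_le_compat_l; lra. }
  assert (Gq : Cmod dx <= Cmod rq + h * M0).
  { replace dx with (rq + RtoC h * dq)%C by (unfold rq; ring).
    eapply Rle_trans; [apply Cmod_triangle|]. rewrite Cmod_mult, Cmod_R, Rabs_pos_eq by lra.
    apply Rplus_le_compat_l, Rmult_le_compat_l; lra. }
  generalize (Cmod_ge_0 dx) (Cmod_ge_0 dy) (Cmod_ge_0 rp) (Cmod_ge_0 rq); intros P1 P2 P3 P4.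
  set (X := Cmod dx) in *. set (Y := Cmod dy) in *. set (A := Cmod rp) in *. set (B := Cmod rq) in *.
  (* one factor of the square is small, the other is at most the remainder plus O(h) *)
  assert (Sq2 : (X + Y) * (X + Y) <= 2 * (2 + 2 * M0) * (A + e * h)).
  { apply Rle_trans with ((2 * e) * (A + e * h + 2 * h * M0)).
    - apply Rmult_le_compat; lra.
    - assert (0 <= e * h) by (apply Rmult_le_pos; lra).
      assert (0 <= M0 * (e * h)) by (apply Rmult_le_pos; lra).
      assert (0 <= M0 * A) by (apply Rmult_le_pos; lra).
      assert (e * A <= A) by nra. assert (e * (e * h) <= e * h) by nra. nra. }
  assert (F1 : k2 * ((X + Y) * (X + Y)) <= k2 * (2 * (2 + 2 * M0) * (A + e * h)))
    by (apply Rmult_le_compat_l; lra).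
  assert (F2 : Rabs m * B <= Rabs m * (A + e * h))
    by (apply Rmult_le_compat_l; [apply Rabs_pos|lra]).
  assert (F3 : k1 * (B + A) <= k1 * (A + e * h)) by (apply Rmult_le_compat_l; lra).
  lra.
Qed.

(** First-order perturbation of the transport equation [p_x = src p q]: when [q]
    and the initial value of [p] move by [h] times a tangent up to [O(e h)], the
    remainder of [p] satisfies a Gronwall inequality with the same [O(e h)]. *)
Lemma transport_taylor m al be K0 M K len :
  0 <= K0 -> 0 <= K -> 0 <= len ->
  taylor_bound m al be M K ->
  forall e h c d (p q p' q' dp dq r : R -> C),
  0 < e <= 1 -> 0 <= h -> c <= d -> d - c <= len ->
  (forall x, continuous p x) -> (forall x, continuous p' x) -> (forall x, continuous dp x) ->
  (forall x, continuous r x) ->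
  (forall x, c <= x <= d ->
    (Cmod (p x) <= M /\ Cmod (q x) <= M /\ Cmod (p' x) <= M /\ Cmod (q' x) <= M /\
     Cmod (dp x) <= M /\ Cmod (dq x) <= M) /\
    Cmod (p' x - p x)%C <= e /\ Cmod (q' x - q x)%C <= e /\
    Cmod (q' x - q x - RtoC h * dq x)%C <= e * h /\
    r x = (src m al be (p' x) (q' x) - src m al be (p x) (q x)
             - RtoC h * dsrc m al be (p x) (q x) (dp x) (dq x))%C) ->
  (forall x, c <= x <= d ->
     Cmod (p' x - p x - RtoC h * dp x)%C <= K0 * (e * h) + Cmod (CInt r c x)) ->
  Cmod (p' d - p d - RtoC h * dp d)%C <= (K0 + K * len) * exp (K * len) * (e * h).
Proof.
  intros HK0 HK Hlen HT e h c d p q p' q' dp dq r He Hh Hcd Hdc Cp Cp' Cdp Cr H HI.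
  set (phi := fun x => Cmod (p' x - p x - RtoC h * dp x)%C).
  assert (Cphi : forall x, continuous phi x) by (intros; unfold phi; cont).
  assert (Heh : 0 <= e * h) by (apply Rmult_le_pos; lra).
  assert (HG : forall x, c <= x <= d -> phi x <= (K0 + K * len) * (e * h) + K * RInt phi c x).
  { intros x Hx. unfold phi at 1. eapply Rle_trans; [now apply HI|].
    assert (Hr : Cmod (CInt r c x) <= RInt (fun y => K * (phi y + e * h)) c x).
    { apply Cmod_CInt_le; [lra|exact Cr|intros; cont|].
      intros y Hy. destruct (H y ltac:(lra)) as [[B1 [B2 [B3 [B4 [B5 B6]]]]] [S1 [S2 [S3 ->]]]].
      apply HT; assumption. }
    assert (Hi : RInt (fun y => K * (phi y + e * h)) c x = K * RInt phi c x + K * (x - c) * (e * h)).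
    { apply is_RInt_unique.
      replace (K * RInt phi c x + K * (x - c) * (e * h)) with
        (scal K (plus (RInt phi c x) (scal (x - c) (e * h))))
        by (unfold scal, plus; simpl; unfold mult; simpl; ring).
      apply (is_RInt_scal (V := R_NormedModule)), (is_RInt_plus (V := R_NormedModule)).
      - apply (RInt_correct (V := R_CompleteNormedModule)). now apply ex_RInt_cont.
      - apply (is_RInt_const (V := R_NormedModule)). }
    rewrite Hi in Hr.
    assert (K * (x - c) * (e * h) <= K * len * (e * h)).
    { apply Rmult_le_compat_r; [exact Heh|]. apply Rmult_le_compat_l; lra. }
    lra. }
  assert (Hd := gronwall phi ((K0 + K * len) * (e * h)) K c d HK Cphi HG d ltac:(lra)).
  eapply Rle_trans; [exact Hd|].
  rewrite (Rmult_comm ((K0 + K * len) * exp (K * len))), (Rmult_comm (K0 + K * len)), !Rmult_assoc.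
  apply Rmult_le_compat_l; [lra|]. apply Rmult_le_compat_l; [lra|].
  apply Rmult_le_compat_l; [generalize (Rmult_le_pos K len HK Hlen); lra|].
  apply exp_le, Rmult_le_compat_l; lra.
Qed.

Lemma CInt_comb (f g k : R -> C) (h a b : R) :
  (forall x, continuous f x) -> (forall x, continuous g x) -> (forall x, continuous k x) ->
  CInt (fun x => f x - g x - RtoC h * k x)%C a b
    = (CInt f a b - CInt g a b - RtoC h * CInt k a b)%C.
Proof.
  intros Hf Hg Hk.
  rewrite (CInt_minus (fun x => (f x - g x)%C)), CInt_minus by (intros; cont).
  f_equal. f_equal.
  assert (Hsc : forall z : C, (RtoC h * z)%C = scal (V := C_R_ModuleSpace) h z).
  { intros [z1 z2]. unfold scal; simpl. unfold prod_scal, scal; simpl. unfold mult; simpl.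
    unfold Cmult, RtoC; simpl. f_equal; ring. }
  rewrite (Hsc (CInt k a b)). unfold CInt.
  rewrite <- (RInt_scal (V := C_R_CompleteNormedModule)).
  - apply (RInt_ext (V := C_R_CompleteNormedModule)). intros x _. apply Hsc.
  - apply (ex_RInt_continuous (V := C_R_CompleteNormedModule)). intros z _; apply Hk.
Qed.

Lemma modulus4 (f1 f2 f3 f4 : R -> R -> C) (M e : R) :
  cont2 f1 -> cont2 f2 -> cont2 f3 -> cont2 f4 -> 0 < e ->
  exists d, 0 < d /\ forall a b a' b',
    Rabs a <= M -> Rabs b <= M -> Rabs a' <= M -> Rabs b' <= M ->
    Rabs (a' - a) < d -> Rabs (b' - b) < d ->
    Cmod (f1 a' b' - f1 a b)%C <= e /\ Cmod (f2 a' b' - f2 a b)%C <= e /\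
    Cmod (f3 a' b' - f3 a b)%C <= e /\ Cmod (f4 a' b' - f4 a b)%C <= e.
Proof.
  intros H1 H2 H3 H4 He.
  destruct (box_uniform_continuity f1 M e H1 He) as [d1 [P1 U1]].
  destruct (box_uniform_continuity f2 M e H2 He) as [d2 [P2 U2]].
  destruct (box_uniform_continuity f3 M e H3 He) as [d3 [P3 U3]].
  destruct (box_uniform_continuity f4 M e H4 He) as [d4 [P4 U4]].
  exists (Rmin (Rmin d1 d2) (Rmin d3 d4)).
  generalize (Rmin_l (Rmin d1 d2) (Rmin d3 d4)) (Rmin_r (Rmin d1 d2) (Rmin d3 d4))
    (Rmin_l d1 d2) (Rmin_r d1 d2) (Rmin_l d3 d4) (Rmin_r d3 d4); intros.
  split; [repeat apply Rmin_pos; assumption|].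
  intros a b a' b' A1 A2 A3 A4 A5 A6.
  repeat split; left; [apply U1|apply U2|apply U3|apply U4]; auto; lra.
Qed.

Lemma bound6 (f1 f2 f3 f4 f5 f6 : R -> R -> C) (M : R) :
  cont2 f1 -> cont2 f2 -> cont2 f3 -> cont2 f4 -> cont2 f5 -> cont2 f6 ->
  exists B, 0 <= B /\ forall a b, Rabs a <= M -> Rabs b <= M ->
    (Cmod (f1 a b) <= B /\ Cmod (f2 a b) <= B /\ Cmod (f3 a b) <= B) /\
    (Cmod (f4 a b) <= B /\ Cmod (f5 a b) <= B /\ Cmod (f6 a b) <= B).
Proof.
  intros H1 H2 H3 H4 H5 H6.
  destruct (box_bounded f1 M H1) as [B1 [P1 U1]]. destruct (box_bounded f2 M H2) as [B2 [P2 U2]].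
  destruct (box_bounded f3 M H3) as [B3 [P3 U3]]. destruct (box_bounded f4 M H4) as [B4 [P4 U4]].
  destruct (box_bounded f5 M H5) as [B5 [P5 U5]]. destruct (box_bounded f6 M H6) as [B6 [P6 U6]].
  exists (B1 + B2 + B3 + B4 + B5 + B6). split; [lra|].
  intros a b Ha Hb.
  specialize (U1 a b Ha Hb). specialize (U2 a b Ha Hb). specialize (U3 a b Ha Hb).
  specialize (U4 a b Ha Hb). specialize (U5 a b Ha Hb). specialize (U6 a b Ha Hb).
  repeat split; lra.
Qed.

Lemma Cmod_triangle6 x1 x2 x3 x4 x5 x6 :
  Cmod (x1 + x2 + x3 + x4 + x5 + x6)%C
   <= Cmod x1 + Cmod x2 + Cmod x3 + Cmod x4 + Cmod x5 + Cmod x6.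
Proof.
  generalize (Cmod_triangle x1 x2) (Cmod_triangle (x1 + x2)%C x3)
    (Cmod_triangle (x1 + x2 + x3)%C x4) (Cmod_triangle (x1 + x2 + x3 + x4)%C x5)
    (Cmod_triangle (x1 + x2 + x3 + x4 + x5)%C x6). lra.
Qed.

Lemma Rabs_between u v w M : Rabs u <= M -> Rabs v <= M -> u <= w <= v -> Rabs w <= M.
Proof.
  intros Hu Hv H. apply Rabs_le_between in Hu, Hv. apply Rabs_le_between. lra.
Qed.

Lemma is_derive_RtoC (p : R -> R) x l : is_derive p x l -> is_derive (fun y => RtoC (p y)) x (RtoC l).
Proof.
  intros H. apply is_derive_C_iff. split; [exact H|].
  change (is_derive (fun _ : R => 0) x 0).
  exact (is_derive_const (K := R_AbsRing) (V := R_NormedModule) 0 x).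
Qed.

Lemma Rabs_same x d : 0 < d -> Rabs (x - x) < d.
Proof. intros; unfold Rminus; rewrite Rplus_opp_r, Rabs_R0; lra. Qed.

Lemma bpos_of_nonpos b : b <= 0 -> bpos b = 0.
Proof. intros; unfold bpos; now rewrite Rmax_right. Qed.

(** First variation of a wave [W] in its label [a]: [W] starts from [w0 a] on the
    line [x = - a] and is transported in [x] with source [src W Z], the other wave
    [Z] being already known to be differentiable in [a].  Backward waves have this
    form, and so have forward waves issued from the initial line. *)
Lemma initial_taylor m al be N (D : R -> R -> Prop) (W Z G F W' G' : R -> R -> C) (w0 dw0 : R -> C) :
  cont2 W -> cont2 Z -> cont2 G -> cont2 F -> cont2 W' -> cont2 G' ->
  (forall x, is_derive w0 x (dw0 x)) -> (forall x, continuous dw0 x) ->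
  (forall a x, is_derive (fun a => Z a x) a (F a x)) ->
  (forall a x, D a x -> Rabs a <= N /\ Rabs x <= N /\ - a <= x /\ forall y, - a <= y <= x -> D a y) ->
  (forall a x, D a x ->
     G a x = src m al be (W a x) (Z a x) /\
     G' a x = dsrc m al be (W a x) (Z a x) (W' a x) (F a x) /\
     W a x = (w0 a + CInt (G a) (- a) x)%C /\
     W' a x = (dw0 a + G a (- a)%R + CInt (G' a) (- a) x)%C) ->
  exists A, 0 <= A /\ forall e, 0 < e <= 1 -> exists d, 0 < d /\
    forall a1 a2 x, D a1 x -> D a2 x -> a1 <= a2 -> a2 - a1 < d ->
    Cmod (W a2 x - W a1 x - RtoC (a2 - a1) * W' a1 x)%C <= A * (e * (a2 - a1)).
Proof.
  intros CW CZ CG CF CW' CG' Dw0 Cdw0 DZ Hdom Heq.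
  destruct (bound6 W Z G F W' W' N CW CZ CG CF CW' CW') as [M [HM HB]].
  destruct (src_taylor m al be M) as [K [HK HT]].
  set (N' := Rabs N).
  exists ((2 + K * (2 * N')) * exp (K * (2 * N'))).
  assert (HN' : 0 <= N') by apply Rabs_pos.
  assert (HKN : 0 <= K * (2 * N')) by (apply Rmult_le_pos; lra).
  split; [apply Rmult_le_pos; [lra|left; apply exp_pos]|].
  intros e He.
  destruct (modulus4 W Z F G N e CW CZ CF CG ltac:(lra)) as [d1 [Hd1 Hmod]].
  destruct (C1_uniform w0 dw0 N e Dw0 Cdw0 ltac:(lra)) as [d2 [Hd2 Hw0]].
  exists (Rmin d1 d2). split; [now apply Rmin_pos|].
  intros a1 a2 b R1 R2 H12 Hd.
  assert (Hda := Rmin_l d1 d2). assert (Hdb := Rmin_r d1 d2).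
  destruct (Hdom a1 b R1) as [B1 [Bb [Ht B1']]]. destruct (Hdom a2 b R2) as [B2 [_ [_ B2']]].
  set (h := a2 - a1). assert (Hh : 0 <= h) by (unfold h; lra).
  assert (HN : N <= N') by apply Rle_abs.
  assert (Hreg : forall x, - a1 <= x <= b -> D a1 x /\ D a2 x).
  { intros x Hx. split; [apply B1'|apply B2']; lra. }
  apply (transport_taylor m al be 2 M K (2 * N')) with
    (c := - a1) (q := Z a1) (q' := Z a2) (dq := F a1) (p := W a1) (p' := W a2) (dp := W' a1)
    (r := fun x => (G a2 x - G a1 x - RtoC h * G' a1 x)%C); auto; try lra.
  - apply Rabs_le_between in B1, Bb. lra.
  - intros; cont.
  - intros; cont.
  - intros; cont.
  - intros; cont.
  - intros x Hx. destruct (Hreg x Hx) as [Rx1 Rx2].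
    destruct (Hdom a1 x Rx1) as [_ [Bx _]].
    destruct (HB a1 x B1 Bx) as [[b1 [b2 b3]] [b4 [b5 b6]]].
    destruct (HB a2 x B2 Bx) as [[c1 [c2 c3]] [c4 [c5 c6]]].
    destruct (Hmod a1 x a2 x) as [e1 [e2 [e3 e4]]]; auto.
    { rewrite Rabs_pos_eq; lra. }
    { now apply Rabs_same. }
    split; [repeat split; assumption|]. split; [exact e1|]. split; [exact e2|]. split.
    + replace (Z a2 x - Z a1 x)%C with (CInt (fun a => F a x) a1 a2).
      2:{ apply (CInt_of_derive (fun a => Z a x)); [|intros; cont]. intros a. apply DZ. }
      apply CInt_near; auto.
      * intros; cont.
      * intros y Hy. refine (proj1 (proj2 (proj2 (Hmod a1 x y x _ _ _ _ _ _)))); auto.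
        -- now apply (Rabs_between a1 a2).
        -- rewrite Rabs_pos_eq; lra.
        -- now apply Rabs_same.
    + destruct (Heq a1 x Rx1) as [-> [-> _]]. now destruct (Heq a2 x Rx2) as [-> _].
  - intros x Hx. destruct (Hreg x Hx) as [Rx1 Rx2].
    rewrite (CInt_comb (G a2) (G a1) (G' a1)) by (intros; cont).
    destruct (Heq a1 x Rx1) as [_ [_ [Wx1 Wx']]]. destruct (Heq a2 x Rx2) as [_ [_ [Wx2 _]]].
    rewrite <- (CInt_Chasles (G a2) (- a2) (- a1) x) in Wx2 by (intros; cont).
    replace (W a2 x - W a1 x - RtoC h * W' a1 x)%C with
      ((w0 a2 - w0 a1 - RtoC h * dw0 a1) + (CInt (G a2) (- a2) (- a1) - RtoC h * G a1 (- a1)%R)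
        + (CInt (G a2) (- a1) x - CInt (G a1) (- a1) x - RtoC h * CInt (G' a1) (- a1) x))%C.
    2:{ rewrite Wx2, Wx1, Wx'. ring. }
    eapply Rle_trans; [apply Cmod_triangle|]. apply Rplus_le_compat_r.
    eapply Rle_trans; [apply Cmod_triangle|].
    assert (I1 : Cmod (w0 a2 - w0 a1 - RtoC h * dw0 a1)%C <= e * h) by (apply Hw0; auto; lra).
    assert (I2 : Cmod (CInt (G a2) (- a2) (- a1) - RtoC h * G a1 (- a1)%R)%C <= e * h).
    { replace h with (- a1 - - a2) by (unfold h; ring).
      apply CInt_near; [lra|intros; cont|].
      intros y Hy. refine (proj2 (proj2 (proj2 (Hmod a1 (- a1) a2 y _ _ _ _ _ _)))); auto.
      - now rewrite Rabs_Ropp.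
      - apply (Rabs_between (- a2) (- a1)); auto; now rewrite Rabs_Ropp.
      - rewrite Rabs_pos_eq; lra.
      - apply Rabs_lt_between; lra. }
    lra.
Qed.

(** The Taylor estimates below compare two characteristics with the derivative on
    the first of them; continuity of the derivative moves it to the point [x] when
    that is the second. *)
Lemma is_derive_of_left_anchored (phi dphi : R -> C) (x : R) :
  continuous dphi x ->
  (forall e, 0 < e -> exists d, 0 < d /\ forall y, Rabs (y - x) < d ->
     (y <= x -> Cmod (phi x - phi y - RtoC (x - y) * dphi y)%C <= e * (x - y)) /\
     (x <= y -> Cmod (phi y - phi x - RtoC (y - x) * dphi x)%C <= e * (y - x))) ->
  is_derive phi x (dphi x).
Proof.
  intros Hc H. split; [apply is_linear_scal_C|].
  intros x' Hx'.
  apply (@is_filter_lim_locally_unique R_AbsRing (AbsRing_NormedModule R_AbsRing)) in Hx'. subst x'.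
  intros e. assert (He : 0 < e / 2) by (generalize (cond_pos e); lra).
  destruct (H (e / 2) He) as [d [Hd Hy]].
  destruct (proj1 (continuous_C_eps dphi x) Hc (e / 2) He) as [d' Hd'].
  assert (Hmin : 0 < Rmin d d') by (apply Rmin_pos; [exact Hd|apply cond_pos]).
  exists (mkposreal _ Hmin). intros y Hball.
  assert (Hyd : Rabs (y - x) < Rmin d d') by exact Hball.
  generalize (Rmin_l d d') (Rmin_r d d'); intros m1 m2.
  rewrite norm_Cmod.
  change (norm (minus y x)) with (Rabs (y - x)).
  assert (Hs : scal (V := C_R_ModuleSpace) (y - x) (dphi x) = (RtoC (y - x) * dphi x)%C).
  { destruct (dphi x) as [z1 z2]. unfold scal; simpl. unfold prod_scal, scal; simpl.
    unfold mult; simpl. unfold Cmult, RtoC; simpl. f_equal; ring. }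
  change (Cmod (phi y - phi x - scal (V := C_R_ModuleSpace) (y - x)%R (dphi x))%C <= e * Rabs (y - x)).
  rewrite Hs.
  destruct (Hy y ltac:(lra)) as [H1 H2].
  destruct (Rle_dec x y) as [Hxy|Hxy].
  - eapply Rle_trans; [now apply H2|]. rewrite Rabs_pos_eq by lra.
    apply Rmult_le_compat_r; generalize (cond_pos e); lra.
  - assert (Hyx : y <= x) by lra. specialize (H1 Hyx).
    assert (Hdy : Cmod (dphi y - dphi x)%C < e / 2) by (apply Hd'; unfold ball; simpl; unfold AbsRing_ball; simpl; unfold abs, minus, plus, opp; simpl; unfold Rminus in *; lra).
    replace (phi y - phi x - RtoC (y - x) * dphi x)%C with
      (- (phi x - phi y - RtoC (x - y) * dphi y) + - (RtoC (x - y) * (dphi y - dphi x)))%C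
      by (rewrite !RtoC_minus; ring).
    eapply Rle_trans; [apply Cmod_triangle|]. rewrite !Cmod_opp, Cmod_mult, Cmod_R.
    rewrite (Rabs_pos_eq (x - y)), (Rabs_left1 (y - x)) by lra.
    assert ((x - y) * Cmod (dphi y - dphi x)%C <= (x - y) * (e / 2))
      by (apply Rmult_le_compat_l; lra).
    simpl. lra.
Qed.

Section Regularity.

Context (s sg dsg : R -> R) (k dk vi dvi nub dnub : R -> C) (m al be N : R).
Hypothesis Hs : entry_curve s.
Hypothesis Hsg : forall b, 0 <= b -> sg b = s b.
Hypothesis Dsg : forall b, is_derive sg b (dsg b).
Hypothesis Cdsg : forall b, continuous dsg b.
Hypothesis Dk : forall b, is_derive k b (dk b).
Hypothesis Cdk : forall b, continuous dk b.
Hypothesis Dvi : forall b, is_derive vi b (dvi b).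
Hypothesis Cdvi : forall b, continuous dvi b.
Hypothesis Dnub : forall b, is_derive nub b (dnub b).
Hypothesis Cdnub : forall b, continuous dnub b.
Hypothesis compat0 : k 0 = (nub 0 * vi 0)%C.

(** With these coefficients [fwd_wave] enters with [k] on the initial line and with
    [nub] times the backward wave on the boundary; at the corner the two agree by
    the first compatibility condition. *)
Definition entry_mu (k : R -> C) (b : R) : C := (k (Rmin b 0) - k 0)%C.
Definition entry_nu (nub : R -> C) (b : R) : C := nub (bpos b).

Context (f g : R -> R -> C).
Hypothesis Cf : cont2 f.
Hypothesis Cg : cont2 g.
Let U := fwd_wave s (entry_mu k) (entry_nu nub) vi f g.
Let V := back_wave vi g.

(** Entry data of the derivatives [P] of [U] in [b] and [Q] of [V] in [a],
    obtained by differentiating those of [U] and [V]. *)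
Definition init_Q (a : R) : C := (dvi a + g a (- a)%R)%C.
Definition init_P (b : R) : C := (dk b + f (- b)%R b)%C.
Definition boundary_P (b : R) : C :=
  (dnub b * V (sg b) b + nub b * g (sg b) b - RtoC (dsg b) * f (sg b) b)%C.
Definition mu_P (b : R) : C := (entry_mu init_P b + boundary_P (bpos b))%C.
Definition nu_P (b : R) : C := entry_nu (fun b => (RtoC (dsg b) * nub b)%C) b.

(** The second compatibility condition: both expressions for the derivative of [U]
    across the corner characteristic agree, so that [P] is continuous there. *)
Hypothesis compat1 : init_P 0 = (boundary_P 0 + RtoC (dsg 0) * nub 0 * init_Q 0)%C.
Hypothesis Hf : forall a b, reg s N a b -> f a b = src m al be (U a b) (V a b).
Hypothesis Hg : forall a b, reg s N a b -> g a b = src m al be (V a b) (U a b).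

Lemma continuous_of_derive (p dp : R -> C) : (forall x, is_derive p x (dp x)) -> forall x, continuous p x.
Proof.
  intros H x. apply continuous_C_iff.
  specialize (H x). apply is_derive_C_iff in H. destruct H as [H1 H2].
  split; eapply is_derive_continuous_R; eassumption.
Qed.

Lemma k_cont : forall x, continuous k x.
Proof. now apply continuous_of_derive with dk. Qed.

Lemma vi_cont : forall x, continuous vi x.
Proof. now apply continuous_of_derive with dvi. Qed.

Lemma nub_cont : forall x, continuous nub x.
Proof. now apply continuous_of_derive with dnub. Qed.

Lemma sg_cont : forall x, continuous sg x.
Proof. intros x. apply (is_derive_continuous_R _ _ _ (Dsg x)). Qed.

Lemma entry_mu_cont (p : R -> C) : (forall x, continuous p x) -> forall x, continuous (entry_mu p) x.
Proof.
  intros H x. unfold entry_mu. apply continuous_Cminus; [|cont].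
  apply (continuous_1 p); [exact H|]. cont.
Qed.

Lemma entry_nu_cont (p : R -> C) : (forall x, continuous p x) -> forall x, continuous (entry_nu p) x.
Proof.
  intros H x. unfold entry_nu. apply (continuous_1 p); [exact H|].
  apply continuous_bpos. cont.
Qed.

Lemma U_continuous : cont2 U.
Proof.
  apply cont2_fwd_wave; auto using entry_mu_cont, entry_nu_cont, k_cont, nub_cont, vi_cont.
Qed.

Lemma V_continuous : cont2 V.
Proof. apply cont2_back_wave; auto using vi_cont. Qed.

Lemma init_Q_cont x : continuous init_Q x.
Proof. unfold init_Q. cont. Qed.

Lemma init_P_cont x : continuous init_P x.
Proof. unfold init_P. cont. Qed.

Lemma boundary_P_cont x : continuous boundary_P x.
Proof.
  assert (H1 := sg_cont). assert (H2 := V_continuous). assert (H3 := nub_cont).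
  unfold boundary_P. cont.
Qed.

Lemma mu_P_cont x : continuous mu_P x.
Proof.
  unfold mu_P. apply continuous_Cplus; [apply entry_mu_cont, init_P_cont|].
  apply (continuous_1 boundary_P); [apply boundary_P_cont|]. apply continuous_bpos; cont.
Qed.

Lemma nu_P_cont x : continuous nu_P x.
Proof. assert (H3 := nub_cont). unfold nu_P. apply entry_nu_cont. intros; cont. Qed.

(** The differentiated system is linear, so it has a mild solution. *)
Lemma derivative_system : exists fP gP, cont2 fP /\ cont2 gP /\
  forall a b, reg s N a b ->
    fP a b = dsrc m al be (U a b) (V a b) (fwd_wave s mu_P nu_P init_Q fP gP a b) (g a b) /\
    gP a b = dsrc m al be (V a b) (U a b) (back_wave init_Q gP a b) (f a b).
Proof.
  assert (CU := U_continuous). assert (CV := V_continuous).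
  assert (lin : forall p q : R -> R -> C, cont2 p -> cont2 q -> forall N', exists L, 0 <= L /\
    forall a b, reg s N' a b -> forall dp dp' dq,
      Cmod (dsrc m al be (p a b) (q a b) dp dq - dsrc m al be (p a b) (q a b) dp' dq)%C
       <= L * Cmod (dp - dp')%C).
  { intros p q Cp Cq N'.
    destruct (box_bounded p N' Cp) as [Bp [HBp Hp]]. destruct (box_bounded q N' Cq) as [Bq [HBq Hq]].
    assert (Hc := tri_bound_nonneg al be).
    exists (3 * tri_bound al be * ((Bq + Bp) * (Bq + Bp))). split.
    { apply Rmult_le_pos; [lra|nra]. }
    intros a b Hab dp dp' dq. destruct (reg_box s N' a b Hs Hab) as [Ha [Hb _]].
    unfold dsrc.
    replace (Ci * (RtoC m * dq - dN2 al be (q a b) (p a b) dq dp) -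
       Ci * (RtoC m * dq - dN2 al be (q a b) (p a b) dq dp'))%C with
      (Ci * - (dN2 al be (q a b) (p a b) dq dp - dN2 al be (q a b) (p a b) dq dp'))%C by ring.
    rewrite Cmod_mult, Cmod_Ci, Rmult_1_l, Cmod_opp, dN2_sub.
    eapply Rle_trans; [apply (dN2_le al be (Bq + Bp))|].
    - specialize (Hp a b Ha Hb). specialize (Hq a b Ha Hb). lra.
    - replace (dq - dq)%C with (RtoC 0) by ring. rewrite Cmod_0. lra. }
  assert (csrc : forall p q dp dq : R -> R -> C, cont2 p -> cont2 q -> cont2 dp -> cont2 dq ->
     cont2 (fun a b => dsrc m al be (p a b) (q a b) (dp a b) (dq a b))).
  { intros p q dp dq H1 H2 H3 H4 x. unfold dsrc, dN2, tri; simpl. cont. }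
  destruct (mild_existence s mu_P nu_P init_Q
    (fun a b P _ => dsrc m al be (U a b) (V a b) P (g a b))
    (fun a b _ Q => dsrc m al be (V a b) (U a b) Q (f a b))) as [fP [gP H]].
  - exact Hs.
  - exact mu_P_cont.
  - exact nu_P_cont.
  - exact init_Q_cont.
  - intros u v Cu Cv. now apply csrc.
  - intros u v Cu Cv. now apply csrc.
  - intros N'. destruct (lin U V CU CV N') as [L [HL HL']]. exists L. split; [exact HL|].
    intros a b Hab u v u' v'. eapply Rle_trans; [now apply HL'|].
    apply Rmult_le_compat_l; [exact HL|]. generalize (Cmod_ge_0 (v - v')%C); lra.
  - intros N'. destruct (lin V U CV CU N') as [L [HL HL']]. exists L. split; [exact HL|].
    intros a b Hab u v u' v'. eapply Rle_trans; [now apply HL'|].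
    apply Rmult_le_compat_l; [exact HL|]. generalize (Cmod_ge_0 (u - u')%C); lra.
  - exists fP, gP. destruct (H N) as [C1 C2 H1 H2]. repeat split; auto.
Qed.

Context (fP gP : R -> R -> C).
Hypothesis CfP : cont2 fP.
Hypothesis CgP : cont2 gP.
Let P := fwd_wave s mu_P nu_P init_Q fP gP.
Let Q := back_wave init_Q gP.
Hypothesis HP : forall a b, reg s N a b -> fP a b = dsrc m al be (U a b) (V a b) (P a b) (g a b).
Hypothesis HQ : forall a b, reg s N a b -> gP a b = dsrc m al be (V a b) (U a b) (Q a b) (f a b).

Lemma P_continuous : cont2 P.
Proof. apply cont2_fwd_wave; auto using mu_P_cont, nu_P_cont, init_Q_cont. Qed.

Lemma Q_continuous : cont2 Q.
Proof. apply cont2_back_wave; auto using init_Q_cont. Qed.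

Lemma V_taylor : exists A, 0 <= A /\ forall e, 0 < e <= 1 -> exists d, 0 < d /\
  forall a1 a2 b, reg s N a1 b -> reg s N a2 b -> a1 <= a2 -> a2 - a1 < d ->
  Cmod (V a2 b - V a1 b - RtoC (a2 - a1) * Q a1 b)%C <= A * (e * (a2 - a1)).
Proof.
  refine (initial_taylor m al be N (reg s N) V U g f Q gP vi dvi
    V_continuous U_continuous Cg Cf Q_continuous CgP Dvi Cdvi _ _ _).
  - intros a b. now apply is_derive_fwd_wave.
  - intros a b Hab. destruct (reg_box s N a b Hs Hab) as [Ha [Hb _]].
    assert (Ht := reg_time s N a b Hs Hab).
    split; [exact Ha|]. split; [exact Hb|]. split; [lra|].
    intros y Hy. now apply (reg_back_b s N a b).
  - intros a b Hab. split; [now apply Hg|]. split; [now apply HQ|]. split; reflexivity.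
Qed.

Lemma V_corner : V 0 0 = vi 0.
Proof. unfold V. rewrite <- Ropp_0 at 2. apply back_wave_entry. Qed.

Lemma Q_corner : Q 0 0 = init_Q 0.
Proof. unfold Q. rewrite <- Ropp_0 at 2. apply back_wave_entry. Qed.

Lemma U_entry_initial b : b <= 0 -> U (s b) b = k b.
Proof.
  intros Hb. unfold U. rewrite fwd_wave_entry, bpos_of_nonpos, (entry_0 s Hs) by exact Hb.
  fold V. rewrite V_corner. unfold entry_mu, entry_nu.
  rewrite Rmin_left, bpos_of_nonpos, compat0 by exact Hb. ring.
Qed.

Lemma U_entry_boundary b : 0 <= b -> U (s b) b = (nub b * V (s b) b)%C.
Proof.
  intros Hb. unfold U. rewrite fwd_wave_entry, bpos_of_nonneg by exact Hb.
  fold V. unfold entry_mu, entry_nu. rewrite Rmin_right, bpos_of_nonneg by exact Hb. ring.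
Qed.

Lemma P_entry_initial b : b <= 0 -> P (s b) b = init_P b.
Proof.
  intros Hb. unfold P. rewrite fwd_wave_entry, (bpos_of_nonpos b Hb), (entry_0 s Hs).
  fold Q. rewrite Q_corner. unfold mu_P, nu_P, entry_mu, entry_nu.
  rewrite Rmin_left, (bpos_of_nonpos b Hb), compat1 by exact Hb. ring.
Qed.

Lemma P_entry_boundary b : 0 <= b -> P (s b) b =
  (dnub b * V (s b) b + nub b * (RtoC (dsg b) * Q (s b) b + g (s b) b) - RtoC (dsg b) * f (s b) b)%C.
Proof.
  intros Hb. unfold P. rewrite fwd_wave_entry, (bpos_of_nonneg b Hb).
  fold Q. unfold mu_P, nu_P, entry_mu, entry_nu, boundary_P.
  rewrite Rmin_right, (bpos_of_nonneg b Hb), (Hsg b Hb) by exact Hb. ring.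
Qed.

Lemma fwd_wave_from mu nu w f' g' c a b : cont2 f' ->
  fwd_wave s mu nu w f' g' a b = (fwd_wave s mu nu w f' g' c b + CInt (fun x => f' x b) c a)%C.
Proof.
  intros Hc. unfold fwd_wave.
  rewrite <- (CInt_Chasles (fun x => f' x b) (s b) c a) by (intros; cont). ring.
Qed.

Lemma U_taylor_initial : exists A, 0 <= A /\ forall e, 0 < e <= 1 -> exists d, 0 < d /\
  forall b1 b2 a, (reg s N a b1 /\ b1 <= 0) -> (reg s N a b2 /\ b2 <= 0) -> b1 <= b2 -> b2 - b1 < d ->
  Cmod (U a b2 - U a b1 - RtoC (b2 - b1) * P a b1)%C <= A * (e * (b2 - b1)).
Proof.
  assert (swap : forall w : R -> R -> C, cont2 w -> cont2 (fun b a => w a b)) by (intros w Hw p; cont).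
  refine (initial_taylor m al be N (fun b a => reg s N a b /\ b <= 0) (fun b a => U a b)
    (fun b a => V a b) (fun b a => f a b) (fun b a => g a b) (fun b a => P a b) (fun b a => fP a b) k dk
    (swap U U_continuous) (swap V V_continuous) (swap f Cf) (swap g Cg) (swap P P_continuous) (swap fP CfP) Dk Cdk _ _ _).
  - intros b a. now apply is_derive_back_wave.
  - intros b a [Hab Hb0]. destruct (reg_box s N a b Hs Hab) as [Ha [Hb _]].
    assert (Ht := reg_time s N a b Hs Hab). assert (Sb := entry_initial s Hs b Hb0).
    split; [exact Hb|]. split; [exact Ha|]. split; [lra|].
    intros y Hy. split; [apply (reg_back_a s N a); [exact Hab|lra]|exact Hb0].
  - intros b a [Hab Hb]. assert (Sb := entry_initial s Hs b Hb).
    split; [now apply Hf|]. split; [now apply HP|].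
    rewrite <- U_entry_initial by exact Hb.
    change (dk b + f (- b)%R b)%C with (init_P b).
    rewrite <- P_entry_initial, <- Sb by exact Hb.
    split; now apply fwd_wave_from.
Qed.

(** Along the boundary both ends of the forward characteristics move: their entry
    points [s b1 <= s b2] and the value of [V] there, which is differentiable along
    the boundary by [V_taylor] and the equation of [V]. *)
Lemma U_taylor_boundary : exists A, 0 <= A /\ forall e, 0 < e <= 1 -> exists d, 0 < d /\
  forall a b1 b2, reg s N a b1 -> reg s N a b2 -> b1 <= b2 -> b2 - b1 < d -> 0 <= b1 ->
  Cmod (U a b2 - U a b1 - RtoC (b2 - b1) * P a b1)%C <= A * (e * (b2 - b1)).
Proof.
  assert (CU := U_continuous). assert (CV := V_continuous). assert (CP := P_continuous). assert (CQ := Q_continuous).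
  destruct (bound6 U V f g P Q N CU CV Cf Cg CP CQ) as [M [HM HB]].
  destruct (box_bounded fP N CfP) as [MP [HMP HBP]].
  destruct (interval_bounded nub N nub_cont) as [La [HLa HBn]].
  destruct (interval_bounded (fun b => RtoC (dsg b)) N ltac:(intros; cont)) as [D [HD HBD]].
  destruct (src_taylor m al be M) as [K [HK HT]].
  destruct V_taylor as [AV [HAV HV]].
  set (N' := Rabs N).
  assert (HN' : 0 <= N') by apply Rabs_pos.
  assert (HKN : 0 <= K * (2 * N')) by (apply Rmult_le_pos; lra).
  assert (HAD : 0 <= AV * D) by now apply Rmult_le_pos.
  assert (HDM : 0 <= D * M) by now apply Rmult_le_pos.
  set (K0 := M + La * (1 + AV * D + M) + (D * M + M) + D + M + MP).
  assert (HK0 : 0 <= K0).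
  { assert (0 <= La * (1 + AV * D + M)) by (apply Rmult_le_pos; lra). unfold K0; lra. }
  exists ((K0 + K * (2 * N')) * exp (K * (2 * N'))).
  split; [apply Rmult_le_pos; [lra|left; apply exp_pos]|].
  intros e He.
  destruct (modulus4 U V f g N e CU CV Cf Cg ltac:(lra)) as [d1 [Hd1 Hmod]].
  destruct (C1_uniform nub dnub N e Dnub Cdnub ltac:(lra)) as [d2 [Hd2 Hnub]].
  destruct (C1_uniform (fun b => RtoC (sg b)) (fun b => RtoC (dsg b)) N e
     (fun b => is_derive_RtoC _ _ _ (Dsg b)) ltac:(intros; cont) ltac:(lra)) as [d3 [Hd3 Hsgu]].
  destruct (HV e He) as [d4 [Hd4 HVe]].
  destruct (box_uniform_continuity (fun a _ => nub a) N e ltac:(intros p; assert (Hn := nub_cont); cont)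
     ltac:(lra)) as [d5 [Hd5 Hnubc]].
  set (d6 := Rmin (Rmin d1 d4) e / (D + 1)).
  assert (Hd6 : 0 < d6).
  { apply Rdiv_lt_0_compat; [|lra]. repeat apply Rmin_pos; lra. }
  exists (Rmin (Rmin (Rmin d1 d2) (Rmin d3 d5)) d6).
  split. { repeat apply Rmin_pos; assumption. }
  intros a b1 b2 R1 R2 H12 Hd H10.
  assert (Hda : b2 - b1 < d1 /\ b2 - b1 < d2 /\ b2 - b1 < d3 /\ b2 - b1 < d5 /\ b2 - b1 < d6).
  { generalize (Rmin_l (Rmin (Rmin d1 d2) (Rmin d3 d5)) d6)
     (Rmin_r (Rmin (Rmin d1 d2) (Rmin d3 d5)) d6) (Rmin_l (Rmin d1 d2) (Rmin d3 d5))
     (Rmin_r (Rmin d1 d2) (Rmin d3 d5)) (Rmin_l d1 d2) (Rmin_r d1 d2) (Rmin_l d3 d5) (Rmin_r d3 d5).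
    intros. lra. }
  destruct Hda as [Dl1 [Dl2 [Dl3 [Dl5 Dl6]]]].
  destruct (reg_box s N a b1 Hs R1) as [Ba [B1 A1]].
  destruct (reg_box s N a b2 Hs R2) as [_ [B2 _]].
  set (h := b2 - b1). assert (Hh : 0 <= h) by (unfold h; lra).
  assert (HN : N <= N') by apply Rle_abs.
  set (c1 := s b1). set (c2 := s b2).
  assert (Hc12 : c1 <= c2).
  { unfold c1, c2. destruct (Req_dec b1 b2) as [ -> |Hne]; [lra|].
    left. apply (entry_increasing s Hs); lra. }
  assert (Hc2a : c2 <= a) by apply R2.
  assert (Ec1 : sg b1 = c1) by (apply Hsg; lra).
  assert (Ec2 : sg b2 = c2) by (apply Hsg; lra).
  assert (Hc : c2 - c1 <= D * h).
  { assert (Hb : Cmod (CInt (fun b => RtoC (dsg b)) b1 b2) <= Rabs (b2 - b1) * D).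
    { apply Cmod_CInt_le_const; [intros; cont|]. intros x Hx.
      rewrite Rmin_left, Rmax_right in Hx by lra. apply HBD. now apply (Rabs_between b1 b2). }
    rewrite (CInt_of_derive (fun b => RtoC (sg b))) in Hb
      by (intros; first [apply is_derive_RtoC, Dsg|cont]).
    rewrite Ec1, Ec2, <- RtoC_minus, Cmod_R, !Rabs_pos_eq in Hb by lra.
    unfold h. lra. }
  assert (Hc' : c2 - c1 < d1 /\ c2 - c1 < d4 /\ c2 - c1 <= e).
  { assert (Hx : D * h <= (D + 1) * h) by nra.
    assert (Hy : (D + 1) * h < Rmin (Rmin d1 d4) e).
    { replace (Rmin (Rmin d1 d4) e) with ((D + 1) * d6) by (unfold d6; field; lra).
      apply Rmult_lt_compat_l; [lra|exact Dl6]. }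
    generalize (Rmin_l (Rmin d1 d4) e) (Rmin_r (Rmin d1 d4) e) (Rmin_l d1 d4) (Rmin_r d1 d4).
    lra. }
  destruct Hc' as [Hcd1 [Hcd4 Hce]].
  assert (Rc1 : reg s N c1 b1) by (apply (reg_back_a s N a); auto; unfold c1; split; [lra|apply R1]).
  assert (Rc2 : reg s N c2 b2) by (apply (reg_back_a s N a); auto; unfold c2; split; [lra|exact Hc2a]).
  assert (Rc21 : reg s N c2 b1) by (apply (reg_back_a s N a); auto).
  destruct (reg_box s N c1 b1 Hs Rc1) as [Bc1 _].
  destruct (reg_box s N c2 b2 Hs Rc2) as [Bc2 _].
  assert (Hreg : forall x, c2 <= x <= a -> reg s N x b1 /\ reg s N x b2).
  { intros x Hx. split; apply (reg_back_a s N a); auto. unfold c1 in Hc12; lra. }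
  destruct (HB c1 b1 Bc1 B1) as [[M1 [M2 M3]] [M4 [M5 M6]]].
  set (f1 := f c1 b1) in *. set (g1 := g c1 b1) in *. set (V1 := V c1 b1) in *.
  set (Q1 := Q c1 b1) in *. set (V2 := V c2 b2).
  set (W := (RtoC (dsg b1) * Q1 + g1)%C).
  assert (Deh : e * (c2 - c1) <= D * (e * h)).
  { replace (D * (e * h)) with (e * (D * h)) by ring. apply Rmult_le_compat_l; lra. }
  assert (Heh : 0 <= e * h) by (apply Rmult_le_pos; lra).
  assert (Tsg : Rabs (c2 - c1 - h * dsg b1) <= e * h).
  { rewrite <- Cmod_R, <- Ec1, <- Ec2, !RtoC_minus, RtoC_mult.
    apply (Hsgu b1 b2); auto; lra. }
  (* the value of V on the boundary is differentiable along it *)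
  assert (TV : Cmod (V2 - V1 - RtoC h * W)%C <= (1 + AV * D + M) * (e * h)).
  { assert (E1 : V2 = (V c2 b1 + CInt (fun b => g c2 b) b1 b2)%C).
    { unfold V2. rewrite (CInt_of_derive (fun b => V c2 b)); [ring| |intros; cont].
      intros b. now apply is_derive_back_wave. }
    assert (T1 : Cmod (CInt (fun b => g c2 b) b1 b2 - RtoC h * g1)%C <= e * h).
    { apply CInt_near; [lra|intros; cont|]. intros y Hy.
      refine (proj2 (proj2 (proj2 (Hmod c1 b1 c2 y _ _ _ _ _ _)))); auto.
      - now apply (Rabs_between b1 b2).
      - rewrite Rabs_pos_eq; lra.
      - rewrite Rabs_pos_eq; lra. }
    assert (T2 : Cmod (V c2 b1 - V1 - RtoC (c2 - c1) * Q1)%C <= AV * (D * (e * h))).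
    { eapply Rle_trans; [now apply HVe|]. apply Rmult_le_compat_l; assumption. }
    assert (T3 : Cmod (RtoC (c2 - c1 - h * dsg b1) * Q1)%C <= e * h * M).
    { rewrite Cmod_mult, Cmod_R. apply Rmult_le_compat; auto using Rabs_pos, Cmod_ge_0. }
    replace (V2 - V1 - RtoC h * W)%C with
      ((CInt (fun b => g c2 b) b1 b2 - RtoC h * g1) + (V c2 b1 - V1 - RtoC (c2 - c1) * Q1)
        + RtoC (c2 - c1 - h * dsg b1) * Q1)%C.
    2:{ rewrite E1. unfold W. rewrite !RtoC_minus, RtoC_mult. ring. }
    eapply Rle_trans; [apply Cmod_triangle|].
    assert (T12 := Cmod_triangle (CInt (fun b => g c2 b) b1 b2 - RtoC h * g1)%C
      (V c2 b1 - V1 - RtoC (c2 - c1) * Q1)%C).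
    lra. }
  assert (HW : Cmod W <= D * M + M).
  { unfold W. eapply Rle_trans; [apply Cmod_triangle|]. rewrite Cmod_mult.
    assert (Cmod (RtoC (dsg b1)) * Cmod Q1 <= D * M).
    { apply Rmult_le_compat; try apply Cmod_ge_0; [exact (HBD b1 B1)|exact M6]. }
    lra. }
  apply (transport_taylor m al be K0 M K (2 * N')) with
    (c := c2) (d := a) (p := fun x => U x b1) (q := fun x => V x b1)
    (p' := fun x => U x b2) (q' := fun x => V x b2)
    (dp := fun x => P x b1) (dq := fun x => g x b1)
    (r := fun x => (f x b2 - f x b1 - RtoC h * fP x b1)%C); auto; try lra.
  - apply Rabs_le_between in Ba, Bc2. lra.
  - intros; cont.
  - intros; cont.
  - intros; cont.
  - intros; cont.
  - intros x Hx. destruct (Hreg x Hx) as [Rx1 Rx2].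
    destruct (reg_box s N x b1 Hs Rx1) as [Bx _].
    destruct (HB x b1 Bx B1) as [[k1 [k2 k3]] [k4 [k5 k6]]].
    destruct (HB x b2 Bx B2) as [[l1 [l2 l3]] [l4 [l5 l6]]].
    destruct (Hmod x b1 x b2) as [e1 [e2 [e3 e4]]]; auto.
    { now apply Rabs_same. }
    { rewrite Rabs_pos_eq; lra. }
    split; [repeat split; assumption|]. split; [exact e1|]. split; [exact e2|]. split.
    + replace (V x b2 - V x b1)%C with (CInt (fun b => g x b) b1 b2).
      2:{ apply (CInt_of_derive (fun b => V x b)); [|intros; cont].
          intros b. now apply is_derive_back_wave. }
      apply CInt_near; auto.
      * intros; cont.
      * intros y Hy. refine (proj2 (proj2 (proj2 (Hmod x b1 x y _ _ _ _ _ _)))); auto.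
        -- now apply (Rabs_between b1 b2).
        -- now apply Rabs_same.
        -- rewrite Rabs_pos_eq; lra.
    + now rewrite (Hf x b1), (Hf x b2), (HP x b1).
  - intros x Hx.
    rewrite (CInt_comb (fun x => f x b2) (fun x => f x b1) (fun x => fP x b1)) by (intros; cont).
    assert (Ux2 : U x b2 = (nub b2 * V2 + CInt (fun x => f x b2) c2 x)%C).
    { unfold V2, c2. rewrite <- U_entry_boundary by lra. now apply fwd_wave_from. }
    assert (Ux1 : U x b1 = (nub b1 * V1 + CInt (fun x => f x b1) c1 c2
        + CInt (fun x => f x b1) c2 x)%C).
    { rewrite <- Cplus_assoc, (CInt_Chasles (fun x => f x b1)) by (intros; cont).
      unfold V1, c1. rewrite <- U_entry_boundary by lra. now apply fwd_wave_from. }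
    assert (Px : P x b1 = (dnub b1 * V1 + nub b1 * W - RtoC (dsg b1) * f1
        + CInt (fun x => fP x b1) c1 c2 + CInt (fun x => fP x b1) c2 x)%C).
    { unfold P at 1. rewrite (fwd_wave_from mu_P nu_P init_Q fP gP c1) by exact CfP.
      rewrite <- (CInt_Chasles (fun x => fP x b1) c1 c2 x) by (intros; cont).
      fold P. unfold c1 at 1. rewrite P_entry_boundary by lra.
      fold c1. fold V1 Q1 f1 g1. fold W. ring. }
    replace (U x b2 - U x b1 - RtoC h * P x b1)%C with
      ((nub b2 - nub b1 - RtoC h * dnub b1) * V1 + nub b2 * (V2 - V1 - RtoC h * W)
        + (nub b2 - nub b1) * (RtoC h * W)
        + - (CInt (fun x => f x b1) c1 c2 - RtoC (c2 - c1) * f1)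
        + - (RtoC (c2 - c1 - h * dsg b1) * f1)
        + - (RtoC h * CInt (fun x => fP x b1) c1 c2)
        + (CInt (fun x => f x b2) c2 x - CInt (fun x => f x b1) c2 x
            - RtoC h * CInt (fun x => fP x b1) c2 x))%C.
    2:{ rewrite Ux2, Ux1, Px. rewrite !RtoC_minus, RtoC_mult. ring. }
    eapply Rle_trans; [apply Cmod_triangle|]. apply Rplus_le_compat_r.
    assert (I1 : Cmod ((nub b2 - nub b1 - RtoC h * dnub b1) * V1)%C <= M * (e * h)).
    { rewrite Cmod_mult, Rmult_comm. apply Rmult_le_compat; try apply Cmod_ge_0; [exact M2|].
      apply (Hnub b1 b2); auto. }
    assert (I2 : Cmod (nub b2 * (V2 - V1 - RtoC h * W))%C <= La * (1 + AV * D + M) * (e * h)).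
    { rewrite Cmod_mult, Rmult_assoc. apply Rmult_le_compat; auto using Cmod_ge_0. }
    assert (I3 : Cmod ((nub b2 - nub b1) * (RtoC h * W))%C <= (D * M + M) * (e * h)).
    { rewrite !Cmod_mult, Cmod_R, (Rabs_pos_eq h) by lra.
      replace ((D * M + M) * (e * h)) with (e * (h * (D * M + M))) by ring.
      apply Rmult_le_compat; [apply Cmod_ge_0|apply Rmult_le_pos; [lra|apply Cmod_ge_0]| |].
      - left. apply (Hnubc b1 b1 b2 b1); auto; [rewrite Rabs_pos_eq; lra|now apply Rabs_same].
      - apply Rmult_le_compat_l; lra. }
    assert (I4 : Cmod (CInt (fun x => f x b1) c1 c2 - RtoC (c2 - c1) * f1)%C <= D * (e * h)).
    { eapply Rle_trans; [|exact Deh]. apply CInt_near; [lra|intros; cont|].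
      intros y Hy. refine (proj1 (proj2 (proj2 (Hmod c1 b1 y b1 _ _ _ _ _ _)))); auto.
      - now apply (Rabs_between c1 c2).
      - rewrite Rabs_pos_eq; lra.
      - now apply Rabs_same. }
    assert (I5 : Cmod (RtoC (c2 - c1 - h * dsg b1) * f1)%C <= M * (e * h)).
    { rewrite Cmod_mult, Cmod_R, Rmult_comm.
      apply Rmult_le_compat; auto using Rabs_pos, Cmod_ge_0. }
    assert (I6 : Cmod (RtoC h * CInt (fun x => fP x b1) c1 c2)%C <= MP * (e * h)).
    { rewrite Cmod_mult, Cmod_R, (Rabs_pos_eq h) by lra.
      replace (MP * (e * h)) with (h * (e * MP)) by ring. apply Rmult_le_compat_l; [lra|].
      apply Rle_trans with (Rabs (c2 - c1) * MP).
      - apply Cmod_CInt_le_const; [intros; cont|]. intros y Hy.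
        rewrite Rmin_left, Rmax_right in Hy by lra.
        apply HBP; auto. now apply (Rabs_between c1 c2).
      - apply Rmult_le_compat_r; [lra|]. rewrite Rabs_pos_eq; lra. }
    eapply Rle_trans; [apply Cmod_triangle6|]. rewrite !Cmod_opp.
    unfold K0. lra.
Qed.

Lemma near_reg a b : s b < a -> 3 * a + b < N ->
  exists d, 0 < d /\ forall a' b', Rabs (a' - a) < d -> Rabs (b' - b) < d -> reg s N a' b'.
Proof.
  intros H1 H2.
  assert (Hsc := entry_continuous s Hs b).
  destruct (continuous_R_eps s b Hsc ((a - s b) / 2) ltac:(lra)) as [d1 Hd1].
  set (d := Rmin (Rmin d1 ((a - s b) / 2)) ((N - 3 * a - b) / 4)).
  assert (Hd : 0 < d) by (repeat apply Rmin_pos; try apply cond_pos; lra).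
  exists d. split; [exact Hd|]. intros a' b' Ha Hb.
  assert (m1 : d <= d1 /\ d <= (a - s b) / 2 /\ d <= (N - 3 * a - b) / 4).
  { unfold d. generalize (Rmin_l (Rmin d1 ((a - s b) / 2)) ((N - 3 * a - b) / 4))
      (Rmin_r (Rmin d1 ((a - s b) / 2)) ((N - 3 * a - b) / 4))
      (Rmin_l d1 ((a - s b) / 2)) (Rmin_r d1 ((a - s b) / 2)). lra. }
  assert (Hsb : Rabs (s b' - s b) < (a - s b) / 2).
  { apply Hd1. apply Rlt_le_trans with d; [exact Hb|lra]. }
  apply Rabs_lt_between in Ha, Hb, Hsb. split; lra.
Qed.

Lemma is_derive_V a b : s b < a -> 3 * a + b < N -> is_derive (fun a => V a b) a (Q a b).
Proof.
  intros H1 H2. assert (CQ := Q_continuous).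
  apply (is_derive_of_left_anchored (fun a => V a b) (fun a => Q a b)); [cont|].
  intros e He. destruct V_taylor as [A [HA HV]].
  set (e' := Rmin 1 (e / (A + 1))).
  assert (He' : 0 < e' <= 1).
  { split; [apply Rmin_pos; [lra|apply Rdiv_lt_0_compat; lra]|apply Rmin_l]. }
  assert (HAe : A * e' <= e).
  { apply Rle_trans with ((A + 1) * e'); [nra|].
    apply Rle_trans with ((A + 1) * (e / (A + 1))); [|right; field; lra].
    apply Rmult_le_compat_l; [lra|apply Rmin_r]. }
  destruct (HV e' He') as [d1 [Hd1 HV1]].
  destruct (near_reg a b H1 H2) as [d2 [Hd2 Hr]].
  exists (Rmin d1 d2). split; [now apply Rmin_pos|].
  intros y Hy. generalize (Rmin_l d1 d2) (Rmin_r d1 d2); intros.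
  assert (Ry : reg s N y b) by (apply Hr; [lra|now apply Rabs_same]).
  assert (Ra : reg s N a b) by (apply Hr; now apply Rabs_same).
  apply Rabs_lt_between in Hy.
  split; intros Hle.
  - eapply Rle_trans; [apply HV1; auto; lra|]. rewrite <- Rmult_assoc.
    apply Rmult_le_compat_r; lra.
  - eapply Rle_trans; [apply HV1; auto; lra|]. rewrite <- Rmult_assoc.
    apply Rmult_le_compat_r; lra.
Qed.

Lemma is_derive_U a b : s b < a -> 3 * a + b < N -> is_derive (fun b => U a b) b (P a b).
Proof.
  intros H1 H2. assert (CP := P_continuous).
  apply (is_derive_of_left_anchored (fun b => U a b) (fun b => P a b)); [cont|].
  intros e He. destruct U_taylor_initial as [A [HA HV]].
  destruct U_taylor_boundary as [A' [HA' HV']].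
  set (e' := Rmin 1 (e / (A + A' + 1))).
  assert (He' : 0 < e' <= 1).
  { split; [apply Rmin_pos; [lra|apply Rdiv_lt_0_compat; lra]|apply Rmin_l]. }
  assert (HAe : (A + A') * e' <= e).
  { apply Rle_trans with ((A + A' + 1) * e'); [nra|].
    apply Rle_trans with ((A + A' + 1) * (e / (A + A' + 1))); [|right; field; lra].
    apply Rmult_le_compat_l; [lra|apply Rmin_r]. }
  destruct (HV e' He') as [d1 [Hd1 HV1]].
  destruct (HV' e' He') as [d1' [Hd1' HV1']].
  destruct (near_reg a b H1 H2) as [d2 [Hd2 Hr]].
  (* stay on one side of the corner characteristic [b = 0] *)
  assert (Hb0 : exists d3, 0 < d3 /\ forall y, Rabs (y - b) < d3 ->
     (y <= b -> b <= 0 \/ 0 <= y) /\ (b <= y -> y <= 0 \/ 0 <= b)).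
  { destruct (Req_dec b 0) as [ -> |Hb].
    - exists 1. split; [lra|]. intros y _. lra.
    - exists (Rabs b). split; [now apply Rabs_pos_lt|]. intros y Hy.
      apply Rabs_lt_between in Hy. unfold Rabs in Hy; destruct (Rcase_abs b); lra. }
  destruct Hb0 as [d3 [Hd3 Hside]].
  exists (Rmin (Rmin d1 d1') (Rmin d2 d3)). split; [repeat apply Rmin_pos; assumption|].
  intros y Hy. generalize (Rmin_l (Rmin d1 d1') (Rmin d2 d3)) (Rmin_r (Rmin d1 d1') (Rmin d2 d3))
    (Rmin_l d1 d1') (Rmin_r d1 d1') (Rmin_l d2 d3) (Rmin_r d2 d3); intros.
  assert (Ry : reg s N a y) by (apply Hr; [now apply Rabs_same|lra]).
  assert (Ra : reg s N a b) by (apply Hr; now apply Rabs_same).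
  destruct (Hside y ltac:(lra)) as [Hs1 Hs2].
  apply Rabs_lt_between in Hy.
  assert (Hfin : forall l A0, 0 <= l -> 0 <= A0 <= A + A' -> A0 * (e' * l) <= e * l).
  { intros l A0 Hl HA0. rewrite <- Rmult_assoc. apply Rmult_le_compat_r; [exact Hl|].
    eapply Rle_trans; [|exact HAe]. apply Rmult_le_compat_r; lra. }
  split; intros Hle.
  - destruct (Hs1 Hle).
    + eapply Rle_trans; [apply HV1; try split; auto; lra|]. apply Hfin; lra.
    + eapply Rle_trans; [apply HV1'; auto; lra|]. apply Hfin; lra.
  - destruct (Hs2 Hle).
    + eapply Rle_trans; [apply HV1; try split; auto; lra|]. apply Hfin; lra.
    + eapply Rle_trans; [apply HV1'; auto; lra|]. apply Hfin; lra.
Qed.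

End Regularity.

(** * Extension of the data and the entry time *)

(** Differentiability is not asked at the end points, which may lie on the boundary
    of the domain. *)
Lemma derive_CInt_open (phi psi : R -> C) (c d : R) :
  c <= d -> (forall x, continuous phi x) -> (forall x, continuous psi x) ->
  (forall x, c < x < d -> is_derive phi x (psi x)) ->
  CInt psi c d = (phi d - phi c)%C.
Proof.
  intros Hcd Hphi Hpsi H.
  assert (real_case : forall p : R -> R, (forall x, continuous p x) ->
    (forall x, c < x < d -> is_derive p x 0) -> p d = p c).
  { intros p Hp Hd.
    assert (H1 : p d - p c <= 0 * (d - c)).
    { apply increase_le_of_derive_le with (df := fun _ => 0); auto. intros; lra. }
    assert (H2 : - p d - - p c <= 0 * (d - c)).
    { apply increase_le_of_derive_le with (f := fun x => - p x) (df := fun _ => 0); auto.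
      - intros x Hx. rewrite <- Ropp_0.
        apply (is_derive_opp (K := R_AbsRing) (V := R_NormedModule)). now apply Hd.
      - intros; cont.
      - intros; lra. }
    lra. }
  set (D := fun x => (phi x - CInt psi c x)%C).
  assert (CI : forall x, continuous (fun x => CInt psi c x) x).
  { apply (continuous_of_derive _ psi). intros x. now apply is_derive_CInt. }
  assert (HD : forall x, c < x < d -> is_derive D x (RtoC 0)).
  { intros x Hx. assert (H1 := H x Hx). assert (H2 := is_derive_CInt psi c x Hpsi).
    apply is_derive_C_iff in H1, H2. destruct H1 as [H1 H1'], H2 as [H2 H2'].
    apply is_derive_C_iff. split.
    - replace (Re (RtoC 0)) with (Re (psi x) - Re (psi x)) by (simpl; ring).
      exact (is_derive_minus (K := R_AbsRing) (V := R_NormedModule) _ _ _ _ _ H1 H2).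
    - replace (Im (RtoC 0)) with (Im (psi x) - Im (psi x)) by (simpl; ring).
      exact (is_derive_minus (K := R_AbsRing) (V := R_NormedModule) _ _ _ _ _ H1' H2'). }
  assert (E1 : Re (D d) = Re (D c)).
  { apply (real_case (fun x => Re (D x))); [intros; unfold D; cont|].
    intros x Hx. specialize (HD x Hx). apply is_derive_C_iff in HD. apply HD. }
  assert (E2 : Im (D d) = Im (D c)).
  { apply (real_case (fun x => Im (D x))); [intros; unfold D; cont|].
    intros x Hx. specialize (HD x Hx). apply is_derive_C_iff in HD. apply HD. }
  assert (E : D d = D c).
  { destruct (D d), (D c); unfold Re, Im in *; simpl in *; now subst. }
  unfold D in E. rewrite CInt_point in E.
  replace (CInt psi c d) with (phi d - (phi d - CInt psi c d))%C by ring. rewrite E. ring.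
Qed.

Definition clamp (T x : R) : R := Rmax 0 (Rmin x T).

Lemma clamp_range T x : 0 <= T -> 0 <= clamp T x <= T.
Proof.
  intros HT. unfold clamp. split; [apply Rmax_l|].
  apply Rmax_lub; [exact HT|apply Rmin_r].
Qed.

Lemma clamp_id T x : 0 <= x <= T -> clamp T x = x.
Proof. intros H. unfold clamp. rewrite Rmin_left, Rmax_right; lra. Qed.

Lemma clamp_locally_id T y : 0 < y < T -> locally y (fun w => clamp T w = w).
Proof.
  intros H. assert (He : 0 < Rmin y (T - y)) by (apply Rmin_pos; lra).
  exists (mkposreal _ He). intros w Hw.
  assert (Hw' : Rabs (w - y) < Rmin y (T - y)) by exact Hw.
  apply Rabs_lt_between in Hw'. generalize (Rmin_l y (T - y)) (Rmin_r y (T - y)); intros.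
  apply clamp_id. lra.
Qed.

Lemma clamp_continuous {X : UniformSpace} T (f : X -> R) x :
  continuous f x -> continuous (fun y => clamp T (f y)) x.
Proof. intros; unfold clamp; cont. Qed.

Lemma clamp_within T x : 0 <= T ->
  filterlim (clamp T) (locally x) (within half_line (locally (clamp T x))).
Proof.
  intros HT P HP.
  assert (Hc := clamp_continuous T (fun y => y) x (continuous_id x) _ HP).
  unfold filtermap in *. refine (filter_imp _ _ _ Hc). intros y Hy. apply Hy.
  unfold half_line. now apply (clamp_range T y).
Qed.

Lemma continuous_clamp_half_line {V : UniformSpace} (f : R -> V) T x :
  0 <= T -> continuous_on half_line f -> continuous (fun y => f (clamp T y)) x.
Proof.
  intros HT Hf. unfold continuous.
  apply (filterlim_comp _ _ _ (clamp T) f (locally x) (within half_line (locally (clamp T x)))).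
  - now apply clamp_within.
  - apply Hf. now apply (clamp_range T x).
Qed.

Lemma half_line_continuous {V : NormedModule R_AbsRing} (f df : R -> V) :
  C1_half_line f df -> continuous_on half_line f.
Proof.
  intros [H _] t Ht.
  apply (filterdiff_continuous_aux (K := R_AbsRing) (U := R_NormedModule) (V := V)).
  - eexists. now apply H.
  - intros P HP. now apply filter_le_within.
Qed.

Lemma half_line_derive {V : NormedModule R_AbsRing} (f df : R -> V) (t : R) :
  C1_half_line f df -> 0 < t -> is_derive f t (df t).
Proof.
  intros [H _] Ht. destruct (H t ltac:(lra)) as [Hl Hd].
  split; [exact Hl|]. intros x Hx.
  apply (@is_filter_lim_locally_unique R_AbsRing (AbsRing_NormedModule R_AbsRing)) in Hx. subst x.
  intros e.
  assert (Hw : is_filter_lim (within half_line (locally t)) t).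
  { intros P HP. now apply filter_le_within. }
  specialize (Hd t Hw e). unfold within in Hd.
  assert (Hpos : locally t half_line).
  { exists (mkposreal t Ht). intros y Hy. unfold half_line.
    assert (Hy' : Rabs (y - t) < t) by exact Hy. apply Rabs_lt_between in Hy'. lra. }
  refine (filter_imp _ _ _ (filter_and _ _ Hd Hpos)). intros y [Hy1 Hy2]. now apply Hy1.
Qed.

(** The derivative is frozen outside [0, T]; for the boundary curve this keeps its
    speed away from the characteristic speed, so that every characteristic meets
    it, which the curve itself may fail to achieve. *)
Lemma C1_extension (f df : R -> C) (T : R) : 0 <= T -> C1_half_line f df ->
  exists F dF, (forall x, is_derive F x (dF x)) /\ (forall x, continuous dF x) /\
    (forall x, 0 <= x <= T -> F x = f x) /\ (forall x, dF x = df (clamp T x)).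
Proof.
  intros HT Hf.
  set (dF := fun x => df (clamp T x)).
  assert (CdF : forall x, continuous dF x).
  { intros x. apply (continuous_clamp_half_line (V := C_UniformSpace)); [exact HT|].
    destruct Hf as [_ Hc]. exact Hc. }
  set (F := fun x => (f 0 + CInt dF 0 x)%C).
  assert (HF : forall x, is_derive F x (dF x)).
  { intros x. now apply is_derive_add_const, is_derive_CInt. }
  exists F, dF. split; [exact HF|]. split; [exact CdF|]. split; [|reflexivity].
  intros x Hx. unfold F.
  rewrite (derive_CInt_open (fun y => f (clamp T y)) dF 0 x); [|lra| |exact CdF|].
  - rewrite !clamp_id by lra. change (f 0 + (f x - f 0) = f x)%C. ring.
  - intros y. apply (continuous_clamp_half_line (V := C_UniformSpace)); [exact HT|].
    exact (half_line_continuous _ _ Hf).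
  - intros y Hy.
    assert (Hd := half_line_derive f df y Hf ltac:(lra)).
    unfold dF. rewrite clamp_id by lra.
    apply (is_derive_ext_loc f); [|exact Hd].
    assert (HyT : 0 < y < T) by lra.
    refine (filter_imp _ _ _ (clamp_locally_id T y HyT)). now intros w ->.
Qed.

Lemma C1_half_line_RtoC (f df : R -> R) :
  C1_half_line f df -> C1_half_line (fun x => RtoC (f x)) (fun x => RtoC (df x)).
Proof.
  intros [H Hc]. split.
  - intros t Ht. destruct (H t Ht) as [_ Hd]. split; [apply is_linear_scal_C|].
    intros x Hx e. specialize (Hd x Hx e). refine (filter_imp _ _ _ Hd).
    intros y Hy. rewrite norm_Cmod.
    assert (Hs : scal (V := C_R_ModuleSpace) (minus y x) (RtoC (df t)) = RtoC (scal (minus y x) (df t))).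
    { unfold scal; simpl. unfold prod_scal, scal; simpl. unfold mult; simpl.
      unfold RtoC. f_equal. ring. }
    change (Cmod (RtoC (f y) - RtoC (f x) - scal (V := C_R_ModuleSpace) (minus y x) (RtoC (df t)))%C
              <= e * norm (minus y x)).
    rewrite Hs, <- !RtoC_minus, Cmod_R. exact Hy.
  - intros x Hx. apply (filterlim_comp _ _ _ df RtoC _ (locally (df x)) _ (Hc x Hx)).
    apply (continuous_RtoC (fun y : R => y) (df x)). apply continuous_id.
Qed.

Lemma is_derive_R_eps (f : R -> R) (x l : R) :
  (forall e, 0 < e -> exists d, 0 < d /\ forall y, Rabs (y - x) < d ->
     Rabs (f y - f x - (y - x) * l) <= e * Rabs (y - x)) -> is_derive f x l.
Proof.
  intros H. split; [apply (is_linear_scal_l (V := R_NormedModule))|].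
  intros x' Hx'.
  apply (@is_filter_lim_locally_unique R_AbsRing (AbsRing_NormedModule R_AbsRing)) in Hx'. subst x'.
  intros e. destruct (H e (cond_pos e)) as [d [Hd Hy]].
  exists (mkposreal d Hd). intros y Hb. exact (Hy y Hb).
Qed.

Lemma mvt_R (f df : R -> R) (x y : R) :
  (forall x, is_derive f x (df x)) ->
  exists c, Rmin x y <= c <= Rmax x y /\ f y - f x = df c * (y - x).
Proof.
  intros H. apply MVT_gen; intros c _; [apply H|].
  apply continuous_continuity_pt, (is_derive_continuous_R _ _ _ (H c)).
Qed.

(** [tau b] is the time at which the characteristic [t - x = 2 b] meets the
    boundary curve, for a speed bounded away from the characteristic speed 1. *)
Lemma entry_time (Z dZ : R -> R) (th : R) :
  (forall x, is_derive Z x (dZ x)) -> (forall x, continuous dZ x) -> Z 0 = 0 ->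
  (forall x, -1 < dZ x <= th) -> th < 1 ->
  exists tau, (forall b, tau b - Z (tau b) = 2 * b) /\
    (forall b, is_derive tau b (2 / (1 - dZ (tau b)))) /\
    (forall b b', b < b' -> tau b < tau b').
Proof.
  intros HZ Hc HZ0 Hb Hth.
  set (phi := fun t => t - Z t).
  assert (Hphi : forall x, is_derive phi x (1 - dZ x)).
  { intros x. apply (is_derive_minus (K := R_AbsRing) (V := R_NormedModule));
    [apply (is_derive_id (K := R_AbsRing))|apply HZ]. }
  assert (Hmono : forall x y, x <= y -> (1 - th) * (y - x) <= phi y - phi x).
  { intros x y Hxy. destruct (mvt_R phi (fun x => 1 - dZ x) x y Hphi) as [c [_ ->]].
    apply Rmult_le_compat_r; [lra|]. generalize (Hb c); lra. }
  assert (phi0 : phi 0 = 0) by (unfold phi; rewrite HZ0; ring).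
  assert (Hex : forall b, exists t, phi t = 2 * b).
  { intros b. set (K := Rabs (2 * b) / (1 - th)).
    assert (HK : 0 <= K) by (apply Rdiv_le_0_compat; [apply Rabs_pos|lra]).
    assert (HK' : (1 - th) * K = Rabs (2 * b)) by (unfold K; field; lra).
    destruct (IVT_gen phi (- K) K (2 * b)) as [t [_ Ht]].
    - intros x. apply continuous_continuity_pt, (is_derive_continuous_R _ _ _ (Hphi x)).
    - assert (H1 := Hmono (- K) 0 ltac:(lra)). assert (H2 := Hmono 0 K HK).
      rewrite phi0 in H1, H2.
      assert (H3 := Rle_abs (2 * b)). assert (H4 := Rle_abs (- (2 * b))). rewrite Rabs_Ropp in H4.
      rewrite Rmin_left, Rmax_right by lra. lra.
    - now exists t. }
  set (tau := fun b => proj1_sig (constructive_indefinite_description _ (Hex b))).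
  assert (Htau : forall b, phi (tau b) = 2 * b).
  { intros b. unfold tau. apply proj2_sig. }
  assert (Hlip : forall b b', b <= b' -> tau b <= tau b' /\ (1 - th) * (tau b' - tau b) <= 2 * (b' - b)).
  { intros b b' Hbb.
    assert (Hle : tau b <= tau b').
    { destruct (Rle_dec (tau b) (tau b')) as [H|H]; [exact H|].
      assert (Hm := Hmono (tau b') (tau b) ltac:(lra)). rewrite !Htau in Hm.
      assert (0 < (1 - th) * (tau b - tau b')) by (apply Rmult_lt_0_compat; lra). lra. }
    split; [exact Hle|]. assert (Hm := Hmono _ _ Hle). rewrite !Htau in Hm. lra. }
  assert (Hlip' : forall b b', Rabs (tau b' - tau b) <= 2 / (1 - th) * Rabs (b' - b)).
  { assert (Hone : forall b b', b <= b' -> Rabs (tau b' - tau b) <= 2 / (1 - th) * Rabs (b' - b)).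
    { intros b b' Hbb. destruct (Hlip b b' Hbb) as [H1 H2].
      rewrite !Rabs_pos_eq by lra.
      replace (2 / (1 - th) * (b' - b)) with (2 * (b' - b) / (1 - th)) by (field; lra).
      apply Rle_div_r; lra. }
    intros b b'. destruct (Rle_dec b b'); [now apply Hone|].
    rewrite (Rabs_minus_sym (tau b')), (Rabs_minus_sym b'). apply Hone; lra. }
  exists tau. split; [exact Htau|]. split.
  - intros b. apply is_derive_R_eps. intros e He.
    assert (Hcq : continuous (fun x => 2 / (1 - dZ x)) (tau b)).
    { apply continuous_Rdiv; [cont|cont|]. generalize (Hb (tau b)); lra. }
    destruct (continuous_R_eps _ _ Hcq e He) as [d Hd].
    set (d' := d * ((1 - th) / 2)).
    assert (Hd' : 0 < d').
    { apply Rmult_lt_0_compat; [apply cond_pos|lra]. }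
    exists d'. split; [exact Hd'|]. intros y Hy.
    destruct (mvt_R phi (fun x => 1 - dZ x) (tau b) (tau y) Hphi) as [c [Hc1 Hc2]].
    rewrite !Htau in Hc2. assert (Hpc := Hb c).
    assert (Hcb : Rabs (c - tau b) < d).
    { apply Rle_lt_trans with (Rabs (tau y - tau b)).
      - unfold Rmin, Rmax in Hc1. unfold Rabs.
        destruct (Rle_dec (tau b) (tau y)), (Rcase_abs _), (Rcase_abs _); lra.
      - eapply Rle_lt_trans; [apply Hlip'|].
        apply Rlt_le_trans with (2 / (1 - th) * d').
        + apply Rmult_lt_compat_l; [apply Rdiv_lt_0_compat; lra|exact Hy].
        + unfold d'. right; field; lra. }
    replace (tau y - tau b - (y - b) * (2 / (1 - dZ (tau b)))) with
      ((y - b) * (2 / (1 - dZ c) - 2 / (1 - dZ (tau b)))).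
    2:{ assert (Hpt := Hb (tau b)).
        replace (tau y - tau b) with ((2 * y - 2 * b) / (1 - dZ c)) by (rewrite Hc2; field; lra).
        field; lra. }
    rewrite Rabs_mult, Rmult_comm. apply Rmult_le_compat_r; [apply Rabs_pos|].
    left. now apply Hd.
  - intros b b' Hbb. destruct (Hlip b b' ltac:(lra)) as [[H|H] _]; [exact H|].
    assert (E1 := Htau b). assert (E2 := Htau b'). rewrite H in E1. lra.
Qed.

(** The curve [z] up to time [N], in characteristic coordinates; there [a + b] is the
    time, [a - b] the position, and [tau b - b] the coordinate [a] of the boundary
    point on the characteristic [b]. *)
Record boundary_geometry (z zt : R -> R) (N : R) (tau dtau : R -> R) : Prop := {
  tau_derive : forall b, is_derive tau b (dtau b);
  dtau_continuous : forall b, continuous dtau b;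
  tau_0 : tau 0 = 0;
  tau_increasing : forall b b', b < b' -> tau b < tau b';
  exit_increasing : forall b b', b < b' -> tau b - b < tau b' - b';
  tau_le : forall t b, 0 <= t <= N -> (2 * b <= t - z t <-> tau b <= t);
  le_tau : forall t b, 0 <= t <= N -> (t - z t <= 2 * b <-> t <= tau b);
  dtau_eq : forall b, 0 <= tau b <= N -> dtau b = 2 / (1 - zt (tau b)) }.

Lemma boundary_geometry_exists (z zt : R -> R) (N : R) :
  0 <= N -> C1_half_line z zt -> (forall t, 0 <= t -> -1 < zt t < 1) -> z 0 = 0 ->
  exists tau dtau, boundary_geometry z zt N tau dtau.
Proof.
  intros HN Hz Hzt Hz0.
  destruct (C1_extension _ _ N HN (C1_half_line_RtoC z zt Hz)) as [F [dF [HF [CdF [EF EdF]]]]].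
  set (Z := fun x => Re (F x)). set (dZ := fun x => zt (clamp N x)).
  assert (HdZ : forall x, Re (dF x) = dZ x) by (intros x; rewrite EdF; reflexivity).
  assert (DZ : forall x, is_derive Z x (dZ x)).
  { intros x. specialize (HF x). apply is_derive_C_iff in HF. rewrite HdZ in HF. apply HF. }
  assert (CdZ : forall x, continuous dZ x).
  { intros x. apply continuous_ext with (f := fun x => Re (dF x)); [exact HdZ|].
    apply continuous_Re, CdF. }
  assert (EZ : forall x, 0 <= x <= N -> Z x = z x).
  { intros x Hx. unfold Z. rewrite EF by exact Hx. reflexivity. }
  assert (Hmax : exists th, th < 1 /\ forall x, dZ x <= th).
  { destruct (continuity_ab_maj dZ 0 N HN) as [M [HM1 HM2]].
    { intros c _. now apply continuous_continuity_pt. }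
    exists (dZ M). split.
    - unfold dZ. rewrite clamp_id by exact HM2. apply Hzt; lra.
    - intros x. assert (Hr := clamp_range N x HN).
      replace (dZ x) with (dZ (clamp N x)) by (unfold dZ; rewrite (clamp_id N (clamp N x)); auto).
      now apply HM1. }
  destruct Hmax as [th [Hth Hmax]].
  assert (Hb : forall x, -1 < dZ x <= th).
  { intros x. split; [|apply Hmax]. apply Hzt. now apply (clamp_range N x). }
  destruct (entry_time Z dZ th DZ CdZ ltac:(rewrite EZ by lra; exact Hz0) Hb Hth)
    as [tau [E1 [E2 E3]]].
  assert (Hinv : forall t, tau ((t - Z t) / 2) = t).
  { intros t. assert (H := E1 ((t - Z t) / 2)).
    set (t' := tau ((t - Z t) / 2)) in *.
    destruct (mvt_R Z dZ t t' DZ) as [c [_ Hc]].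
    assert ((t' - t) * (1 - dZ c) = 0) by lra.
    specialize (Hb c). apply Rmult_integral in H0. lra. }
  assert (tau0 : tau 0 = 0).
  { rewrite <- (Hinv 0) at 2. f_equal. rewrite EZ, Hz0 by lra. lra. }
  assert (mono : forall b b', b <= b' -> tau b <= tau b').
  { intros b b' [H| -> ]; [left; now apply E3|lra]. }
  assert (Ctau : forall b, continuous tau b).
  { intros b. apply (is_derive_continuous_R _ _ _ (E2 b)). }
  exists tau, (fun b => 2 / (1 - dZ (tau b))). split.
  - exact E2.
  - intros b. apply continuous_Rdiv; [cont|cont|]. generalize (Hb (tau b)); lra.
  - exact tau0.
  - exact E3.
  - intros b b' Hbb.
    destruct (mvt_R tau (fun b => 2 / (1 - dZ (tau b))) b b' E2) as [c [_ Hc]].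
    specialize (Hb (tau c)).
    assert (1 < 2 / (1 - dZ (tau c))) by (apply Rlt_div_r; lra).
    assert (1 * (b' - b) < 2 / (1 - dZ (tau c)) * (b' - b)) by (apply Rmult_lt_compat_r; lra).
    lra.
  - intros t b Ht. rewrite <- (EZ t Ht). split; intros H.
    + rewrite <- (Hinv t). apply mono. lra.
    + destruct (Rle_dec (2 * b) (t - Z t)) as [|Hn]; [lra|].
      assert (Hc := E3 ((t - Z t) / 2) b ltac:(lra)). rewrite Hinv in Hc. lra.
  - intros t b Ht. rewrite <- (EZ t Ht). split; intros H.
    + rewrite <- (Hinv t). apply mono. lra.
    + destruct (Rle_dec (t - Z t) (2 * b)) as [|Hn]; [lra|].
      assert (Hc := E3 b ((t - Z t) / 2) ltac:(lra)). rewrite Hinv in Hc. lra.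
  - intros b Hb'. unfold dZ. now rewrite clamp_id.
Qed.

(** * Solutions on backward triangles *)

(** The problem on [x + 2 t <= N] in characteristic coordinates: [k] and [vi] are the
    initial values of [U] and [V], [nub] is [lambda] at the entry time. *)
Record char_data (z zt : R -> R) (lambda lambdat u0 u0x v0 v0x : R -> C) (N : R)
    (s sg dsg : R -> R) (k dk vi dvi nub dnub : R -> C) : Prop := {
  cd_curve : entry_curve s;
  cd_sg : forall b, 0 <= b -> sg b = s b;
  cd_dsg : forall b, is_derive sg b (dsg b);
  cd_dsg_cont : forall b, continuous dsg b;
  cd_dk : forall b, is_derive k b (dk b);
  cd_dk_cont : forall b, continuous dk b;
  cd_dvi : forall b, is_derive vi b (dvi b);
  cd_dvi_cont : forall b, continuous dvi b;
  cd_dnub : forall b, is_derive nub b (dnub b);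
  cd_dnub_cont : forall b, continuous dnub b;
  cd_k : forall b, - N <= 2 * b <= 0 -> k b = u0 (- (2 * b));
  cd_vi : forall a, 0 <= 2 * a <= N -> vi a = v0 (2 * a);
  cd_nub : forall b, 0 <= b -> s b + b <= N ->
     nub b = lambda (s b + b) /\ z (s b + b) = s b - b /\ normsq (nub b) <= dsg b;
  cd_dom : forall a b, 0 <= a + b <= N -> (s b <= a <-> z (a + b) <= a - b);
  cd_dom_strict : forall a b, 0 <= a + b <= N -> (s b < a <-> 0 < a + b /\ z (a + b) < a - b);
  cd_corner : dk 0 = (- (RtoC 2) * u0x 0)%C /\ dvi 0 = (RtoC 2 * v0x 0)%C /\
     dsg 0 = 2 / (1 - zt 0) - 1 /\ dnub 0 = (RtoC (2 / (1 - zt 0)) * lambdat 0)%C }.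

Lemma is_derive_C_comp (F dF : R -> C) (p : R -> R) (dp x : R) :
  is_derive F (p x) (dF (p x)) -> is_derive p x dp ->
  is_derive (fun y => F (p y)) x (RtoC dp * dF (p x))%C.
Proof.
  intros HF Hp. apply is_derive_C_iff in HF. destruct HF as [H1 H2].
  apply is_derive_C_iff. split.
  - replace (Re (RtoC dp * dF (p x))%C) with (scal dp (Re (dF (p x)))).
    + exact (is_derive_comp (fun y => Re (F y)) p x _ _ H1 Hp).
    + unfold scal; simpl; unfold mult, Re; simpl; ring.
  - replace (Im (RtoC dp * dF (p x))%C) with (scal dp (Im (dF (p x)))).
    + exact (is_derive_comp (fun y => Im (F y)) p x _ _ H2 Hp).
    + unfold scal; simpl; unfold mult, Im; simpl; ring.
Qed.

Lemma char_data_exists (z zt : R -> R) (lambda lambdat u0 u0x v0 v0x : R -> C) (N : R) :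
  0 <= N -> C1_half_line z zt -> C1_half_line lambda lambdat ->
  (forall t, 0 <= t -> -1 < zt t < 1) -> z 0 = 0 ->
  (forall t, 0 <= t -> Cmod (lambda t) ^ 2 * (1 - zt t) <= 1 + zt t) ->
  C1_half_line u0 u0x -> C1_half_line v0 v0x ->
  exists s sg dsg k dk vi dvi nub dnub,
    char_data z zt lambda lambdat u0 u0x v0 v0x N s sg dsg k dk vi dvi nub dnub.
Proof.
  intros HN Hz Hl Hzt Hz0 Hdiss Hu Hv.
  destruct (boundary_geometry_exists z zt N HN Hz Hzt Hz0) as [tau [dtau [G1 G2 G3 G4 G5 G6 G7 G8]]].
  destruct (C1_extension u0 u0x N HN Hu) as [U0 [dU0 [DU [CU [EU EdU]]]]].
  destruct (C1_extension v0 v0x N HN Hv) as [V0 [dV0 [DV [CV [EV EdV]]]]].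
  destruct (C1_extension lambda lambdat N HN Hl) as [L [dL [DL [CL [EL EdL]]]]].
  assert (Ctau : forall b, continuous tau b).
  { intros b. apply (is_derive_continuous_R _ _ _ (G1 b)). }
  assert (mono : forall b b', b <= b' -> tau b <= tau b').
  { intros b b' [H| -> ]; [left; now apply G4|lra]. }
  assert (tau_pos : forall b, 0 <= b -> 0 <= tau b).
  { intros b Hb. rewrite <- G3. now apply mono. }
  assert (tau_z : forall b, 0 <= tau b <= N -> tau b - z (tau b) = 2 * b).
  { intros b Hb. assert (H1 := proj2 (G6 (tau b) b Hb)). assert (H2 := proj2 (G7 (tau b) b Hb)). lra. }
  assert (s_bpos : forall b, 0 <= b -> tau (bpos b) - b = tau b - b).
  { intros b Hb. now rewrite bpos_of_nonneg. }
  assert (s_neg : forall b, b <= 0 -> tau (bpos b) - b = - b).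
  { intros b Hb. rewrite bpos_of_nonpos, G3 by exact Hb. ring. }
  assert (exit_mono : forall b b', b <= b' -> tau b - b <= tau b' - b').
  { intros b b' [H| -> ]; [left; now apply G5|lra]. }
  exists (fun b => tau (bpos b) - b), (fun b => tau b - b), (fun b => dtau b - 1),
    (fun b => U0 (-2 * b)%R), (fun b => (RtoC (-2) * dU0 (-2 * b)%R)%C),
    (fun a => V0 (2 * a)%R), (fun a => (RtoC 2 * dV0 (2 * a)%R)%C),
    (fun b => L (tau b)), (fun b => (RtoC (dtau b) * dL (tau b))%C).
  assert (dlin : forall c x, is_derive (fun y => c * y) x c).
  { intros c x. auto_derive; [exact I|ring]. }
  assert (dom : forall a b, 0 <= a + b <= N -> (tau (bpos b) - b <= a <-> z (a + b) <= a - b)).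
  { intros a b Hab. assert (H6 := G6 (a + b) b Hab).
    destruct (Rle_dec 0 b) as [Hb|Hb].
    - rewrite s_bpos by exact Hb. split; intros H; [apply proj2 in H6|apply proj1 in H6]; lra.
    - rewrite s_neg by lra. assert (tau b <= 0) by (rewrite <- G3; apply mono; lra).
      apply proj2 in H6. split; intros; lra. }
  split.
  - split.
    + intros b. apply continuous_Rminus; [|cont].
      apply (continuous_1 tau); [exact Ctau|]. apply continuous_bpos; cont.
    + rewrite bpos_of_nonpos, G3; lra.
    + exact s_neg.
    + intros b. destruct (Rle_dec 0 b) as [Hb|Hb]; [|rewrite s_neg; lra].
      rewrite s_bpos by exact Hb. assert (H := exit_mono 0 b Hb). lra.
    + intros b b1 Hb Hbb. rewrite !s_bpos by lra. now apply G5.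
  - intros b Hb. now rewrite s_bpos.
  - intros b. apply (is_derive_minus (K := R_AbsRing) (V := R_NormedModule));
      [apply G1|apply (is_derive_id (K := R_AbsRing))].
  - intros b. cont.
  - intros b. apply (is_derive_C_comp U0 dU0 (fun b => -2 * b)); [apply DU|apply dlin].
  - intros b. cont.
  - intros b. apply (is_derive_C_comp V0 dV0 (fun b => 2 * b)); [apply DV|apply dlin].
  - intros b. cont.
  - intros b. apply (is_derive_C_comp L dL tau); [apply DL|apply G1].
  - intros b. cont.
  - intros b Hb. rewrite EU by lra. f_equal. ring.
  - intros a Ha. now rewrite EV.
  - intros b Hb HbN. rewrite bpos_of_nonneg in * by exact Hb.
    replace (tau b - b + b) with (tau b) in * by ring.
    assert (Ht : 0 <= tau b <= N) by (split; [now apply tau_pos|exact HbN]).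
    split; [now apply EL|]. split; [assert (H := tau_z b Ht); lra|].
    rewrite EL, G8 by exact Ht.
    assert (Hd := Hdiss (tau b) ltac:(lra)). assert (Hq := Hzt (tau b) ltac:(lra)).
    rewrite Cmod2_alt in Hd.
    replace (2 / (1 - zt (tau b)) - 1) with ((1 + zt (tau b)) / (1 - zt (tau b))) by (field; lra).
    apply Rle_div_r; [lra|]. unfold normsq. simpl in Hd. lra.
  - exact dom.
  - intros a b Hab. assert (H7 := G7 (a + b) b Hab).
    destruct (Rle_dec 0 b) as [Hb|Hb].
    + rewrite s_bpos by exact Hb. split; intros H.
      * assert (Hp := tau_pos b Hb). split; [lra|]. apply proj1 in H7.
        destruct (Rlt_dec (z (a + b)) (a - b)) as [|Hn]; [assumption|]. lra.
      * apply proj2 in H7. destruct (Rlt_dec (tau b - b) a) as [|Hn]; [assumption|]. lra.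
    + rewrite s_neg by lra. split; intros H; [|lra]. split; [lra|].
      assert (tau b < 0) by (rewrite <- G3; apply G4; lra).
      apply proj1 in H7. destruct (Rlt_dec (z (a + b)) (a - b)) as [|Hn]; [assumption|]. lra.
  - rewrite !Rmult_0_r, G3, !EdU, !EdV, !EdL, !clamp_id by lra.
    assert (Hd0 : dtau 0 = 2 / (1 - zt 0)) by (rewrite G8, G3; [reflexivity|lra]).
    rewrite Hd0. split; [|split; [reflexivity|split; reflexivity]].
    rewrite <- RtoC_opp. reflexivity.
Qed.

Lemma boundary_speed (z zt : R -> R) (t t' : R) : C1_half_line z zt ->
  (forall t, 0 <= t -> -1 < zt t < 1) -> 0 <= t -> t <= t' -> Rabs (z t' - z t) <= t' - t.
Proof.
  intros hz hzt Ht Htt.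
  assert (Dz : forall y, t < y < t' -> is_derive (fun y => z (clamp t' y)) y (zt (clamp t' y))).
  { intros y Hy. rewrite clamp_id by lra. apply (is_derive_ext_loc z).
    - assert (Hyt : 0 < y < t') by lra.
      refine (filter_imp _ _ _ (clamp_locally_id t' y Hyt)). now intros w ->.
    - apply half_line_derive; [exact hz|lra]. }
  assert (Cz : forall y, continuous (fun y => z (clamp t' y)) y).
  { intros y. apply (continuous_clamp_half_line (V := R_UniformSpace)); [lra|].
    exact (half_line_continuous _ _ hz). }
  assert (Hzt : forall y, t <= y <= t' -> -1 < zt (clamp t' y) < 1).
  { intros y Hy. apply hzt. rewrite clamp_id; lra. }
  assert (H1 := increase_le_of_derive_le (fun y => z (clamp t' y)) (fun y => zt (clamp t' y)) 1 t t' Htt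
    Dz (fun y _ => Cz y) ltac:(intros y Hy; generalize (Hzt y Hy); lra)).
  assert (H2 := increase_le_of_derive_le (fun y => - z (clamp t' y)) (fun y => - zt (clamp t' y)) 1 t t' Htt
    (fun y Hy => is_derive_opp (K := R_AbsRing) (V := R_NormedModule) _ _ _ (Dz y Hy))
    (fun y _ => continuous_Ropp _ _ (Cz y)) ltac:(intros y Hy; generalize (Hzt y Hy); lra)).
  cbv beta in H1, H2. rewrite !clamp_id in H1, H2 by lra.
  apply Rabs_le_between. lra.
Qed.

Lemma boundary_above_cone (z zt : R -> R) (t : R) : C1_half_line z zt ->
  (forall t, 0 <= t -> -1 < zt t < 1) -> z 0 = 0 -> 0 <= t -> - t <= z t.
Proof.
  intros hz hzt hz0 Ht. assert (H := boundary_speed z zt 0 t hz hzt (Rle_refl 0) Ht).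
  rewrite hz0 in H. apply Rabs_le_between in H. lra.
Qed.

(** Outside the triangle [x + 2 t <= N] only continuity is asked.  Both the solutions
    constructed on one triangle and the restrictions of global ones have this form. *)
Definition classical_upto (m al be : R) (z : R -> R) (lambda u0 v0 : R -> C) (N : R)
    (u v ux ut vx vt : R * R -> C) : Prop :=
  (continuous_on (Omega z) u /\ continuous_on (Omega z) v /\
   continuous_on (Omega z) ux /\ continuous_on (Omega z) ut /\
   continuous_on (Omega z) vx /\ continuous_on (Omega z) vt) /\
  (forall x t, 0 < t -> z t < x -> x + 2 * t < N ->
     is_derive (fun y => u (y, t)) x (ux (x, t)) /\ is_derive (fun r => u (x, r)) t (ut (x, t)) /\
     is_derive (fun y => v (y, t)) x (vx (x, t)) /\ is_derive (fun r => v (x, r)) t (vt (x, t))) /\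
  (forall p, Omega z p -> fst p + 2 * snd p <= N ->
     (ut p + ux p = src m al be (u p) (v p))%C /\ (vt p - vx p = src m al be (v p) (u p))%C) /\
  (forall x, 0 <= x <= N -> u (x, 0) = u0 x /\ v (x, 0) = v0 x) /\
  (forall t, 0 <= t -> z t + 2 * t <= N -> u (z t, t) = (lambda t * v (z t, t))%C).

Section Data.

Context (m alpha beta : R) (z zt : R -> R) (lambda lambdat u0 u0x v0 v0x : R -> C).
Hypothesis hm : 0 <= m.
Hypothesis hz : C1_half_line z zt.
Hypothesis hlambda : C1_half_line lambda lambdat.
Hypothesis hzt : forall t, 0 <= t -> -1 < zt t < 1.
Hypothesis hz0 : z 0 = 0.
Hypothesis hdiss : forall t, 0 <= t -> Cmod (lambda t) ^ 2 * (1 - zt t) <= 1 + zt t.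
Hypothesis hu0 : C1_half_line u0 u0x.
Hypothesis hv0 : C1_half_line v0 v0x.
Hypothesis hcompat0 : u0 0 = (lambda 0 * v0 0)%C.
Hypothesis hcompat1 :
       (RtoC (1 - zt 0)%R * u0x 0
        + lambda 0 * RtoC (1 + zt 0)%R * v0x 0
        + Ci * lambda 0 * (RtoC m * u0 0 - N2 alpha beta (u0 0) (v0 0))
        - Ci * (RtoC m * v0 0 - N1 alpha beta (u0 0) (v0 0))
        + lambdat 0 * v0 0)%C = RtoC 0.

Lemma normsq_Cmod x B : 0 <= B -> normsq x <= B -> Cmod x <= B + 1.
Proof.
  intros HB H. assert (Hs := Cmod_sq x). assert (Hp := Cmod_ge_0 x).
  unfold normsq in H. rewrite <- Hs in H. nra.
Qed.

Lemma Cmod_normsq x B : Cmod x <= B -> normsq x <= B * B.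
Proof.
  intros H. assert (Hs := Cmod_sq x). assert (Hp := Cmod_ge_0 x).
  unfold normsq. rewrite <- Hs. nra.
Qed.

Lemma is_derive_half_sum x t : is_derive (fun y => (y + t) / 2) x (/ 2) /\
  is_derive (fun y => (t - y) / 2) x (- / 2) /\ is_derive (fun y => (x + y) / 2) t (/ 2) /\
  is_derive (fun y => (y - x) / 2) t (/ 2).
Proof. split; [|split; [|split]]; (auto_derive; [exact I|field]). Qed.

Theorem classical_upto_exists (N : R) : 0 <= N -> exists u v ux ut vx vt,
  classical_upto m alpha beta z lambda u0 v0 N u v ux ut vx vt.
Proof.
  intros HN.
  destruct (char_data_exists z zt lambda lambdat u0 u0x v0 v0x N HN hz hlambda hzt hz0 hdiss hu0 hv0)
    as [s [sg [dsg [k [dk [vi [dvi [nub [dnub HD]]]]]]]]].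
  assert (Hs := cd_curve _ _ _ _ _ _ _ _ _ _ _ _ _ _ _ _ _ _ HD).
  destruct HD as [_ Hsg Dsg Cdsg Dk Cdk Dvi Cdvi Dnub Cdnub Hk Hvi Hnub Hdom Hdoms [Kdk [Kdvi [Kdsg Kdnub]]]].
  assert (s0 := entry_0 s Hs).
  assert (sg0 : sg 0 = 0) by (rewrite Hsg, s0; lra).
  assert (k0 : k 0 = u0 0) by (rewrite Hk by lra; f_equal; ring).
  assert (vi0 : vi 0 = v0 0) by (rewrite Hvi by lra; f_equal; ring).
  assert (nub0 : nub 0 = lambda 0).
  { destruct (Hnub 0) as [-> _]; [lra|rewrite s0; lra|]. f_equal. rewrite s0; ring. }
  assert (c0 : k 0 = (nub 0 * vi 0)%C) by (rewrite k0, vi0, nub0; exact hcompat0).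
  assert (Ck := continuous_of_derive k dk Dk).
  assert (Cvi := continuous_of_derive vi dvi Dvi).
  assert (Cnub := continuous_of_derive nub dnub Dnub).
  destruct (interval_bounded k N Ck) as [Bk [HBk HBk']].
  destruct (interval_bounded vi N Cvi) as [Bv [HBv HBv']].
  destruct (interval_bounded nub N Cnub) as [Bn [HBn HBn']].
  set (S0 := Bk * Bk + Bv * Bv). set (La := Bn * Bn).
  set (B := back_bound m beta N S0 + fwd_bound m beta N S0 La).
  (* beyond the a priori bounds, so that the truncation at r is never active *)
  set (r := B + 1).
  assert (HS0 : 0 <= S0) by (unfold S0; nra).
  assert (HLa : 0 <= La) by (unfold La; nra).
  assert (HC : 0 <= m * (2 * S0 * N)) by (apply Rmult_le_pos; [exact hm|nra]).
  assert (HB1 : 0 <= back_bound m beta N S0).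
  { unfold back_bound. apply Rmult_le_pos; [left; apply exp_pos|lra]. }
  assert (HB2 : 0 <= fwd_bound m beta N S0 La).
  { unfold fwd_bound. apply Rmult_le_pos; [left; apply exp_pos|].
    assert (0 <= La * back_bound m beta N S0) by now apply Rmult_le_pos. lra. }
  assert (Hr : 0 < r) by (unfold r, B; lra).
  set (mu := entry_mu k). set (nu := entry_nu nub).
  assert (Cmu : forall x, continuous mu x) by now apply entry_mu_cont.
  assert (Cnu : forall x, continuous nu x) by now apply entry_nu_cont.
  destruct (cut_src_lipschitz m alpha beta r Hr) as [Lc [HLc HLc']].
  destruct (mild_existence s mu nu vi
    (fun _ _ u v => cut_src m alpha beta r u v) (fun _ _ u v => cut_src m alpha beta r v u))
    as [f [g Hmild]]; auto.
  { intros u v Cu Cv. now apply (cont2_cut_src m alpha beta r u v). }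
  { intros u v Cu Cv. now apply (cont2_cut_src m alpha beta r v u). }
  { intros N'. exists Lc. split; [exact HLc|]. intros; apply HLc'. }
  { intros N'. exists Lc. split; [exact HLc|]. intros a b _ u v u' v'.
    rewrite (Rplus_comm (Cmod (u - u')%C)). apply HLc'. }
  specialize (Hmild N).
  set (U := fwd_wave s mu nu vi f g). set (V := back_wave vi g).
  assert (Cf := mild_f_cont _ _ _ _ _ _ _ _ _ Hmild).
  assert (Cg := mild_g_cont _ _ _ _ _ _ _ _ _ Hmild).
  assert (Hmu0 : forall b, 0 <= b -> mu b = 0).
  { intros b Hb. unfold mu, entry_mu. rewrite Rmin_right by exact Hb. ring. }
  assert (Hinit : forall b, - N <= b <= 0 ->
    normsq (mu b + nu b * vi 0)%C <= S0 /\ normsq (vi (- b)) <= S0).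
  { intros b Hb. assert (Hab : Rabs b <= N) by (apply Rabs_le_between; lra).
    assert (E : (mu b + nu b * vi 0)%C = k b).
    { unfold mu, nu, entry_mu, entry_nu. rewrite Rmin_left, bpos_of_nonpos, c0 by lra. ring. }
    rewrite E. assert (H1 := Cmod_normsq _ _ (HBk' b Hab)).
    assert (H2 := Cmod_normsq _ _ (HBv' (- b) ltac:(rewrite Rabs_Ropp; exact Hab))).
    unfold S0. nra. }
  assert (HnuLa : forall b, 0 <= b <= N -> normsq (nu b) <= La).
  { intros b Hb. unfold nu, entry_nu. rewrite bpos_of_nonneg by lra.
    apply Cmod_normsq, HBn', Rabs_le_between; lra. }
  assert (Hdiss' : forall a b, reg s N a b -> 0 <= b -> normsq (nu b) <= dsg b).
  { intros a b Hab Hb. unfold nu, entry_nu. rewrite bpos_of_nonneg by exact Hb.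
    apply Hnub; [exact Hb|]. destruct (reg_box s N a b Hs Hab) as [_ [_ Ha]].
    destruct Hab; lra. }
  assert (bounds : forall a b, reg s N a b -> Cmod (U a b) <= r /\ Cmod (V a b) <= r).
  { intros a b Hab. split.
    - apply Rle_trans with (fwd_bound m beta N S0 La + 1); [|unfold r, B; lra].
      apply normsq_Cmod; [exact HB2|].
      apply (fwd_wave_bound s sg dsg mu nu vi m alpha beta r N S0 La f g); auto.
    - apply Rle_trans with (back_bound m beta N S0 + 1); [|unfold r, B; lra].
      apply normsq_Cmod; [exact HB1|].
      apply (back_wave_bound s sg dsg mu nu vi m alpha beta r N S0 f g); auto. }
  assert (Hf : forall a b, reg s N a b -> f a b = src m alpha beta (U a b) (V a b)).
  { intros a b Hab. destruct (bounds a b Hab) as [b1 b2].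
    rewrite <- (cut_src_src m alpha beta r) by assumption.
    now apply (mild_f _ _ _ _ _ _ _ _ _ Hmild). }
  assert (Hg : forall a b, reg s N a b -> g a b = src m alpha beta (V a b) (U a b)).
  { intros a b Hab. destruct (bounds a b Hab) as [b1 b2].
    rewrite <- (cut_src_src m alpha beta r) by assumption.
    now apply (mild_g _ _ _ _ _ _ _ _ _ Hmild). }
  assert (R0 : reg s N 0 0) by (split; [rewrite s0; lra|lra]).
  assert (V00 : V 0 0 = v0 0).
  { unfold V. rewrite <- Ropp_0 at 2. now rewrite back_wave_entry. }
  assert (U00 : U 0 0 = u0 0).
  { rewrite <- s0 at 1. unfold U. rewrite fwd_wave_entry, bpos_of_nonpos, s0 by lra.
    fold V. rewrite V00. unfold mu, nu, entry_mu, entry_nu.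
    rewrite Rmin_left, bpos_of_nonpos, <- vi0, <- c0, k0 by lra. ring. }
  assert (c1 : init_P dk f 0 = (boundary_P sg dsg vi nub dnub f g 0 + RtoC (dsg 0) * nub 0 * init_Q dvi g 0)%C).
  { unfold init_P, boundary_P, init_Q. rewrite sg0, Ropp_0. fold V.
    rewrite (Hf 0 0 R0), (Hg 0 0 R0), U00, V00, Kdk, Kdvi, Kdsg, Kdnub, nub0.
    unfold src. rewrite <- N1_N2.
    set (n1 := N1 alpha beta (u0 0) (v0 0)) in *. set (n2 := N2 alpha beta (u0 0) (v0 0)) in *.
    assert (Hq := hzt 0 ltac:(lra)).
    set (q := RtoC (1 - zt 0)) in *.
    assert (Hq0 : q <> 0).
    { unfold q. intros Hc. apply RtoC_inj in Hc. lra. }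
    assert (E1 : RtoC (1 + zt 0) = (RtoC 2 - q)%C).
    { unfold q. rewrite <- RtoC_minus. f_equal. ring. }
    assert (E2 : RtoC (2 / (1 - zt 0)) = (RtoC 2 / q)%C).
    { unfold q. now rewrite RtoC_div by lra. }
    rewrite RtoC_minus, E2. rewrite E1 in hcompat1.
    (* the corner condition is -2 / (1 - zt 0) times the compatibility condition *)
    set (X := (q * u0x 0 + lambda 0 * (RtoC 2 - q) * v0x 0
       + Ci * lambda 0 * (RtoC m * u0 0 - n2) - Ci * (RtoC m * v0 0 - n1) + lambdat 0 * v0 0)%C) in *.
    match goal with |- ?l = ?rr => assert (Hd : (l - rr = - (RtoC 2 / q) * X)%C) end.
    { unfold X. field. exact Hq0. }
    rewrite hcompat1 in Hd.
    match goal with |- ?l = ?rr => replace l with (l - rr + rr)%C by ring; rewrite Hd end. ring. }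
  destruct (derivative_system s sg dsg k dk vi dvi nub dnub m alpha beta N
     Hs Dsg Cdsg Dk Cdk Dvi Cdvi Dnub Cdnub f g Cf Cg) as [fP [gP [CfP [CgP HPQ]]]].
  set (P := fwd_wave s (mu_P sg dsg dk vi nub dnub f g) (nu_P dsg nub) (init_Q dvi g) fP gP).
  set (Q := back_wave (init_Q dvi g) gP).
  fold mu nu U V P Q in HPQ.
  assert (CU : cont2 U) by now apply cont2_fwd_wave.
  assert (CV : cont2 V) by now apply cont2_back_wave.
  assert (CP : cont2 P) by now apply P_continuous.
  assert (CQ : cont2 Q) by now apply Q_continuous.
  assert (DU : forall a b, s b < a -> 3 * a + b < N -> is_derive (fun b => U a b) b (P a b)).
  { exact (is_derive_U s sg dsg k dk vi dvi nub dnub m alpha beta N Hs Hsg Dsg Cdsg Dk Cdk Dvi Cdvi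
      Dnub Cdnub c0 f g Cf Cg c1 Hf Hg fP gP CfP CgP (fun a b H => proj1 (HPQ a b H))
      (fun a b H => proj2 (HPQ a b H))). }
  assert (DV : forall a b, s b < a -> 3 * a + b < N -> is_derive (fun a => V a b) a (Q a b)).
  { exact (is_derive_V s k dk vi dvi nub dnub m alpha beta N Hs Dk Dvi Cdvi Dnub f g Cf Cg Hg
      gP CgP (fun a b H => proj2 (HPQ a b H))). }
  set (chi := fun (W : R -> R -> C) (p : R * R) => W ((fst p + snd p) / 2) ((snd p - fst p) / 2)).
  assert (dom : forall x t, 0 <= t -> z t <= x -> x + 2 * t <= N -> reg s N ((x + t) / 2) ((t - x) / 2)).
  { intros x t Ht Hx HNx. split; [|lra].
    assert (HtN : 0 <= t <= N).
    { assert (Hlow := boundary_above_cone z zt t hz hzt hz0 Ht). lra. }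
    apply Hdom; replace ((x + t) / 2 + (t - x) / 2) with t by field; [exact HtN|].
    replace ((x + t) / 2 - (t - x) / 2) with x by field. exact Hx. }
  assert (tN : forall x t, reg s N ((x + t) / 2) ((t - x) / 2) -> 0 <= t <= N).
  { intros x t Hrg. assert (Ht := reg_time s N _ _ Hs Hrg).
    destruct (reg_box s N _ _ Hs Hrg) as [_ [_ Ha]]. destruct Hrg. lra. }
  exists (chi U), (chi V),
    (fun p => (RtoC (/ 2) * (chi f p - chi P p))%C), (fun p => (RtoC (/ 2) * (chi f p + chi P p))%C),
    (fun p => (RtoC (/ 2) * (chi Q p - chi g p))%C), (fun p => (RtoC (/ 2) * (chi Q p + chi g p))%C).
  split; [|split; [|split; [|split]]].
  - assert (cc : forall W, cont2 W -> forall p, continuous (chi W) p).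
    { intros W HW p. apply (cont2_comp W _ _ p HW); unfold Rdiv; cont. }
    assert (c3 := cc f Cf). assert (c4 := cc P CP). assert (c5 := cc Q CQ). assert (c6 := cc g Cg).
    assert (con : forall W : R * R -> C, (forall p, continuous W p) -> continuous_on (Omega z) W).
    { intros W HW. apply continuous_on_forall. intros p _. apply HW. }
    assert (half : forall W W' : R * R -> C, (forall p, continuous W p) -> (forall p, continuous W' p) ->
      (forall p, continuous (fun p => (RtoC (/ 2) * (W p - W' p))%C) p) /\
      (forall p, continuous (fun p => (RtoC (/ 2) * (W p + W' p))%C) p)).
    { intros W W' HW HW'. split; intros p; (apply continuous_Cmult; [apply continuous_const|]).
      - now apply continuous_Cminus.
      - now apply continuous_Cplus. }
    destruct (half _ _ c3 c4) as [e1 e2]. destruct (half _ _ c5 c6) as [e3 e4].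
    exact (conj (con _ (cc U CU)) (conj (con _ (cc V CV)) (conj (con _ e1) (conj (con _ e2)
      (conj (con _ e3) (con _ e4)))))).
  - intros x t Ht Hx HNx.
    assert (Hrg := dom x t ltac:(lra) ltac:(lra) ltac:(lra)).
    assert (HtN := tN x t Hrg).
    assert (Hstr : s ((t - x) / 2) < (x + t) / 2).
    { apply Hdoms; replace ((x + t) / 2 + (t - x) / 2) with t by field; [exact HtN|].
      replace ((x + t) / 2 - (t - x) / 2) with x by field. lra. }
    destruct (is_derive_half_sum x t) as [d1 [d2 [d3 d4]]].
    assert (DUb := DU _ _ Hstr ltac:(lra)). assert (DVa := DV _ _ Hstr ltac:(lra)).
    assert (DUa : forall a b, is_derive (fun a => U a b) a (f a b)) by (intros; now apply is_derive_fwd_wave).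
    assert (DVb : forall a b, is_derive (fun b => V a b) b (g a b)) by (intros; now apply is_derive_back_wave).
    assert (LU : forall X Y : R, locally (X, Y) (fun p : R * R =>
      is_derive (fun w => U w (snd p)) (fst p) (f (fst p) (snd p)))).
    { intros X Y. apply filter_forall. intros p. apply DUa. }
    assert (LV : forall X Y : R, locally (X, Y) (fun p : R * R =>
      is_derive (fun w => V (snd p) w) (fst p) (g (snd p) (fst p)))).
    { intros X Y. apply filter_forall. intros p. apply DVb. }
    set (a := (x + t) / 2) in *. set (b := (t - x) / 2) in *.
    assert (Cg' : continuous (fun p : R * R => g (snd p) (fst p)) (b, a)) by cont.
    unfold chi; simpl fst; simpl snd.
    split; [|split; [|split]].
    + evar_last; [exact (is_derive_along_curve U f (P a b) (fun y => (y + t) / 2) (fun y => (t - y) / 2)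
        x (/ 2) (- / 2) (LU _ _) DUb (Cf _) d1 d2)|]. cbv beta. fold a b. rewrite RtoC_opp. ring.
    + evar_last; [exact (is_derive_along_curve U f (P a b) (fun y => (x + y) / 2) (fun y => (y - x) / 2)
        t (/ 2) (/ 2) (LU _ _) DUb (Cf _) d3 d4)|]. cbv beta. fold a b. ring.
    + evar_last; [exact (is_derive_along_curve (fun b a => V a b) (fun b a => g a b) (Q a b)
        (fun y => (t - y) / 2) (fun y => (y + t) / 2)
        x (- / 2) (/ 2) (LV _ _) DVa Cg' d2 d1)|]. cbv beta. fold a b. rewrite RtoC_opp. ring.
    + evar_last; [exact (is_derive_along_curve (fun b a => V a b) (fun b a => g a b) (Q a b)
        (fun y => (y - x) / 2) (fun y => (x + y) / 2)
        t (/ 2) (/ 2) (LV _ _) DVa Cg' d4 d3)|]. cbv beta. fold a b. ring.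
  - intros [x t] [Ht Hx] HNx. simpl fst in *; simpl snd in *.
    assert (Hrg := dom x t Ht Hx HNx). unfold chi; simpl fst; simpl snd.
    rewrite <- Hf, <- Hg by exact Hrg.
    assert (h2 : (RtoC (/ 2) * RtoC 2)%C = 1).
    { rewrite <- RtoC_mult. f_equal. field. }
    assert (hh : forall w : C, (RtoC (/ 2) * RtoC 2 * w = w)%C) by (intros w; rewrite h2; ring).
    split.
    + rewrite <- (hh (f ((x + t) / 2) ((t - x) / 2))) at 3. ring.
    + rewrite <- (hh (g ((x + t) / 2) ((t - x) / 2))) at 3. ring.
  - intros x Hx. unfold chi; simpl fst; simpl snd.
    replace ((x + 0) / 2) with (- ((0 - x) / 2)) by field.
    set (b := (0 - x) / 2).
    assert (Hb : b <= 0) by (unfold b; lra).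
    split.
    + rewrite <- (entry_initial s Hs b Hb).
      unfold U. rewrite fwd_wave_entry, bpos_of_nonpos, s0 by exact Hb. fold V. rewrite V00, <- vi0.
      unfold mu, nu, entry_mu, entry_nu. rewrite Rmin_left, bpos_of_nonpos, c0 by exact Hb.
      transitivity (k b); [ring|]. rewrite Hk by (unfold b; lra). f_equal. unfold b; field.
    + rewrite <- (Ropp_involutive b) at 2. unfold V. rewrite back_wave_entry.
      rewrite Hvi by (unfold b; lra). f_equal. unfold b; field.
  - intros t Ht HNt. unfold chi; simpl fst; simpl snd.
    assert (Hrg := dom (z t) t Ht ltac:(lra) HNt). assert (HtN := tN _ _ Hrg).
    set (a := (z t + t) / 2) in *. set (b := (t - z t) / 2) in *.
    assert (Hab : a + b = t) by (unfold a, b; field).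
    assert (Hba : a - b = z t) by (unfold a, b; field).
    assert (Hsb : s b = a).
    { apply Rle_antisym; [apply Hrg|].
      destruct (Rle_dec a (s b)) as [|Hn]; [assumption|].
      assert (Hlt : s b < a) by lra.
      apply Hdoms in Hlt; [|lra]. rewrite Hab in Hlt. lra. }
    assert (Hb : 0 <= b).
    { destruct (Rle_dec 0 b) as [|Hn]; [assumption|]. exfalso.
      assert (Hx := entry_initial s Hs b ltac:(lra)).
      assert (Ht0 : t = 0) by lra. assert (z t = 0) by (rewrite Ht0; exact hz0). lra. }
    destruct (Hnub b Hb ltac:(lra)) as [E _]. rewrite Hsb, Hab in E.
    rewrite <- Hsb. unfold U. rewrite fwd_wave_entry, bpos_of_nonneg, Hmu0 by exact Hb.
    fold V. unfold nu, entry_nu. rewrite bpos_of_nonneg, E by exact Hb. ring.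
Qed.

End Data.

(** * Uniqueness *)

Lemma continuous_on_interior {X Y : UniformSpace} (D : X -> Prop) (f : X -> Y) (p : X) :
  continuous_on D f -> locally p D -> continuous f p.
Proof.
  intros Hf Hp P HP. assert (HD : D p) by now apply locally_singleton.
  specialize (Hf p HD P HP). unfold filtermap, within in *.
  refine (filter_imp _ _ _ (filter_and _ _ Hf Hp)). intros y [H1 H2]. now apply H1.
Qed.

(** Composing with this retraction turns functions continuous on the domain into
    functions continuous on the plane, to which the results on waves apply. *)
Definition retract (z : R -> R) (N : R) (p : R * R) : R * R :=
  (Rmax (fst p) (z (clamp N (snd p))), clamp N (snd p)).

Lemma retract_Omega z N p : 0 <= N -> Omega z (retract z N p).
Proof.
  intros HN. split; simpl; [now apply clamp_range|apply Rmax_r].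
Qed.

Lemma retract_id z N p : Omega z p -> snd p <= N -> retract z N p = p.
Proof.
  intros [H1 H2] HN. destruct p as [x t]. unfold retract; simpl in *.
  rewrite clamp_id by lra. now rewrite Rmax_left.
Qed.

Lemma continuous_retract {V : UniformSpace} z N (f : R * R -> V) (p : R * R) :
  0 <= N -> continuous_on half_line z -> continuous_on (Omega z) f ->
  continuous (fun q => f (retract z N q)) p.
Proof.
  intros HN Hz Hf P HP.
  specialize (Hf (retract z N p) (retract_Omega z N p HN) P HP).
  assert (Cz : forall q : R * R, continuous (fun q : R * R => z (clamp N (snd q))) q).
  { intros q. apply (continuous_comp (fun q : R * R => snd q) (fun y => z (clamp N y))); [cont|].
    now apply (continuous_clamp_half_line (V := R_UniformSpace)). }
  assert (C1 : continuous (fun q : R * R => Rmax (fst q) (z (clamp N (snd q)))) p).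
  { apply continuous_Rmax; [cont|apply Cz]. }
  assert (C2 : continuous (fun q : R * R => clamp N (snd q)) p).
  { apply clamp_continuous. cont. }
  assert (CR : filterlim (retract z N) (locally p) (locally (retract z N p))).
  { intros A [e He].
    destruct (C1 (ball (fst (retract z N p)) e) ltac:(exists e; auto)) as [d1 Hd1].
    destruct (C2 (ball (snd (retract z N p)) e) ltac:(exists e; auto)) as [d2 Hd2].
    exists (mkposreal (Rmin d1 d2) ltac:(apply Rmin_pos; apply cond_pos)).
    intros q Hq. apply He. split.
    - apply Hd1. eapply ball_le; [|exact Hq]. apply Rmin_l.
    - apply Hd2. eapply ball_le; [|exact Hq]. apply Rmin_r. }
  unfold filtermap, within in *. specialize (CR _ Hf). unfold filtermap in CR.
  refine (filter_imp _ _ _ CR). intros q Hq. apply Hq. now apply retract_Omega.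
Qed.

Lemma open_interior z N x t : continuous_on half_line z -> (forall t, 0 <= t -> - t <= z t) ->
  0 <= N -> 0 < t -> z t < x -> x + 2 * t < N ->
  locally (x, t) (fun q : R * R => 0 < snd q /\ z (snd q) < fst q /\ fst q + 2 * snd q < N).
Proof.
  intros Hz Hlow HN Ht Hx Hxt.
  assert (HtN : 0 <= t <= N) by (generalize (Hlow t ltac:(lra)); lra).
  set (G := fun q : R * R => Rmin (Rmin (snd q) (fst q - z (clamp N (snd q)))) (N - (fst q + 2 * snd q))).
  assert (CG : continuous G (x, t)).
  { unfold G. apply continuous_Rmin; [apply continuous_Rmin; [cont|]|cont].
    apply continuous_Rminus; [cont|].
    apply (continuous_comp (fun q : R * R => snd q) (fun y => z (clamp N y))); [cont|].
    now apply (continuous_clamp_half_line (V := R_UniformSpace)). }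
  assert (HG : 0 < G (x, t)).
  { unfold G; simpl. rewrite clamp_id by lra. repeat apply Rmin_pos; lra. }
  refine (filter_imp _ _ _ (continuous_R_eps G (x, t) CG _ HG)).
  intros [x' t'] Hq. apply Rabs_lt_between in Hq. assert (Hq' : 0 < G (x', t')) by lra.
  unfold G in Hq'; simpl in Hq'.
  generalize (Rmin_l (Rmin t' (x' - z (clamp N t'))) (N - (x' + 2 * t')))
    (Rmin_r (Rmin t' (x' - z (clamp N t'))) (N - (x' + 2 * t')))
    (Rmin_l t' (x' - z (clamp N t'))) (Rmin_r t' (x' - z (clamp N t'))). intros.
  simpl. assert (Ht' : 0 <= t' <= N).
  { split; [lra|]. destruct (Rle_dec t' N) as [|Hn]; [assumption|].
    assert (Hc : clamp N t' = N) by (unfold clamp; rewrite Rmin_right, Rmax_right; lra).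
    assert (Hl := Hlow N HN). rewrite Hc in *. lra. }
  rewrite clamp_id in * by lra. lra.
Qed.

Lemma src_lipschitz m al be M p q p' q' :
  Cmod p <= M -> Cmod q <= M -> Cmod p' <= M -> Cmod q' <= M ->
  Cmod (src m al be p q - src m al be p' q')%C
   <= (Rabs m + 3 * tri_bound al be * (2 * M * (2 * M))) * (Cmod (p - p')%C + Cmod (q - q')%C).
Proof.
  intros H1 H2 H3 H4. unfold src.
  replace (Ci * (RtoC m * q - N2 al be q p) - Ci * (RtoC m * q' - N2 al be q' p'))%C with
    (Ci * (RtoC m * (q - q') + - (N2 al be q p - N2 al be q' p')))%C by ring.
  rewrite Cmod_mult, Cmod_Ci, Rmult_1_l.
  eapply Rle_trans; [apply Cmod_triangle|]. rewrite Cmod_opp, Cmod_mult, Cmod_R.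
  assert (H := N2_lipschitz al be (2 * M) q p q' p' ltac:(lra) ltac:(lra)).
  assert (Rabs m * Cmod (q - q')%C <= Rabs m * (Cmod (p - p')%C + Cmod (q - q')%C)).
  { apply Rmult_le_compat_l; [apply Rabs_pos|]. generalize (Cmod_ge_0 (p - p')%C); lra. }
  lra.
Qed.

Section Uniqueness.

Context (m alpha beta : R) (z zt : R -> R) (lambda lambdat u0 u0x v0 v0x : R -> C).
Hypothesis hz : C1_half_line z zt.
Hypothesis hlambda : C1_half_line lambda lambdat.
Hypothesis hzt : forall t, 0 <= t -> -1 < zt t < 1.
Hypothesis hz0 : z 0 = 0.
Hypothesis hdiss : forall t, 0 <= t -> Cmod (lambda t) ^ 2 * (1 - zt t) <= 1 + zt t.
Hypothesis hu0 : C1_half_line u0 u0x.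
Hypothesis hv0 : C1_half_line v0 v0x.
Hypothesis hcompat0 : u0 0 = (lambda 0 * v0 0)%C.

(** Integrating along characteristics, a classical solution is a mild one. *)
Lemma classical_is_mild N s sg dsg k dk vi dvi nub dnub u v ux ut vx vt :
  0 <= N -> char_data z zt lambda lambdat u0 u0x v0 v0x N s sg dsg k dk vi dvi nub dnub ->
  classical_upto m alpha beta z lambda u0 v0 N u v ux ut vx vt ->
  exists U V, cont2 U /\ cont2 V /\
   (forall x t, Omega z (x, t) -> x + 2 * t <= N ->
      U ((x + t) / 2) ((t - x) / 2) = u (x, t) /\ V ((x + t) / 2) ((t - x) / 2) = v (x, t)) /\
   (forall a b, reg s N a b ->
      let f := fun a b => src m alpha beta (U a b) (V a b) in
      let g := fun a b => src m alpha beta (V a b) (U a b) in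
      U a b = fwd_wave s (entry_mu k) (entry_nu nub) vi f g a b /\ V a b = back_wave vi g a b).
Proof.
  intros HN HD [[Cu [Cv [Cux [Cut [Cvx Cvt]]]]] [Hder [Heq [Hini Hbd]]]].
  assert (Hs := cd_curve _ _ _ _ _ _ _ _ _ _ _ _ _ _ _ _ _ _ HD).
  destruct HD as [_ Hsg Dsg Cdsg Dk Cdk Dvi Cdvi Dnub Cdnub Hk Hvi Hnub Hdom Hdoms _].
  assert (s0 := entry_0 s Hs).
  assert (Cz := half_line_continuous _ _ hz).
  assert (Hlow : forall t, 0 <= t -> - t <= z t) by (intros; now apply (boundary_above_cone z zt)).
  set (U := fun a b => u (retract z N (a - b, a + b))).
  set (V := fun a b => v (retract z N (a - b, a + b))).
  assert (Cchar : forall w : R * R -> C, continuous_on (Omega z) w ->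
    cont2 (fun a b => w (retract z N (a - b, a + b)))).
  { intros w Cw. assert (CW : cont2 (fun x t => w (retract z N (x, t)))).
    { intros p. apply continuous_ext with (f := fun q => w (retract z N q)).
      - intros [x t]; reflexivity.
      - now apply continuous_retract. }
    intros p. apply (cont2_comp _ _ _ p CW); cont. }
  assert (CU := Cchar u Cu). assert (CV := Cchar v Cv). fold U in CU. fold V in CV.
  assert (ret : forall x t, Omega z (x, t) -> x + 2 * t <= N -> retract z N (x, t) = (x, t)).
  { intros x t [H1 H2] H3. simpl in *. apply retract_id; [now split|]. simpl.
    generalize (Hlow t H1); lra. }
  assert (Hchar : forall a b, Omega z (a - b, a + b) -> 3 * a + b <= N ->
    U a b = u (a - b, a + b) /\ V a b = v (a - b, a + b)).
  { intros a b H1 H2. unfold U, V. rewrite ret by (assumption || lra). split; reflexivity. }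
  assert (Hreg : forall a b, reg s N a b -> Omega z (a - b, a + b) /\ 0 <= a + b <= N).
  { intros a b Hab. assert (Ht := reg_time s N a b Hs Hab).
    destruct (reg_box s N a b Hs Hab) as [_ [_ Ha]]. destruct Hab as [H1 H2].
    assert (HtN : 0 <= a + b <= N) by lra. split; [|exact HtN].
    split; [exact Ht|]. now apply Hdom. }
  set (f := fun a b => src m alpha beta (U a b) (V a b)).
  set (g := fun a b => src m alpha beta (V a b) (U a b)).
  assert (Cf : cont2 f) by now apply cont2_src. assert (Cg : cont2 g) by now apply cont2_src.
  (* derivative along a characteristic with velocity c = 1 or -1 *)
  assert (along : forall (w wx wt : R * R -> C) (X Y : R -> R) (r c : R),
    continuous_on (Omega z) w -> continuous_on (Omega z) wx ->
    (forall x t, 0 < t -> z t < x -> x + 2 * t < N ->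
       is_derive (fun y => w (y, t)) x (wx (x, t)) /\ is_derive (fun r => w (x, r)) t (wt (x, t))) ->
    0 < Y r -> z (Y r) < X r -> X r + 2 * Y r < N -> is_derive X r c -> is_derive Y r 1 ->
    is_derive (fun y => w (retract z N (X y, Y y))) r (RtoC c * wx (X r, Y r) + wt (X r, Y r))%C).
  { intros w wx wt X Y r c Cw Cwx Hw H1 H2 H3 DX DY.
    assert (Hopen := open_interior z N (X r) (Y r) Cz Hlow HN H1 H2 H3).
    apply is_derive_ext_loc with (f := fun y => w (X y, Y y)).
    - assert (CX := is_derive_continuous_R _ _ _ DX). assert (CY := is_derive_continuous_R _ _ _ DY).
      destruct Hopen as [e He].
      generalize (continuous_R_eps X r CX e (cond_pos e)) (continuous_R_eps Y r CY e (cond_pos e)).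
      intros L1 L2. refine (filter_imp _ _ _ (filter_and _ _ L1 L2)). intros y [E1 E2].
      destruct (He (X y, Y y) (conj E1 E2)) as [K1 [K2 K3]]. simpl in K1, K2, K3.
      rewrite ret; [reflexivity| |lra]. split; simpl; lra.
    - replace (RtoC c * wx (X r, Y r) + wt (X r, Y r))%C with
        (RtoC c * wx (X r, Y r) + RtoC 1 * wt (X r, Y r))%C by ring.
      apply (is_derive_along_curve (fun x t => w (x, t)) (fun x t => wx (x, t)) (wt (X r, Y r)) X Y r c 1);
        auto.
      + refine (filter_imp _ _ _ Hopen). intros [x t] [K1 [K2 K3]]. now apply (Hw x t).
      + now apply (Hw (X r) (Y r)).
      + apply continuous_ext with (f := wx); [intros [x t]; reflexivity|].
        apply (continuous_on_interior (Omega z)); [exact Cwx|].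
        refine (filter_imp _ _ _ Hopen). intros q [K1 [K2 K3]]. split; lra. }
  assert (interior : forall a b, s b < a -> 3 * a + b < N ->
    0 < a + b /\ z (a + b) < a - b /\ (a - b) + 2 * (a + b) < N).
  { intros a b H1 H2. assert (Hr : reg s N a b) by (split; lra).
    destruct (Hreg a b Hr) as [_ Ht]. apply Hdoms in H1; [|exact Ht]. lra. }
  assert (VV : forall a b, reg s N a b -> V a b = back_wave vi g a b).
  { intros a b Hab. destruct (reg_box s N a b Hs Hab) as [_ [_ Ha]].
    assert (Ht := reg_time s N a b Hs Hab).
    assert (Rg : reg s N a (- a)) by (apply (reg_back_b s N a b); auto; lra).
    assert (Vi : V a (- a) = vi a).
    { destruct (Hreg _ _ Rg) as [O1 _]. destruct Hab as [_ Hn].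
      rewrite (proj2 (Hchar a (- a) O1 ltac:(lra))), Hvi by lra.
      replace (a - - a) with (2 * a) by ring. replace (a + - a) with 0 by ring. apply Hini; lra. }
    unfold back_wave. rewrite (derive_CInt_open (fun b => V a b) (fun b => g a b)).
    - rewrite Vi. ring.
    - lra.
    - intros; cont.
    - intros; cont.
    - intros b' Hb'.
      assert (Hsb : s b' < a).
      { destruct (Rle_dec b' 0) as [Hn|Hn]; [rewrite (entry_initial s Hs) by exact Hn; lra|].
        apply Rlt_le_trans with (s b); [apply (entry_increasing s Hs); lra|apply Hab]. }
      assert (HN' : 3 * a + b' < N) by (destruct Hab; lra).
      destruct (interior a b' Hsb HN') as [K1 [K2 K3]].
      assert (O : Omega z (a - b', a + b')) by (split; simpl; lra).
      assert (Hd := along v vx vt (fun y => a - y) (fun y => a + y) b' (-1) Cv Cvx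
        (fun x t h1 h2 h3 => proj2 (proj2 (Hder x t h1 h2 h3))) K1 K2 K3
        ltac:(auto_derive; [exact I|ring]) ltac:(auto_derive; [exact I|ring])).
      assert (E : (RtoC (-1) * vx (a - b', a + b')%R + vt (a - b', a + b')%R)%C = g a b').
      { unfold g. destruct (Hchar a b' O ltac:(lra)) as [-> ->].
        destruct (Heq _ O) as [_ <-]; [simpl; lra|].
        replace (RtoC (-1)) with (- (1))%C by (rewrite <- RtoC_opp; f_equal; ring). ring. }
      cbv beta. rewrite <- E. exact Hd. }
  assert (Ventry : forall a b, reg s N a b -> back_wave vi g (s (bpos b)) (bpos b) = V (s (bpos b)) (bpos b)).
  { intros a b Hab. symmetry. apply VV. now apply (reg_entry s N a b). }
  assert (UU : forall a b, reg s N a b -> U a b = fwd_wave s (entry_mu k) (entry_nu nub) vi f g a b).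
  { intros a b Hab. unfold fwd_wave. rewrite (Ventry a b Hab).
    assert (Ht := reg_time s N a b Hs Hab). destruct (reg_box s N a b Hs Hab) as [_ [_ Ha]].
    assert (Hge := entry_ge s b Hs).
    assert (Rg : reg s N (s b) b) by (apply (reg_back_a s N a); auto; destruct Hab; lra).
    destruct (Hreg _ _ Rg) as [O1 T1].
    assert (Hn : 3 * s b + b <= N) by apply Rg.
    assert (Ui : U (s b) b = (entry_mu k b + entry_nu nub b * V (s (bpos b)) (bpos b))%C).
    { destruct (Hchar _ _ O1 Hn) as [-> HVs]. unfold entry_mu, entry_nu.
      destruct (Rle_dec b 0) as [Hb|Hb].
      - rewrite Rmin_left, bpos_of_nonpos, s0 by exact Hb.
        assert (V00 : V 0 0 = v0 0).
        { assert (R0 : reg s N 0 0) by (split; [rewrite s0|]; lra).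
          rewrite (VV 0 0 R0). rewrite <- Ropp_0 at 2. rewrite back_wave_entry, Hvi by lra.
          f_equal; ring. }
        assert (S1 := entry_initial s Hs b Hb).
        rewrite V00, S1. replace (- b - b) with (- (2 * b)) by ring. replace (- b + b) with 0 by ring.
        rewrite (proj1 (Hini (- (2 * b)) ltac:(lra))).
        rewrite <- Hk by lra.
        assert (K0 : k 0 = u0 0) by (rewrite Hk by lra; f_equal; ring).
        destruct (Hnub 0 ltac:(lra) ltac:(rewrite s0; lra)) as [N0 _].
        rewrite K0, hcompat0, N0, s0, Rplus_0_r. ring.
      - rewrite Rmin_right, bpos_of_nonneg by lra.
        destruct (Hnub b ltac:(lra) ltac:(lra)) as [-> [Hz' _]].
        rewrite HVs. rewrite <- Hz'.
        rewrite (Hbd (s b + b)); [ring|lra|]. rewrite Hz'. lra. }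
    rewrite (derive_CInt_open (fun a => U a b) (fun a => f a b)).
    - rewrite <- Ui. ring.
    - apply Hab.
    - intros; cont.
    - intros; cont.
    - intros a' Ha'.
      assert (HN' : 3 * a' + b < N) by (destruct Hab; lra).
      destruct (interior a' b ltac:(lra) HN') as [K1 [K2 K3]].
      assert (O : Omega z (a' - b, a' + b)) by (split; simpl; lra).
      assert (Hd := along u ux ut (fun y => y - b) (fun y => y + b) a' 1 Cu Cux
        (fun x t h1 h2 h3 => conj (proj1 (Hder x t h1 h2 h3)) (proj1 (proj2 (Hder x t h1 h2 h3)))) K1 K2 K3
        ltac:(auto_derive; [exact I|ring]) ltac:(auto_derive; [exact I|ring])).
      assert (E : (RtoC 1 * ux (a' - b, a' + b)%R + ut (a' - b, a' + b)%R)%C = f a' b).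
      { unfold f. destruct (Hchar a' b O ltac:(lra)) as [-> ->].
        destruct (Heq _ O) as [<- _]; [simpl; lra|]. ring. }
      cbv beta. rewrite <- E. exact Hd. }
  exists U, V. split; [exact CU|]. split; [exact CV|]. split.
  - intros x t O Hxt. destruct (Hchar ((x + t) / 2) ((t - x) / 2)) as [-> ->];
      replace ((x + t) / 2 - (t - x) / 2) with x by field;
      replace ((x + t) / 2 + (t - x) / 2) with t by field; auto. lra.
  - intros a b Hab. split; [now apply UU|now apply VV].
Qed.

Theorem classical_upto_unique N u v ux ut vx vt u' v' ux' ut' vx' vt' :
  0 <= N ->
  classical_upto m alpha beta z lambda u0 v0 N u v ux ut vx vt ->
  classical_upto m alpha beta z lambda u0 v0 N u' v' ux' ut' vx' vt' ->
  forall x t, Omega z (x, t) -> x + 2 * t <= N -> u (x, t) = u' (x, t) /\ v (x, t) = v' (x, t).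
Proof.
  intros HN H H' x t O Hxt.
  destruct (char_data_exists z zt lambda lambdat u0 u0x v0 v0x N HN hz hlambda hzt hz0 hdiss hu0 hv0)
    as [s [sg [dsg [k [dk [vi [dvi [nub [dnub HD]]]]]]]]].
  destruct (classical_is_mild N s sg dsg k dk vi dvi nub dnub u v ux ut vx vt HN HD H)
    as [U [V [CU [CV [E M]]]]].
  destruct (classical_is_mild N s sg dsg k dk vi dvi nub dnub u' v' ux' ut' vx' vt' HN HD H')
    as [U' [V' [CU' [CV' [E' M']]]]].
  assert (Hs := cd_curve _ _ _ _ _ _ _ _ _ _ _ _ _ _ _ _ _ _ HD).
  assert (Cnub := continuous_of_derive nub dnub (cd_dnub _ _ _ _ _ _ _ _ _ _ _ _ _ _ _ _ _ _ HD)).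
  destruct (bound6 U V U' V' U V N CU CV CU' CV' CU CV) as [B [HB HBd]].
  set (L := Rabs m + 3 * tri_bound alpha beta * (2 * B * (2 * B))).
  assert (HL : 0 <= L).
  { unfold L. assert (Hc := tri_bound_nonneg alpha beta).
    assert (0 <= 3 * tri_bound alpha beta * (2 * B * (2 * B))) by (apply Rmult_le_pos; nra).
    generalize (Rabs_pos m); lra. }
  assert (Hab : reg s N ((x + t) / 2) ((t - x) / 2)).
  { destruct O as [O1 O2]; simpl in O1, O2.
    assert (Hlow := boundary_above_cone z zt t hz hzt hz0 O1).
    split; [|lra]. apply (cd_dom _ _ _ _ _ _ _ _ _ _ _ _ _ _ _ _ _ _ HD);
    replace ((x + t) / 2 + (t - x) / 2) with t by field; [lra|].
    replace ((x + t) / 2 - (t - x) / 2) with x by field. exact O2. }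
  destruct (mild_uniqueness s (entry_mu k) (entry_nu nub) vi
    (fun a b => src m alpha beta (U a b) (V a b)) (fun a b => src m alpha beta (V a b) (U a b))
    (fun a b => src m alpha beta (U' a b) (V' a b)) (fun a b => src m alpha beta (V' a b) (U' a b))
    N L Hs (entry_nu_cont nub Cnub) (cont2_src _ _ _ U V CU CV) (cont2_src _ _ _ V U CV CU)
    (cont2_src _ _ _ U' V' CU' CV') (cont2_src _ _ _ V' U' CV' CU') HL) with (a := (x + t) / 2) (b := (t - x) / 2) as [F1 F2]; [|exact Hab|].
  - intros a b Rab. destruct (M a b Rab) as [<- <-]. destruct (M' a b Rab) as [<- <-].
    destruct (reg_box s N a b Hs Rab) as [Ba [Bb _]].
    destruct (HBd a b Ba Bb) as [[b1 [b2 b3]] [b4 _]].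
    split; [now apply src_lipschitz|].
    rewrite (Rplus_comm (Cmod (U a b - U' a b)%C)). now apply src_lipschitz.
  - destruct (M _ _ Hab) as [M1 M2]. destruct (M' _ _ Hab) as [M1' M2'].
    destruct (E x t O Hxt) as [E1 E2]. destruct (E' x t O Hxt) as [E1' E2'].
    rewrite <- E1, <- E2, <- E1', <- E2', M1, M2, M1', M2'. split; assumption.
Qed.

End Uniqueness.

(** * The global solution *)

Lemma Omega_closed (z : R -> R) (p : R * R) : continuous_on half_line z -> closure_of (Omega z) p -> Omega z p.
Proof.
  intros Cz Hcl. destruct p as [x t].
  assert (Ht : 0 <= t).
  { destruct (Rle_dec 0 t) as [|Hn]; [assumption|].
    destruct (Hcl (fun q : R * R => Rabs (snd q - t) < - t)) as [q [Hq [Hq1 _]]].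
    - apply (continuous_R_eps (fun q : R * R => snd q) (x, t)); [cont|lra].
    - apply Rabs_lt_between in Hq. lra. }
  split; [exact Ht|]. simpl.
  destruct (Rle_dec (z t) x) as [|Hn]; [assumption|].
  set (G := fun q : R * R => fst q - z (clamp (t + 1) (snd q))).
  assert (CG : continuous G (x, t)).
  { unfold G. apply continuous_Rminus; [cont|].
    apply (continuous_comp (fun q : R * R => snd q) (fun y => z (clamp (t + 1) y))); [cont|].
    apply (continuous_clamp_half_line (V := R_UniformSpace)); [lra|exact Cz]. }
  destruct (Hcl (fun q : R * R => Rabs (G q - G (x, t)) < z t - x /\ Rabs (snd q - t) < 1))
    as [q [[Hq1 Hq2] [Hq3 Hq4]]].
  - apply filter_and.
    + apply (continuous_R_eps G (x, t) CG). lra.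
    + apply (continuous_R_eps (fun q : R * R => snd q) (x, t)); [cont|lra].
  - apply Rabs_lt_between in Hq1, Hq2. unfold G in Hq1; simpl in Hq1, Hq2.
    rewrite !clamp_id in Hq1 by lra. lra.
Qed.

Lemma continuous_on_weaken {X Y : UniformSpace} (D D' : X -> Prop) (f : X -> Y) :
  (forall x, D' x -> D x) -> continuous_on D f -> continuous_on D' f.
Proof.
  intros Hs Hf x Hx P HP. specialize (Hf x (Hs x Hx) P HP). unfold filtermap, within in *.
  refine (filter_imp _ _ _ Hf). intros y Hy Hy'. apply Hy, Hs, Hy'.
Qed.

Lemma is_derive_C_unique (f : R -> C) x l l' : is_derive f x l -> is_derive f x l' -> l = l'.
Proof.
  intros H H'. apply is_derive_C_iff in H, H'. destruct H as [H1 H2], H' as [H1' H2'].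
  apply is_derive_unique in H1, H2, H1', H2'. rewrite H1' in H1. rewrite H2' in H2.
  destruct l, l'; unfold Re, Im in *; simpl in *; now subst.
Qed.

Lemma interior_Omega (z : R -> R) (p : R * R) : interior_of (Omega z) p -> 0 < snd p /\ z (snd p) < fst p.
Proof.
  intros [e He]. destruct p as [x t]. simpl.
  assert (Hp := cond_pos e).
  assert (Hz : forall y, Rabs (y - y) < e) by (intros; now apply Rabs_same).
  assert (Hh : forall y, Rabs (y - e / 2 - y) < e).
  { intros y. replace (y - e / 2 - y) with (- (e / 2)) by ring. rewrite Rabs_Ropp, Rabs_pos_eq; lra. }
  split.
  - destruct (He (x, t - e / 2)) as [H _]; [split; [apply Hz|apply Hh]|]. simpl in H. lra.
  - destruct (He (x - e / 2, t)) as [_ H]; [split; [apply Hh|apply Hz]|]. simpl in H. lra.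
Qed.

Section Global.

Context (m alpha beta : R) (z zt : R -> R) (lambda lambdat u0 u0x v0 v0x : R -> C).
Hypothesis hm : 0 <= m.
Hypothesis hz : C1_half_line z zt.
Hypothesis hlambda : C1_half_line lambda lambdat.
Hypothesis hzt : forall t, 0 <= t -> -1 < zt t < 1.
Hypothesis hz0 : z 0 = 0.
Hypothesis hdiss : forall t, 0 <= t -> Cmod (lambda t) ^ 2 * (1 - zt t) <= 1 + zt t.
Hypothesis hu0 : C1_half_line u0 u0x.
Hypothesis hv0 : C1_half_line v0 v0x.
Hypothesis hcompat0 : u0 0 = (lambda 0 * v0 0)%C.

Let classical N u v ux ut vx vt := classical_upto m alpha beta z lambda u0 v0 N u v ux ut vx vt.

Lemma interior_near (x t N : R) : 0 < t -> z t < x -> x + 2 * t < N ->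
  locally (x, t) (fun q : R * R => 0 < snd q /\ z (snd q) < fst q /\ fst q + 2 * snd q < N).
Proof.
  intros Ht Hx HN. apply open_interior; auto.
  - exact (half_line_continuous _ _ hz).
  - intros r Hr. now apply (boundary_above_cone z zt).
  - generalize (boundary_above_cone z zt t hz hzt hz0 ltac:(lra)); lra.
Qed.

Lemma global_is_classical N u v : global_C1_solution m alpha beta z lambda u0 v0 u v ->
  exists ux ut vx vt, classical N u v ux ut vx vt.
Proof.
  intros [ux [ut [vx [vt [[Cu [Cux [Cut Du]]] [[Cv [Cvx [Cvt Dv]]] [Heq [Hini Hbd]]]]]]]].
  exists ux, ut, vx, vt.
  assert (Hsub : forall p, Omega z p -> closure_of (Omega z) p).
  { intros p Hp P HP. exists p. split; [now apply locally_singleton|exact Hp]. }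
  assert (con : forall w : R * R -> C, continuous_on (closure_of (Omega z)) w -> continuous_on (Omega z) w).
  { intros w. now apply continuous_on_weaken. }
  split; [|split; [|split; [|split]]].
  - exact (conj (con _ Cu) (conj (con _ Cv) (conj (con _ Cux) (conj (con _ Cut)
      (conj (con _ Cvx) (con _ Cvt)))))).
  - intros x t Ht Hx _.
    assert (Hi : interior_of (Omega z) (x, t)).
    { assert (Hn := interior_near x t (x + 2 * t + 1) Ht Hx ltac:(lra)).
      refine (filter_imp _ _ _ Hn). intros q [H1 [H2 _]]. split; lra. }
    destruct (Du x t Hi) as [D1 D2]. destruct (Dv x t Hi) as [D3 D4].
    exact (conj D1 (conj D2 (conj D3 D4))).
  - intros p Hp _. destruct (Heq p Hp) as [E1 E2].
    apply equation_src in E1. apply equation_src in E2. unfold src. rewrite <- N1_N2. now split.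
  - intros x Hx. apply Hini; lra.
  - intros t Ht _. now apply Hbd.
Qed.

(** The derivatives agree as well, up to the boundary, because the domain is the
    closure of its interior. *)
Lemma classical_agree N u v ux ut vx vt u' v' ux' ut' vx' vt' :
  classical N u v ux ut vx vt -> classical N u' v' ux' ut' vx' vt' ->
  forall p, Omega z p -> fst p + 2 * snd p < N ->
    u p = u' p /\ v p = v' p /\ ux p = ux' p /\ ut p = ut' p /\ vx p = vx' p /\ vt p = vt' p.
Proof.
  intros H H' p Hp HpN.
  assert (Hlow : forall q, Omega z q -> 0 <= fst q + 2 * snd q).
  { intros q [Q1 Q2]. generalize (boundary_above_cone z zt (snd q) hz hzt hz0 Q1); lra. }
  assert (HN : 0 <= N) by (generalize (Hlow p Hp); lra).
  assert (Eq : forall x t, Omega z (x, t) -> x + 2 * t <= N -> u (x, t) = u' (x, t) /\ v (x, t) = v' (x, t)).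
  { intros x t Hx Hxt.
    exact (classical_upto_unique m alpha beta z zt lambda lambdat u0 u0x v0 v0x hz hlambda hzt hz0
      hdiss hu0 hv0 hcompat0 N u v ux ut vx vt u' v' ux' ut' vx' vt' HN H H' x t Hx Hxt). }
  destruct H as [[_ [_ [Cux [Cut [Cvx Cvt]]]]] [Hd _]].
  destruct H' as [[_ [_ [Cux' [Cut' [Cvx' Cvt']]]]] [Hd' _]].
  (* in the interior the derivatives are determined by the functions *)
  assert (inside : forall x t, 0 < t -> z t < x -> x + 2 * t < N ->
    ux (x, t) = ux' (x, t) /\ ut (x, t) = ut' (x, t) /\ vx (x, t) = vx' (x, t) /\ vt (x, t) = vt' (x, t)).
  { intros x t Ht Hx HxN.
    destruct (Hd x t Ht Hx HxN) as [D1 [D2 [D3 D4]]].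
    destruct (Hd' x t Ht Hx HxN) as [D1' [D2' [D3' D4']]].
    destruct (interior_near x t N Ht Hx HxN) as [e He].
    assert (Heq : forall q, ball (x, t) e q -> u' q = u q /\ v' q = v q).
    { intros [x' t'] Hq. destruct (He _ Hq) as [Q1 [Q2 Q3]]. simpl in Q1, Q2, Q3.
      destruct (Eq x' t' ltac:(split; simpl; lra) ltac:(lra)) as [E1 E2]. now split. }
    assert (Hself : forall y : R, ball y e y) by (intros; apply ball_center).
    repeat split; eapply is_derive_C_unique; try eassumption;
    (eapply is_derive_ext_loc; [|eassumption]); exists e; intros y Hy; apply Heq; split; auto. }
  assert (limit : forall w w' : R * R -> C, continuous_on (Omega z) w -> continuous_on (Omega z) w' ->
    (forall x t, 0 < t -> z t < x -> x + 2 * t < N -> w (x, t) = w' (x, t)) -> w p = w' p).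
  { intros w w' Cw Cw' Hww. apply Cmod_sub_eq_0.
    apply le_epsilon. intros e He. rewrite Rplus_0_l.
    assert (near : forall w : R * R -> C, continuous_on (Omega z) w ->
       exists d : posreal, forall q, ball p d q -> Omega z q -> Cmod (w q - w p)%C < e / 2).
    { intros w1 Cw1.
      destruct (Cw1 p Hp (fun y => Cmod (y - w1 p)%C < e / 2)) as [d Hd1].
      - assert (Cid : continuous (fun y : C => y) (w1 p)) by apply continuous_id.
        apply (proj1 (continuous_C_eps (fun y : C => y) (w1 p)) Cid). lra.
      - exists d. intros q Hq Hq'. now apply Hd1. }
    destruct (near w Cw) as [d1 N1']. destruct (near w' Cw') as [d2 N2'].
    (* the boundary is slower than 1, so a step (2 h, h) leads into the interior *)
    set (h := Rmin (Rmin (d1 / 3) (d2 / 3)) ((N - (fst p + 2 * snd p)) / 5)).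
    assert (Hh : 0 < h).
    { generalize (cond_pos d1) (cond_pos d2); intros. repeat apply Rmin_pos; lra. }
    assert (Hh' : h <= d1 / 3 /\ h <= d2 / 3 /\ h <= (N - (fst p + 2 * snd p)) / 5).
    { unfold h. generalize (Rmin_l (Rmin (d1 / 3) (d2 / 3)) ((N - (fst p + 2 * snd p)) / 5))
        (Rmin_r (Rmin (d1 / 3) (d2 / 3)) ((N - (fst p + 2 * snd p)) / 5))
        (Rmin_l (d1 / 3) (d2 / 3)) (Rmin_r (d1 / 3) (d2 / 3)). lra. }
    destruct p as [x t]. destruct Hp as [P1 P2]. simpl in *.
    assert (Hsp := boundary_speed z zt t (t + h) hz hzt P1 ltac:(lra)).
    apply Rabs_le_between in Hsp.
    assert (Hb : forall d : posreal, h <= d / 3 -> ball (x, t) d (x + 2 * h, t + h)).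
    { intros d Hdh. assert (Hdp := cond_pos d). split; simpl; apply Rabs_lt_between;
      unfold minus, plus, opp; simpl; lra. }
    assert (HO : Omega z (x + 2 * h, t + h)) by (split; simpl; lra).
    assert (E1 := N1' _ (Hb d1 ltac:(lra)) HO). assert (E2 := N2' _ (Hb d2 ltac:(lra)) HO).
    rewrite <- (Hww (x + 2 * h) (t + h)) in E2 by lra.
    replace (w (x, t) - w' (x, t))%C with
      (- (w (x + 2 * h, t + h)%R - w (x, t)) + (w (x + 2 * h, t + h)%R - w' (x, t)))%C by ring.
    eapply Rle_trans; [apply Cmod_triangle|]. rewrite Cmod_opp. lra. }
  assert (E0 : u p = u' p /\ v p = v' p) by (destruct p as [x t]; apply Eq; simpl in HpN; auto; lra).
  destruct E0 as [E1 E2].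
  repeat split; auto; apply limit; auto; intros x t h1 h2 h3; now apply inside.
Qed.

(** By [classical_agree] the value at a point does not depend on the triangle it is
    computed in, as long as that contains the point in its interior. *)
Theorem global_of_classical :
  (forall N, 0 <= N -> exists u v ux ut vx vt, classical N u v ux ut vx vt) ->
  exists u v, global_C1_solution m alpha beta z lambda u0 v0 u v.
Proof.
  intros Hex.
  assert (Hex' : forall n : nat, exists w : nat -> R * R -> C,
    classical (INR n) (w 0%nat) (w 1%nat) (w 2%nat) (w 3%nat) (w 4%nat) (w 5%nat)).
  { intros n. destruct (Hex (INR n) (pos_INR n)) as [u [v [ux [ut [vx [vt H]]]]]].
    exists (fun i => match i with 0 => u | 1 => v | 2 => ux | 3 => ut | 4 => vx | _ => vt end%nat).
    exact H. }
  set (sol := fun n => proj1_sig (constructive_indefinite_description _ (Hex' n))).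
  assert (Hsol : forall n, classical (INR n) (sol n 0%nat) (sol n 1%nat) (sol n 2%nat)
     (sol n 3%nat) (sol n 4%nat) (sol n 5%nat)).
  { intros n. unfold sol. apply proj2_sig. }
  (* the triangle of index level p contains a neighbourhood of p *)
  set (level := fun p : R * R => Z.to_nat (up (fst p + 2 * snd p))).
  assert (Hlevel : forall p, fst p + 2 * snd p < INR (level p)).
  { intros p. unfold level. destruct (archimed (fst p + 2 * snd p)) as [H _].
    eapply Rlt_le_trans; [exact H|]. rewrite INR_IZR_INZ. apply IZR_le. lia. }
  assert (shrink : forall N N' u v ux ut vx vt, N <= N' -> classical N' u v ux ut vx vt ->
    classical N u v ux ut vx vt).
  { intros N N' u v ux ut vx vt HN [H1 [H2 [H3 [H4 H5]]]].
    split; [exact H1|]. split; [|split; [|split]].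
    - intros; apply H2; lra.
    - intros; apply H3; [assumption|lra].
    - intros; apply H4; lra.
    - intros; apply H5; lra. }
  set (W := fun i p => sol (level p) i p).
  assert (HW : forall i n q, (i <= 5)%nat -> Omega z q -> fst q + 2 * snd q < INR n -> W i q = sol n i q).
  { intros i n q Hi Hq Hn. unfold W.
    set (N := Rmin (INR n) (INR (level q))).
    assert (Hc := classical_agree N _ _ _ _ _ _ _ _ _ _ _ _
      (shrink N _ _ _ _ _ _ _ (Rmin_r _ _) (Hsol (level q)))
      (shrink N _ _ _ _ _ _ _ (Rmin_l _ _) (Hsol n)) q Hq
      ltac:(apply Rmin_glb_lt; [exact Hn|apply Hlevel])).
    destruct Hc as [K0 [K1 [K2 [K3 [K4 K5]]]]].
    do 6 (destruct i as [|i]; [assumption|]). lia. }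
  assert (near : forall p : R * R, locally p (fun q : R * R => fst q + 2 * snd q < INR (level p))).
  { intros p.
    assert (Hc : continuous (fun q : R * R => fst q + 2 * snd q) p) by cont.
    assert (Hp := Hlevel p).
    assert (Hpos : 0 < INR (level p) - (fst p + 2 * snd p)) by lra.
    refine (filter_imp _ _ _ (continuous_R_eps _ p Hc _ Hpos)).
    intros q Hq. apply Rabs_lt_between in Hq. lra. }
  assert (contW : forall i, (i <= 5)%nat -> continuous_on (closure_of (Omega z)) (W i)).
  { intros i Hi. apply (continuous_on_weaken (Omega z)).
    { intros p. apply Omega_closed. exact (half_line_continuous _ _ hz). }
    intros p Hp. rewrite (HW i (level p) p Hi Hp (Hlevel p)).
    assert (Hci : continuous_on (Omega z) (sol (level p) i)).
    { destruct (Hsol (level p)) as [[K0 [K1 [K2 [K3 [K4 K5]]]]] _].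
      do 6 (destruct i as [|i]; [assumption|]). lia. }
    apply (filterlim_ext_loc (sol (level p) i)); [|now apply Hci].
    unfold within. refine (filter_imp _ _ _ (near p)). intros q Hq Hq'. symmetry. now apply HW. }
  assert (derW : forall x t, interior_of (Omega z) (x, t) ->
    (is_derive (fun y => W 0%nat (y, t)) x (W 2%nat (x, t)) /\
     is_derive (fun r => W 0%nat (x, r)) t (W 3%nat (x, t))) /\
    (is_derive (fun y => W 1%nat (y, t)) x (W 4%nat (x, t)) /\
     is_derive (fun r => W 1%nat (x, r)) t (W 5%nat (x, t)))).
  { intros x t Hi. destruct (interior_Omega z (x, t) Hi) as [Ht Hx]. simpl in Ht, Hx.
    assert (HO : Omega z (x, t)) by (split; simpl; lra).
    assert (Hl := Hlevel (x, t)).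
    destruct (filter_and _ _ Hi (near (x, t))) as [e He].
    set (n := level (x, t)) in *.
    assert (Eq : forall i q, (i <= 5)%nat -> ball (x, t) e q -> sol n i q = W i q).
    { intros i q Hin Hq. destruct (He q Hq) as [H1 H2]. symmetry. now apply HW. }
    assert (Hself : forall y : R, ball y e y) by (intros; apply ball_center).
    destruct (Hsol n) as [_ [Hd _]].
    destruct (Hd x t Ht Hx Hl) as [D1 [D2 [D3 D4]]].
    rewrite (HW 2%nat n), (HW 3%nat n), (HW 4%nat n), (HW 5%nat n) by (lia || assumption).
    split; split; (eapply is_derive_ext_loc; [|eassumption]);
      exists e; intros y Hy; apply Eq; [lia|split; auto|lia|split; auto|lia|split; auto|lia|split; auto]. }
  exists (W 0%nat), (W 1%nat), (W 2%nat), (W 3%nat), (W 4%nat), (W 5%nat).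
  split; [|split; [|split; [|split]]].
  - split; [now apply contW; lia|]. split; [now apply contW; lia|]. split; [now apply contW; lia|].
    intros x t Hi. now apply derW.
  - split; [now apply contW; lia|]. split; [now apply contW; lia|]. split; [now apply contW; lia|].
    intros x t Hi. now apply derW.
  - intros p Hp. assert (Hl := Hlevel p).
    rewrite !(HW _ (level p) p) by (lia || assumption).
    destruct (Hsol (level p)) as [_ [_ [Heq _]]]. destruct (Heq p Hp ltac:(lra)) as [E1 E2].
    split; apply equation_src; [rewrite N1_N2|]; assumption.
  - intros x Hx. assert (HO : Omega z (x, 0)) by (split; simpl; [lra|rewrite hz0; lra]).
    assert (Hl := Hlevel (x, 0)). rewrite !(HW _ (level (x, 0)) (x, 0)) by (lia || assumption).
    destruct (Hsol (level (x, 0))) as [_ [_ [_ [Hini _]]]]. apply Hini. simpl in Hl. lra.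
  - intros t Ht. assert (HO : Omega z (z t, t)) by (split; simpl; lra).
    assert (Hl := Hlevel (z t, t)). rewrite !(HW _ (level (z t, t)) (z t, t)) by (lia || assumption).
    destruct (Hsol (level (z t, t))) as [_ [_ [_ [_ Hbd]]]]. apply Hbd; [exact Ht|]. simpl in Hl. lra.
Qed.

End Global.
Theorem theorem1p1 (m alpha beta : R) (z zt : R -> R)
    (lambda lambdat : R -> C) (u0 u0x v0 v0x : R -> C)
    (hm : 0 <= m)
    (hz : C1_half_line z zt)
    (hlambda : C1_half_line lambda lambdat)
    (hzt : forall t : R, 0 <= t -> -1 < zt t < 1)
    (hz0 : z 0 = 0)
    (hdiss : forall t : R, 0 <= t ->
       Cmod (lambda t) ^ 2 * (1 - zt t) <= 1 + zt t)
    (hu0 : C1_half_line u0 u0x)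
    (hv0 : C1_half_line v0 v0x)
    (hu0supp : compactly_supported_half_line u0)
    (hv0supp : compactly_supported_half_line v0)
    (hcompat0 : u0 0 = (lambda 0 * v0 0)%C)
    (hcompat1 :
       (RtoC (1 - zt 0)%R * u0x 0
        + lambda 0 * RtoC (1 + zt 0)%R * v0x 0
        + Ci * lambda 0 * (RtoC m * u0 0 - N2 alpha beta (u0 0) (v0 0))
        - Ci * (RtoC m * v0 0 - N1 alpha beta (u0 0) (v0 0))
        + lambdat 0 * v0 0)%C = RtoC 0) :
  exists u v : R * R -> C,
    global_C1_solution m alpha beta z lambda u0 v0 u v /\
    (forall u' v' : R * R -> C,
       global_C1_solution m alpha beta z lambda u0 v0 u' v' ->
       forall p : R * R, closure_of (Omega z) p -> u' p = u p /\ v' p = v p).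

Proof.
  destruct (global_of_classical m alpha beta z zt lambda lambdat u0 u0x v0 v0x hz hlambda hzt hz0
    hdiss hu0 hv0 hcompat0) as [u [v Huv]].
  { intros N HN. now apply (classical_upto_exists m alpha beta z zt lambda lambdat u0 u0x v0 v0x). }
  exists u, v. split; [exact Huv|].
  intros u' v' Huv' p Hp.
  assert (HO : Omega z p) by (apply Omega_closed; [exact (half_line_continuous _ _ hz)|exact Hp]).
  set (N := fst p + 2 * snd p + 1).
  destruct (global_is_classical m alpha beta z zt lambda u0 v0 hz hzt hz0 N u v Huv)
    as [ux [ut [vx [vt H]]]].
  destruct (global_is_classical m alpha beta z zt lambda u0 v0 hz hzt hz0 N u' v' Huv')
    as [ux' [ut' [vx' [vt' H']]]].
  destruct (classical_agree m alpha beta z zt lambda lambdat u0 u0x v0 v0x hz hlambda hzt hz0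
    hdiss hu0 hv0 hcompat0 N _ _ _ _ _ _ _ _ _ _ _ _ H' H p HO) as [E1 [E2 _]].
  - unfold N; lra.
  - now split.
Qed.
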